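(* Let $n \ge 11$ be an integer, let $a$ be a real number with $0 \le a \le 4$, and let $G$ be a graph on $n$ vertices with at most $n - 4 + a$ missing edges. Then there is a fractional triangle packing in $G$ with total uncovered weight at most $a$, such that every triangle has weight at most $1/2$.
   Context: Graphs are finite and simple. The number of missing edges in a graph $G$ is the number of (unordered) pairs of distinct vertices that are not edges of $G$. A fractional triangle packing in a graph $G$ is an assignment $\omega$ of weights in $[0,1]$ to the triangles of $G$ such that $\sum_{w \in V(G)} \omega(uvw) \le 1$ for every edge $uv$ of $G$, where $\omega(uvw) = 0$ if $uvw$ is not a triangle in $G$. For an edge $e = uv$ of $G$ write $\omega(e) = \sum_{w \in V(G)} \omega(uvw)$. The (total) uncovered weight in $\omega$ is $\sum_{e \in E(G)} (1 - \omega(e))$. *)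

(* Defs.v *)
From HB Require Import structures.
From mathcomp Require Import all_boot all_order all_algebra.
From mathcomp Require Import reals.

Set Implicit Arguments.
Unset Strict Implicit.
Unset Printing Implicit Defensive.

Import Order.TTheory GRing.Theory Num.Theory.
Local Open Scope ring_scope.

(* A simple graph is a symmetric irreflexive relation [e] on a finType; edges,
   missing edges and triangles are vertex sets, so that they are unordered. *)

Definition edges (T : finType) (e : rel T) : {set {set T}} :=
  [set [set u; v] | u in T, v in T & e u v].

Definition missing_edges (T : finType) (e : rel T) : {set {set T}} :=
  [set [set u; v] | u in T, v in T & (u != v) && ~~ e u v].

Definition triangle (T : finType) (e : rel T) (t : {set T}) : bool :=
  (#|t| == 3) && [forall u in t, forall v in t, (u != v) ==> e u v].

(* [omega(f)] is the sum over all vertices [w] of [omega(f + w)]; when [w] is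
   an end of the edge [f], [w |: f] has two elements, hence is not a triangle
   and contributes 0 for any [omega] supported on triangles. *)
Definition edge_weight (R : realType) (T : finType) (omega : {set T} -> R)
    (f : {set T}) : R :=
  \sum_(w : T) omega (w |: f).

Record fractional_triangle_packing (R : realType) (T : finType) (e : rel T)
    (omega : {set T} -> R) : Prop := FractionalTrianglePacking {
  packing_weight01 : forall t, triangle e t -> 0 <= omega t <= 1;
  packing_support : forall t, ~~ triangle e t -> omega t = 0;
  packing_edge : forall f, f \in edges e -> edge_weight omega f <= 1
}.

Definition uncovered_weight (R : realType) (T : finType) (e : rel T)
    (omega : {set T} -> R) : R :=
  \sum_(f in edges e) (1 - edge_weight omega f).

(* Main.v *)
From Stdlib Require Import BinNums BinPos.
Require Import Defs.
From mathcomp Require Import all_boot all_order all_algebra all_fingroup.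
From mathcomp Require Import reals.
From mathcomp Require Import zify ring lra.

Set Implicit Arguments.
Unset Strict Implicit.
Unset Printing Implicit Defensive.

Import Order.TTheory GRing.Theory Num.Theory.

(** Costs dual to packings. Fix a set [A] of vertices and a set [F] of missing pairs. For a cost [c] on the
    present pairs, [excess A F c] is the minimum of [\sum_p (1 - omega(p)) c(p)] over all weightings [omega]
    of the triangles by numbers in [0, 1/2]: each triangle takes weight 1/2 if its total cost is positive and
    0 otherwise. By Farkas' lemma a packing with uncovered weight at most [K] exists as soon as the excess is
    at most [K * M] for every cost bounded by [M] ([strong_duality]). The excess is linear enough to be
    averaged, is concave, and reacts in a controlled way when a pair is declared missing or present, so the
    whole argument is carried out on the dual side. The claim becomes [deficit_bound k n]: on [n] vertices
    with at most [n - 4 + k] missing pairs the excess is at most [k * mu]. It is proved for [n >= 11] and [k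
    <= 4] by induction on [n], for which the hypothesis on the cost is relaxed: instead of bounding each cost
    by [mu], it bounds by [mu] the mean of any two of them and by [2 mu] each of them.

    Induction step. Deleting a vertex of missing degree [d] leaves the deficit [k + 1 - d], or 0 for a hub,
    which has [d > k + 1] and wastes [d - k - 1]. The average over all deletions ([excess_average]) tolerates
    a total waste of [n - 8] on [n] vertices; up to this amount it gives the bound ([average_suffices]). A
    vertex [x] whose missing degree is about a third of [n] or more is treated alone: its neighbourhood
    contains a 2-factor up to a few defects, whose edges together with [x] form triangles covering nearly all
    edges at [x] ([hub]). If few vertices are not isolated in the graph of missing pairs, or for [k = 4] and
    large [n] at most two thirds of them, explicit packings work ([spread_few], [spread_many]). In the
    remaining cases the waste is recovered ([recover_step]): the bound for [A] minus an isolated vertex [z] is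
    attained only if two pairs are dear, and then the triangles that [z] forms with these pairs contribute to
    the averaging identity, unless the pairs at [z] are cheap; in that case the hubs, after whose deletion too
    few pairs are missing, can give up some of those cheap pairs. For [k = 4] deleting an isolated vertex
    would need the claim for [k = 5]; there one missing pair is declared present instead ([excess_forget],
    [recover_step_four]).

    Base. For [n = 11] deletion leads to ten vertices, where all graphs with at most seven missing pairs, or
    with eight missing pairs and missing degrees at most 4, are listed up to isomorphism together with weights
    for their triangles. Evaluation shows that the list is closed under adding a pair, hence complete, and
    that the weights form packings. Up to six pairs they cover everything, and for seven pairs they do except
    for five graphs. Adding up over the deleted vertices gives the claim on eleven vertices, except when a
    deletion meets one of these graphs, which is settled by further weights on eleven vertices, and when [k =
    4] and four vertices have missing degree 4, where a packing of ten vertices is modified near the eleventh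
    ([excess_through]). *)

(** * Pairs, triangles and missing degrees *)

Section Pairs.
Variables (T : finType).
Implicit Types (A B N : {set T}) (F S C : {set {set T}}) (p q t : {set T}).

Definition pairs A : {set {set T}} := [set p : {set T} | (p \subset A) && (#|p| == 2)].
Definition present A F := pairs A :\: F.
Definition triangles A F : {set {set T}} :=
  [set t : {set T} | [&& t \subset A, #|t| == 3 & [disjoint pairs t & F]]].
Definition missing A F := #|F :&: pairs A|.
Definition degree A F v := #|[set p in F :&: pairs A | v \in p]|.
Definition neighbours A F x := [set u in A | (u != x) && ([set x; u] \notin F)].

Lemma pairsP A p :
  reflect (exists u v, [/\ u \in A, v \in A, u != v & p = [set u; v]]) (p \in pairs A).
Proof.
rewrite inE; apply: (iffP andP).
  case=> sA /cards2P[u [v [uv ep]]].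
  by exists u, v; rewrite uv !(subsetP sA) // ep !inE eqxx ?orbT.
by case=> u [v [uA vA uv ->]]; rewrite cards2 uv subUset !sub1set uA vA.
Qed.

Lemma mem_pairs2 A u v : ([set u; v] \in pairs A) = [&& u \in A, v \in A & u != v].
Proof. by rewrite inE cards2 subUset !sub1set -andbA; case: (u == v). Qed.

Lemma card_pair A p : p \in pairs A -> #|p| = 2.
Proof. by rewrite inE => /andP[_ /eqP]. Qed.

Lemma pair_sub A p : p \in pairs A -> p \subset A.
Proof. by rewrite inE => /andP[]. Qed.

Lemma pairsS A B : A \subset B -> pairs A \subset pairs B.
Proof.
move=> sAB; apply/subsetP => p; rewrite !inE => /andP[sp ->].
by rewrite (subset_trans sp sAB).
Qed.

Lemma pairsD1 A v p : (p \in pairs (A :\ v)) = (p \in pairs A) && (v \notin p).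
Proof. by rewrite !inE subsetD1 andbAC. Qed.

Lemma set2_inj (u v x y : T) :
  [set u; v] = [set x; y] -> (u = x /\ v = y) \/ (u = y /\ v = x).
Proof.
move=> e; have := set21 u v; have := set22 u v; rewrite e !inE.
have := set21 x y; have := set22 x y; rewrite -e !inE.
do 4!case/orP=> /eqP ?; subst; by [left|right].
Qed.

Lemma card_pairs A : #|pairs A| = 'C(#|A|, 2).
Proof. by rewrite -cards_draws. Qed.

Lemma missingD1 A F v : (missing (A :\ v) F + degree A F v = missing A F)%N.
Proof.
rewrite /missing /degree -(cardsID [set p : {set T} | v \in p] (F :&: pairs A)) addnC.
congr (_ + _)%N; apply: eq_card => p; rewrite !inE ?andbT //.
by rewrite subsetD1; case: (v \in p); rewrite ?andbT ?andbF //= andbC andbA.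
Qed.

Lemma handshake A F : (\sum_(v in A) degree A F v = 2 * missing A F)%N.
Proof.
transitivity (\sum_(v in A) \sum_(p in F :&: pairs A) (v \in p))%N.
  apply: eq_bigr => v _; rewrite /degree -sum1_card big_mkcond /= [RHS]big_mkcond /=.
  by apply: eq_bigr => p _; rewrite !inE; case: (v \in p); rewrite ?andbT ?andbF //; case: ifP.
rewrite exchange_big /= /missing -sum1_card big_distrr /=.
apply: eq_bigr => p; rewrite inE => /andP[_ pA].
rewrite muln1 -(card_pair pA) -sum1_card.
rewrite [RHS](eq_bigl (fun v => (v \in A) && (v \in p))); last first.
  by move=> v; case vp: (v \in p); rewrite ?andbF // (subsetP (pair_sub pA) _ vp).
by rewrite big_mkcondr.
Qed.

Lemma degree_neighbours A F x : x \in A ->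
  (#|neighbours A F x| + degree A F x + 1 = #|A|)%N.
Proof.
move=> xA.
have -> : degree A F x = #|[set u in A | (u != x) && ([set x; u] \in F)]|.
  rewrite -(@card_in_imset _ _ (fun u => [set x; u])); last first.
    move=> u v; rewrite !inE => /and3P[_ ux _] /and3P[_ vx _] /setP/(_ v).
    by rewrite !inE eqxx orbT (negPf vx) /= => /eqP ->.
  apply: eq_card => p; rewrite !inE; apply/idP/imsetP.
    case/andP=> /andP[pF pA] xp.
    have [u ux ep] : exists2 u, u != x & p = [set x; u].
      have /cards1P[u eu] : #|p :\ x| == 1%N.
        by case/andP: pA => _ /eqP pc; have := cardsD1 x p; rewrite xp pc; case: #|_| => [|[]].
      have : u \in p :\ x by rewrite eu set11.
      by rewrite !inE => /andP[ux _]; exists u => //; rewrite -eu setD1K.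
    exists u => //; rewrite inE ux -ep pF /= andbT.
    by case/andP: pA => sp _; apply: (subsetP sp); rewrite ep !inE eqxx orbT.
  case=> u; rewrite inE => /and3P[uA ux uF] ->.
  by rewrite uF !inE eqxx /= subUset !sub1set xA uA cards2 (eq_sym x) ux.
rewrite (cardsD1 x A) xA addnC; congr addn.
rewrite -(cardsID [set u | [set x; u] \in F] (A :\ x)) addnC.
congr (_ + _)%N; apply: eq_card => u; rewrite !inE ?andbT;
  by case: (u \in A); case: (u == x) => //=; case: (_ \in F).
Qed.

End Pairs.

(** * The excess of a cost *)

Section Excess.
Local Open Scope ring_scope.
Variables (R : realFieldType) (T : finType).
Implicit Types (A B N : {set T}) (F S C : {set {set T}}) (p q t : {set T}).
Implicit Types (c : {set T} -> R).

Definition cost c t : R := \sum_(p in pairs t) c p.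
(** The optimum of the linear program in the triangle weights with objective [c]: each triangle takes
    weight 1/2 or 0 according to the sign of its cost. *)
Definition excess A F c : R :=
  \sum_(p in present A F) c p - 2^-1 * \sum_(t in triangles A F) Num.max 0 (cost c t).

Lemma max0_ge0 (x : R) : 0 <= Num.max 0 x. Proof. by rewrite le_max lexx. Qed.
Lemma max0_ge (x : R) : x <= Num.max 0 x. Proof. by rewrite le_max lexx orbT. Qed.

Lemma sum_subset (I : finType) (A B : {set I}) (f : I -> R) :
  A \subset B -> (forall i, i \in B -> 0 <= f i) -> \sum_(i in A) f i <= \sum_(i in B) f i.
Proof.
move=> sAB f0; rewrite [leRHS](big_setID A) /= (setIidPr sAB) lerDl.
by apply: sumr_ge0 => i; rewrite inE => /andP[_ /f0].
Qed.

Lemma triangles_pairs A F t p :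
  t \in triangles A F -> p \in pairs t -> p \in present A F.
Proof.
rewrite !inE => /and3P[tA _ dis] pt.
have pt' : p \in pairs t by rewrite inE.
rewrite (disjointFr dis pt') /=; case/andP: pt => pt ->.
by rewrite (subset_trans pt tA).
Qed.

(** Any admissible weighting [w] bounds the excess, because 1/2 of the positive part of a triangle cost
    dominates [w] times the cost. *)
Lemma weak_duality A F c (w : {set T} -> R) :
  (forall t, t \in triangles A F -> 0 <= w t <= 2^-1) ->
  excess A F c <= \sum_(p in present A F)
    (1 - \sum_(t in triangles A F | p \subset t) w t) * c p.
Proof.
move=> hw; rewrite /excess.
have -> : \sum_(p in present A F) (1 - \sum_(t in triangles A F | p \subset t) w t) * c p =
   \sum_(p in present A F) c p - \sum_(t in triangles A F) w t * cost c t.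
  under eq_bigr do rewrite mulrBl mul1r mulr_suml.
  rewrite sumrB; congr (_ - _).
  rewrite (exchange_big_dep (fun t => t \in triangles A F)) /=; last by move=> p t _ /andP[].
  apply: eq_bigr => t tA; rewrite /cost mulr_sumr; apply: eq_bigl => p.
  rewrite tA /=; apply/andP/idP => [[pA pt]|pt].
    by rewrite inE pt; move: pA; rewrite !inE => /andP[_ /andP[]].
  by rewrite (triangles_pairs tA pt) (pair_sub pt).
rewrite lerD2l lerN2 mulr_sumr; apply: ler_sum => t tA.
have /andP[w0 w1] := hw _ tA.
apply: le_trans (ler_wpM2l w0 (max0_ge _)) _.
by apply: ler_wpM2r => //; exact: max0_ge0.
Qed.

(** Declaring a set [S] of pairs missing only removes triangles, so it loses at most the cost of [S]
    itself. *)
Lemma excess_add A F S c : S \subset present A F ->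
  excess A F c <= excess A (F :|: S) c + \sum_(p in S) c p.
Proof.
move=> sS; rewrite /excess.
have -> : \sum_(p in present A F) c p =
  \sum_(p in present A (F :|: S)) c p + \sum_(p in S) c p.
  rewrite (big_setID S) /= addrC; congr (_ + _); apply: eq_bigl => p.
    by rewrite !inE negb_or; case: (p \in S); rewrite ?andbT ?andbF.
  by rewrite inE andbC; case pS: (p \in S) => //=; rewrite (subsetP sS).
have : \sum_(t in triangles A (F :|: S)) Num.max 0 (cost c t) <=
       \sum_(t in triangles A F) Num.max 0 (cost c t).
  apply: sum_subset => [|t _]; last exact: max0_ge0.
  apply/subsetP => t; rewrite !inE => /and3P[-> -> /=].
  exact: disjointWr (subsetUl _ _).
lra.
Qed.

Lemma sum_pairsU1 x A (f : {set T} -> R) : x \notin A ->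
  \sum_(p in pairs (x |: A)) f p = \sum_(p in pairs A) f p + \sum_(u in A) f [set x; u].
Proof.
move=> xA; rewrite (big_setID (pairs A)) /= (setIidPr (pairsS (subsetUr _ _))).
congr (_ + _); rewrite (_ : _ :\: _ = [set [set x; u] | u in A]).
  rewrite big_imset //= => u v uA vA /setP/(_ v); rewrite !inE eqxx orbT.
  by move/orP=> [/eqP vx|/eqP //]; rewrite -vx vA in xA.
apply/setP => p; rewrite inE; apply/andP/imsetP => [[npA /pairsP[u [v [uA vA uv ep]]]]|[u uA ->]].
  move: uA vA; rewrite !inE => /predU1P[eu|uA] /predU1P[ev|vA].
  - by rewrite eu ev eqxx in uv.
  - by exists v; rewrite // ep eu.
  - by exists u; rewrite // ep ev setUC.
  - by rewrite ep mem_pairs2 uA vA uv in npA.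
rewrite !mem_pairs2 setU11 setU1r // (negPf xA) /=; split => //.
by apply: contraNneq xA => ->.
Qed.

Lemma pairs_pair A p : p \in pairs A -> pairs p = [set p].
Proof.
move=> pA; have cp := card_pair pA; apply/setP => q; rewrite !inE.
apply/andP/eqP => [[sq /eqP cq]|->]; last by rewrite cp.
by apply/eqP; rewrite eqEcard sq cq cp.
Qed.

Lemma cost_add x p : x \notin p -> #|p| = 2%N -> forall c,
  cost c (x |: p) = c p + \sum_(u in p) c [set x; u].
Proof.
move=> xp cp c; have pp : p \in pairs p by rewrite inE subxx cp.
by rewrite /cost sum_pairsU1 // (pairs_pair pp) big_set1.
Qed.

Lemma sum_present A F (f : {set T} -> R) :
  \sum_(p in present A F) f p = \sum_(p in pairs A) (if p \in F then 0 else f p).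
Proof.
rewrite big_mkcond [RHS]big_mkcond /=; apply: eq_bigr => p _; rewrite !inE.
by case: (p \in F) => //=; case: ifP.
Qed.

Lemma present_split A F x c : x \in A ->
  \sum_(p in present A F) c p =
  \sum_(p in present (A :\ x) F) c p + \sum_(u in neighbours A F x) c [set x; u].
Proof.
move=> xA; rewrite !sum_present -{1}(setD1K xA) sum_pairsU1 ?setD11 //.
congr (_ + _); rewrite big_mkcond [RHS]big_mkcond /=; apply: eq_bigr => u _.
by rewrite !inE; case: (u \in A); rewrite ?andbF //= andbT; case: (u == x) => //=; case: ifP.
Qed.

Lemma present_neighbours A F x p : p \in present (neighbours A F x) F ->
  [/\ p \in present A F, x \notin p, #|p| = 2%N
     & {in p, forall u, [set x; u] \in present A F \/ x \notin A}].
Proof.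
rewrite inE => /andP[pF pN]; have sp := pair_sub pN; split.
- rewrite inE pF /=; apply: (subsetP (pairsS _)) pN.
  by apply/subsetP => u; rewrite inE => /andP[].
- by apply/negP => /(subsetP sp); rewrite !inE eqxx andbF.
- exact: card_pair pN.
move=> u /(subsetP sp); rewrite inE => /and3P[uA ux uF].
case xA: (x \in A); [left|by right].
by rewrite inE uF mem_pairs2 xA uA eq_sym.
Qed.

Lemma triangles_at A F x : x \in A ->
  [set t in triangles A F | x \in t] = [set x |: p | p in present (neighbours A F x) F].
Proof.
move=> xA; apply/setP => t; rewrite inE; apply/andP/imsetP.
  case=> tA xt; exists (t :\ x); last by rewrite setD1K.
  have ct : #|t| = 3%N by move: tA; rewrite inE => /and3P[_ /eqP].
  have pt : t :\ x \in pairs t.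
    by rewrite inE subD1set; have := cardsD1 x t; rewrite xt ct; case: #|_| => [|[|[]]].
  have := triangles_pairs tA pt; rewrite !inE => /andP[-> /andP[_ ->]].
  rewrite andbT /=; apply/subsetP => u; rewrite !inE => /andP[ux ut].
  have pu : [set x; u] \in pairs t by rewrite mem_pairs2 xt ut eq_sym.
  have := triangles_pairs tA pu; rewrite !inE => /andP[-> _].
  by rewrite ux; move: tA; rewrite inE => /and3P[sA _ _]; rewrite (subsetP sA).
case=> p pN ->; have [pA xp cp hx] := present_neighbours pN.
rewrite setU11; split => //; rewrite inE cardsU1 xp cp /=.
rewrite subUset sub1set xA; move: (pA); rewrite inE => /andP[pF ppA].
rewrite (pair_sub ppA) /=; rewrite disjoint_subset; apply/subsetP => q.
rewrite -(setU1K xp) => /pairsP[u [v [uA vA uv ->]]].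
have H w : w \in p -> [set x; w] \notin F.
  by move=> wp; have [|] := hx w wp; rewrite ?xA // inE => /andP[].
rewrite inE /=; move: uA vA; rewrite setU1K // => /setU1P[eu|up] /setU1P[ev|vp].
- by rewrite eu ev eqxx in uv.
- by rewrite eu; apply: H.
- by rewrite ev setUC; apply: H.
suff -> : [set u; v] = p by [].
by apply/eqP; rewrite eqEcard subUset !sub1set cards2 uv cp up vp.
Qed.

Lemma trianglesD1 A F x :
  [set t in triangles A F | x \notin t] = triangles (A :\ x) F.
Proof. by apply/setP => t; rewrite !inE subsetD1; do ?case: (_ \subset _); case: (x \in t); rewrite ?andbT ?andbF. Qed.

Lemma sum_triangles_split A F x (f : {set T} -> R) : x \in A ->
  \sum_(t in triangles A F) f t =
  \sum_(t in triangles (A :\ x) F) f t + \sum_(p in present (neighbours A F x) F) f (x |: p).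
Proof.
move=> xA; rewrite (bigID (fun t : {set T} => x \in t)) /= addrC; congr (_ + _).
  by apply: eq_bigl => t; rewrite -trianglesD1 [RHS]inE.
rewrite (eq_bigl (mem [set x |: p | p in present (neighbours A F x) F])); last first.
  by move=> t; rewrite -triangles_at // !inE.
rewrite big_imset //= => p q pN qN.
have [_ xp _ _] := present_neighbours pN; have [_ xq _ _] := present_neighbours qN.
by move=> e; rewrite -(setU1K xp) e setU1K.
Qed.

(** The triangles at [x] are the pairs present inside its neighbourhood. *)
Lemma excess_split A F x c : x \in A ->
  excess A F c = excess (A :\ x) F c + \sum_(u in neighbours A F x) c [set x; u]
   - 2^-1 * \sum_(p in present (neighbours A F x) F)
       Num.max 0 (c p + \sum_(u in p) c [set x; u]).
Proof.
move=> xA; rewrite /excess (present_split _ _ xA) (sum_triangles_split _ _ xA).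
have -> : \sum_(p in present (neighbours A F x) F) Num.max 0 (cost c (x |: p)) =
  \sum_(p in present (neighbours A F x) F) Num.max 0 (c p + \sum_(u in p) c [set x; u]).
  apply: eq_bigr => p pN; have [_ xp cp _] := present_neighbours pN.
  by rewrite cost_add.
by ring.
Qed.

Lemma sum_out (f : {set T} -> R) A B : B \subset A ->
  \sum_(v in A) (if v \in B then 0 else 1 : R) = (#|A| - #|B|)%:R.
Proof.
move=> sBA; rewrite (bigID (mem B)) /= big1 ?add0r => [|v /andP[_ ->] //].
rewrite (eq_bigr (fun=> 1)) => [|v /andP[_ /negPf -> //]]; rewrite (eq_bigl (mem (A :\: B))).
  by rewrite sumr_const cardsD (setIidPr sBA).
by move=> v; rewrite !inE andbC; case: (v \in B).
Qed.

(** A pair survives the deletion of [#|A| - 2] vertices and a triangle that of [#|A| - 3]; the difference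
    is the term in the triangles, which is what the induction step can recover. *)
Lemma excess_average A F c : (2 < #|A|)%N ->
  (#|A|%:R - 2) * excess A F c =
  \sum_(v in A) excess (A :\ v) F c - 2^-1 * \sum_(t in triangles A F) Num.max 0 (cost c t).
Proof.
move=> A2; rewrite /excess sumrB -mulr_sumr.
have -> : \sum_(v in A) \sum_(p in present (A :\ v) F) c p =
    (#|A|%:R - 2) * \sum_(p in present A F) c p.
  under eq_bigr => v vA.
    rewrite (_ : \sum_(p in _) _ = \sum_(p in present A F) (if v \in p then 0 else 1) * c p).
      over.
    rewrite !sum_present big_mkcond [RHS]big_mkcond /=; apply: eq_bigr => p _.
    by rewrite pairsD1; case: (p \in pairs A); case: (v \in p); case: (p \in F); rewrite /= ?mul1r ?mul0r.
  rewrite exchange_big mulr_sumr; apply: eq_bigr => p pA /=; rewrite -mulr_suml.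
  move: pA; rewrite inE => /andP[_ pA]; rewrite (sum_out c (pair_sub pA)) (card_pair pA).
  by rewrite natrB // ltnW.
have -> : \sum_(v in A) \sum_(t in triangles (A :\ v) F) Num.max 0 (cost c t) =
    (#|A|%:R - 3) * \sum_(t in triangles A F) Num.max 0 (cost c t).
  under eq_bigr => v vA.
    rewrite (_ : \sum_(t in _) _ = \sum_(t in triangles A F) (if v \in t then 0 else 1) * Num.max 0 (cost c t)).
      over.
    rewrite big_mkcond [RHS]big_mkcond /=; apply: eq_bigr => t _.
    by rewrite -trianglesD1 inE; case: (t \in _); case: (v \in t); rewrite /= ?mul1r ?mul0r.
  rewrite exchange_big mulr_sumr; apply: eq_bigr => t tA /=; rewrite -mulr_suml.
  move: tA; rewrite inE => /and3P[sA /eqP ct _]; rewrite (sum_out c sA) ct.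
  by rewrite natrB.
by field.
Qed.

Definition cdeg C u := #|[set p in C | u \in p]|.

(** The triangles over the pairs of [C] get weight 1/2, and so cover one half of the edges from [x] to the
    two ends of each pair of [C], and one half of that pair. Where [C] has degree 2 the edge at [x] is
    fully covered. *)
Lemma excess_link A F x C c : x \in A -> C \subset present (neighbours A F x) F ->
  excess A F c <= excess (A :\ x) F c
    + \sum_(u in neighbours A F x) (1 - (cdeg C u)%:R / 2) * c [set x; u]
    - 2^-1 * \sum_(p in C) c p.
Proof.
move=> xA sC; rewrite (excess_split _ _ xA).
set N := neighbours A F x.
have h : \sum_(p in C) (c p + \sum_(u in p) c [set x; u]) <=
   \sum_(p in present N F) Num.max 0 (c p + \sum_(u in p) c [set x; u]).
  apply: le_trans (sum_subset sC _); last by move=> p _; exact: max0_ge0.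
  by apply: ler_sum => p _; exact: max0_ge.
have e : \sum_(p in C) \sum_(u in p) c [set x; u] = \sum_(u in N) (cdeg C u)%:R * c [set x; u].
  under [RHS]eq_bigr => u _.
    rewrite (_ : _ * _ = \sum_(p in C) if u \in p then c [set x; u] else 0).
      over.
    rewrite -big_mkcondr /= (eq_bigl (mem [set p in C | u \in p])); last by move=> p; rewrite /= inE.
    by rewrite sumr_const mulr_natl.
  rewrite exchange_big /=; apply: eq_bigr => p /(subsetP sC); rewrite inE => /andP[_ pN].
  rewrite -big_mkcondr /=; apply: eq_bigl => u.
  by case up: (u \in p); rewrite ?andbF // (subsetP (pair_sub pN)).
have -> : \sum_(u in N) (1 - (cdeg C u)%:R / 2) * c [set x; u] =
  \sum_(u in N) c [set x; u] - 2^-1 * \sum_(u in N) (cdeg C u)%:R * c [set x; u].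
  by rewrite mulr_sumr -sumrB; apply: eq_bigr => u _; field.
move: h; rewrite big_split /= e; lra.
Qed.

End Excess.

(** * Two-factors in graphs with few missing pairs *)

Section TwoFactor.
Variables (T : finType).
Implicit Types (A B N : {set T}) (F S C : {set {set T}}) (p q t : {set T}).

Lemma card_set_pairs A C : C \subset pairs A -> (2 * #|C| = \sum_(v in A) cdeg C v)%N.
Proof.
move=> sC; have := handshake A C; rewrite /missing (setIidPl sC) => <-.
by apply: eq_bigr => v _; rewrite /degree (setIidPl sC).
Qed.

Lemma two_regular_card A C : C \subset pairs A -> {in A, forall v, cdeg C v = 2} -> #|C| = #|A|.
Proof.
move=> sC C2; have := card_set_pairs sC.
have -> : (\sum_(v in A) cdeg C v = \sum_(v in A) 2)%N by apply: eq_bigr.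
by rewrite sum_nat_const mulnC => /eqP; rewrite eqn_pmul2r // => /eqP.
Qed.

Lemma present_pairs A F : present A F \subset pairs A.
Proof. exact: subsetDl. Qed.

Lemma missingU A F S : (missing A (F :|: S) <= missing A F + #|S|)%N.
Proof.
rewrite /missing setIUl; apply: leq_trans (leq_card_setU _ _) _.
by rewrite leq_add2l subset_leq_card // subsetIl.
Qed.

Lemma missing0 A F : missing A F = 0%N -> present A F = pairs A.
Proof.
by move/eqP; rewrite cards_eq0 setI_eq0 => d; apply/setDidPl; rewrite disjoint_sym.
Qed.

Lemma degree_set A F x : x \in A ->
  degree A F x = #|[set u in A | (u != x) && ([set x; u] \in F)]|.
Proof.
move=> xA; have := degree_neighbours F xA; have := cardsD1 x A; rewrite xA.
rewrite -(cardsID [set u | [set x; u] \in F] (A :\ x)).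
set a := #|_ :&: _|; set b := #|_ :\: _|.
have -> : #|neighbours A F x| = b.
  by apply: eq_card => u; rewrite !inE; case: (u \in A); case: (u == x); case: (_ \in F).
have -> : #|[set u in A | (u != x) && ([set x; u] \in F)]| = a.
  by apply: eq_card => u; rewrite !inE; case: (u \in A); case: (u == x); case: (_ \in F).
lia.
Qed.

(** A vertex [v] of minimal positive missing degree [d] has [d] neighbours of missing degree at least [d]
    in the missing graph, so [d (d + 1)] is at most twice the number of missing pairs; this forces [2 d <
    #|N| - 1]. *)
Lemma insertion_vertex N F : (3 < #|N|)%N -> (missing N F + 3 <= #|N|)%N ->
  exists2 v, v \in N & (2 * degree N F v < #|N| - 1)%N /\ (missing (N :\ v) F + 4 <= #|N|)%N.
Proof.
move=> N3 mN; have [m0|mpos] := posnP (missing N F).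
  have /card_gt0P[v vN] : (0 < #|N|)%N by apply: leq_trans N3.
  exists v => //; have := missingD1 N F v; lia.
have [v0 v0N d0] : exists2 v, v \in N & (0 < degree N F v)%N.
  apply/exists_inP; rewrite -[X in is_true X]negbK negb_exists_in; apply/negP => /forall_inP h.
  have := handshake N F; rewrite big1; first lia.
  by move=> v vN; apply/eqP; rewrite -leqn0 leqNgt; apply: h.
have [v /andP[vN dv] vmin] := @arg_minnP _ v0 (fun v => (v \in N) && (0 < degree N F v)%N) (degree N F) (introT andP (conj v0N d0)).
exists v => //; split; last by have := missingD1 N F v; lia.
set D := [set u in N | (u != v) && ([set v; u] \in F)].
have cD : #|D| = degree N F v by rewrite (degree_set F vN).
have vD : v \notin D by rewrite inE eqxx andbF.
have dD u : u \in v |: D -> (degree N F v <= degree N F u)%N.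
  rewrite inE => /orP[|]; first by rewrite inE => /eqP ->.
  rewrite inE => /and3P[uN uv uF]; apply: vmin; rewrite uN (degree_set F uN) /=.
  by apply/card_gt0P; exists v; rewrite inE vN eq_sym uv setUC.
have sD : v |: D \subset N by rewrite subUset sub1set vN; apply/subsetP => u; rewrite inE => /andP[].
have : ((degree N F v).+1 * degree N F v <= 2 * missing N F)%N.
  rewrite -handshake (big_setID (v |: D)) /= (setIidPr sD).
  apply: leq_trans (leq_addr _ _); rewrite -{1}cD.
  have -> : (#|D|.+1 = #|v |: D|)%N by rewrite cardsU1 vD.
  by rewrite -sum_nat_const; apply: leq_sum.
nia.
Qed.

Lemma cdeg_setU1 C p u : p \notin C -> cdeg (p |: C) u = ((u \in p) + cdeg C u)%N.
Proof.
rewrite /cdeg (cardsD1 p) !inE eqxx /=; move=> pC; congr addn; apply: eq_card => q; rewrite !inE.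
by case: (q =P p) => [->|]; rewrite ?(negPf pC).
Qed.

(** Induction on the number of vertices: [v] is inserted into an edge of a 2-factor of the rest, which is
    possible as the missing neighbours of [v] touch at most [2 d < #|N| - 1] of its edges. *)
Lemma two_factor N F : (2 < #|N|)%N -> (missing N F + 3 <= #|N|)%N ->
  exists2 C : {set {set T}}, C \subset present N F & {in N, forall v, cdeg C v = 2}.
Proof.
have [n] := ubnP #|N|; elim: n N => // n IH N; rewrite ltnS => lN N2 mN.
have [N3|N3] := leqP #|N| 3.
  have m0 : missing N F = 0%N by lia.
  exists (pairs N); first by rewrite missing0.
  move=> v vN; have := degree_neighbours (pairs N) vN.
  rewrite /degree setIid -/(cdeg _ _) (_ : neighbours _ _ _ = set0); first by rewrite cards0; lia.
  apply/setP => u; rewrite !inE; apply/and3P => -[uN uv].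
  by rewrite cards2 subUset !sub1set uN vN (eq_sym v) uv.
have [v vN [dv mv]] := insertion_vertex N3 mN.
have cN' : #|N :\ v| = #|N|.-1 by have := cardsD1 v N; rewrite vN; lia.
have [||| C sC C2] := IH (N :\ v); [lia|lia|lia|].
have sCp := subset_trans sC (present_pairs _ _).
have cC : #|C| = #|N :\ v|.
  exact: two_regular_card.
set D := [set u in N | (u != v) && ([set v; u] \in F)].
have cD : #|D| = degree N F v by rewrite (degree_set F vN).
(* An edge of the 2-factor with both ends joined to [v]: the [d] missing neighbours of [v] lie on at most
   [2 d] of the [#|N| - 1] edges. *)
have [p pC pD] : exists2 p, p \in C & [disjoint p & D].
  apply/exists_inP; rewrite -[X in is_true X]negbK negb_exists_in; apply/negP => /forall_inP h.
  have : (#|C| <= \sum_(p in C) \sum_(u in D) (u \in p))%N.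
    rewrite -sum1_card; apply: leq_sum => p pC.
    have /pred0Pn[u /andP[up uD]] := h _ pC.
    by rewrite (bigD1 u) //= [u \in p]up.
  rewrite exchange_big /=.
  suff -> : (\sum_(u in D) \sum_(p in C) (u \in p) = \sum_(u in D) 2)%N.
    rewrite sum_nat_const cD cC cN'; lia.
  apply: eq_bigr => u; rewrite inE => /and3P[uN uv _].
  rewrite -(C2 u) ?inE ?uv // /cdeg -sum1_card [RHS]big_mkcond [LHS]big_mkcond /=.
  by apply: eq_bigr => q _; rewrite !inE; case: (q \in C) => //; case: (u \in q).
have /pairsP[a [b [aN bN ab ep]]] := subsetP sCp _ pC.
have ok u : u \in p -> u \in N :\ v -> [set v; u] \in present N F.
  move=> up; rewrite !inE => /andP[uv uN].
  have := disjointFr pD up; rewrite inE uN uv /= => ->.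
  by rewrite subUset !sub1set uN vN cards2 (eq_sym v) uv.
have ha := ok a _ aN; have hb := ok b _ bN.
have va : [set v; a] \notin C.
  by apply: contraTN isT => /(subsetP sCp); rewrite mem_pairs2 !inE eqxx.
have vb : [set v; b] \notin C.
  by apply: contraTN isT => /(subsetP sCp); rewrite mem_pairs2 !inE eqxx.
have vab : [set v; a] != [set v; b].
  apply: contraNneq ab => /setP/(_ a); rewrite !inE eqxx orbT => /esym/orP[/eqP av|//].
  by move: aN; rewrite av !inE eqxx.
exists ([set v; a] |: ([set v; b] |: (C :\ p))).
  rewrite !subUset !sub1set ha ?hb ?ep ?inE ?eqxx ?orbT //=.
  apply: subset_trans (subD1set _ _) _; apply: subset_trans sC _.
  by apply: setSD; apply: pairsS; exact: subD1set.
move=> u uN.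
have e1 : cdeg C u = ((u \in p) + cdeg (C :\ p) u)%N.
  by rewrite -cdeg_setU1 ?setD1K // !inE eqxx.
rewrite !cdeg_setU1 ?inE ?negb_or ?vab ?(negPf va) ?(negPf vb) ?andbF //.
move: e1; rewrite ep !inE.
have [->|uv] := eqVneq u v.
  have -> : cdeg (C :\ [set a; b]) v = 0%N.
    apply/eqP; rewrite cards_eq0; apply/eqP/setP => q; rewrite !inE.
    apply/negP => /andP[/andP[_ /(subsetP sCp)]]; rewrite pairsD1 => /andP[_ /negPf ->].
    by [].
  by [].
rewrite (C2 u) ?inE ?uv //=.
have [->|ua] := eqVneq u a; first by rewrite (negPf ab) /= add0n => <-.
by rewrite /= add0n => <-.
Qed.

Lemma subset_card (I : finType) (A : {set I}) m : (m <= #|A|)%N -> exists2 B : {set I}, B \subset A & #|B| = m.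
Proof.
elim: m => [|m IH] mA; first by exists set0; rewrite ?sub0set ?cards0.
have [|B sB cB] := IH; first exact: ltnW.
have /card_gt0P[x] : (0 < #|A :\: B|)%N by rewrite cardsD (setIidPr sB) cB subn_gt0.
rewrite inE => /andP[xB xA]; exists (x |: B); first by rewrite subUset sub1set xA.
by rewrite cardsU1 xB cB.
Qed.

(** A 2-factor through an outside vertex [x] joined to everything; without the two edges at [x] it leaves
    a defect at [u] and at [v]. *)
Lemma near_factor N F x : (1 < #|N|)%N -> (missing N F + 2 <= #|N|)%N -> x \notin N ->
  exists (C : {set {set T}}) u v, [/\ C \subset present N F, #|C|.+1 = #|N|, [/\ u \in N, v \in N & u != v]
     & {in N, forall w, (cdeg C w + (w == u) + (w == v) = 2)%N}].
Proof.
move=> N1 mN xN; pose F' := F :&: pairs N.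
have cx : #|x |: N| = #|N|.+1 by rewrite cardsU1 xN.
have mx : missing (x |: N) F' = missing N F.
  by rewrite /missing /F' -setIA (setIidPl (pairsS (subsetUr _ _))).
have [||C sC C2] := two_factor (N := x |: N) (F := F'); [lia|lia|].
have sCp := subset_trans sC (present_pairs _ _).
have := C2 _ (setU11 _ _); move/eqP/cards2P => [p [q [pq epq]]].
have other r : r \in C -> x \in r -> exists2 u, u \in N & r = [set x; u].
  move=> /(subsetP sCp) /pairsP[u [v [uN vN uv ->]]]; rewrite !inE => /orP[]/eqP xx.
    by exists v; rewrite ?xx //; move: vN; rewrite !inE xx eq_sym (negPf uv).
  by exists u; [move: uN; rewrite !inE xx (negPf uv)|rewrite xx setUC].
have /andP[pC xp] : (p \in C) && (x \in p) by have := set21 p q; rewrite -epq inE.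
have /andP[qC xq] : (q \in C) && (x \in q) by have := set22 p q; rewrite -epq inE.
have [u uN pe] := other _ pC xp; have [v vN qe] := other _ qC xq.
have ux : u != x by apply: contraNneq xN => <-.
have vx : v != x by apply: contraNneq xN => <-.
have uv : u != v by apply: contraNneq pq => uv; rewrite pe qe uv.
have cC : (#|C| = #|N|.+1)%N.
  by rewrite (two_regular_card sCp C2).
exists (C :\: [set p; q]), u, v; split => //.
- apply/subsetP => r; rewrite inE -epq inE negb_and => /andP[+ rC]; rewrite rC /= => xr.
  have := subsetP sC _ rC; rewrite !inE => /andP[rF /andP[rs cr]].
  have rN : r \subset N.
    apply/subsetP => w wr; have := subsetP rs _ wr; rewrite !inE => /orP[/eqP wx|//].
    by rewrite -wx wr in xr.
  by move: rF; rewrite rN cr !andbT.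
- have spq : [set p; q] \subset C by rewrite subUset !sub1set pC qC.
  rewrite cardsD (setIidPr spq) cards2 pq cC.
  by case: #|N| N1 => [|[|m]].
move=> w wN; have wx : w != x by apply: contraNneq xN => <-.
have e1 : cdeg C w = ((w \in p) + ((w \in q) + cdeg (C :\: [set p; q]) w))%N.
  have eC : C = p |: (q |: (C :\: [set p; q])).
    apply/setP => r; rewrite !inE; case: (r =P p) => [->|_] /=; first by rewrite pC.
    by case: (r =P q) => [->|_] /=; rewrite ?qC.
  by rewrite [in LHS]eC !cdeg_setU1 // !inE ?eqxx ?(negPf pq) ?orbT.
move: e1; rewrite (C2 w) ?setU1r // pe qe !inE (negPf wx) /= => ->.
by rewrite -addnA addnC -addnA.
Qed.

End TwoFactor.

(** * The bound to be proved; vertices of large missing degree *)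

Section Bounds.
Local Open Scope ring_scope.
Variables (R : realFieldType) (T : finType).
Implicit Types (A B N : {set T}) (F S C : {set {set T}}) (p q t : {set T}).
Implicit Types (c : {set T} -> R).

(** The costs for which uncovered weights of total at most 1, and at most 1/2 on each pair, amount to at
    most [mu]. *)
Definition tame A F c (mu : R) :=
  [/\ 0 <= mu, {in present A F, forall p, c p <= 2 * mu}
    & {in present A F &, forall p q, p != q -> c p + c q <= 2 * mu}].

Definition capped A F c (M : R) := 0 <= M /\ {in present A F, forall p, c p <= M}.

(** The integer [k] is the allowed uncovered weight; [n - 4 + k] missing pairs are written without
    subtraction. *)
Definition deficit_bound k n := forall A F c mu, #|A| = n -> (missing A F + 4 <= n + k)%N ->
  tame A F c mu -> excess A F c <= k%:R * mu.

Lemma presentS A B F F' : A \subset B -> F' \subset F -> present A F \subset present B F'.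
Proof.
move=> sAB sF; apply/subsetP => p; rewrite !in_setD => /andP[pF pA].
by rewrite (subsetP (pairsS sAB)) // andbT; apply: contra pF; apply: (subsetP sF).
Qed.

Lemma tameS A B F F' c mu : present B F' \subset present A F -> tame A F c mu -> tame B F' c mu.
Proof.
move=> s [mu0 h1 h2]; split=> // [p pB|p q pB qB]; [apply: h1|apply: h2]; exact: (subsetP s).
Qed.

Lemma cappedS A B F F' c M : present B F' \subset present A F -> capped A F c M -> capped B F' c M.
Proof. by move=> s [M0 h]; split=> // p pB; apply: h; exact: (subsetP s). Qed.

Lemma capped_tame A F c M : capped A F c M -> tame A F c M.
Proof.
by move=> [M0 h]; split=> // [p /h|p q /h ? /h ? _]; lra.
Qed.

(** Lowering the costs also lowers the triangle terms, and these enter the excess negatively. *)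
Lemma excess_lip A F c c' : (forall p, p \in present A F -> c' p <= c p) ->
  excess A F c <= excess A F c' + \sum_(p in present A F) (c p - c' p).
Proof.
move=> h; rewrite /excess sumrB.
have : \sum_(t in triangles A F) Num.max 0 (cost c' t) <=
       \sum_(t in triangles A F) Num.max 0 (cost c t).
  apply: ler_sum => t tA; rewrite ge_max max0_ge0 /=; apply: le_trans (max0_ge _).
  by apply: ler_sum => p pt; apply: h; exact: triangles_pairs pt.
lra.
Qed.

(** At most one pair [e] can cost more than [mu], and then all the others cost at most [2 mu - c e].
    Lowering [c e] to the cap [M = 2 mu - c e] loses [2 (mu - M)], which the factor [k >= 2] absorbs. *)
Lemma bound_of_capped k A F c mu : (1 < k)%N ->
  (forall c' M, capped A F c' M -> excess A F c' <= k%:R * M) ->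
  tame A F c mu -> excess A F c <= k%:R * mu.
Proof.
move=> k2 H [mu0 h1 h2].
(* A cost above [mu] can only occur at a single pair [e]. *)
have [/forall_inP h|] := boolP [forall p in present A F, c p <= mu]; first by apply: H.
rewrite negb_forall_in => /exists_inP[e eE]; rewrite -ltNge => ce.
pose M := Num.max 0 (2 * mu - c e).
pose c' p := if p == e then M else c p.
have he p : p \in present A F -> p != e -> c p <= 2 * mu - c e.
  by move=> pE pe; have := h2 _ _ pE eE pe; lra.
have M0 : 0 <= M by exact: max0_ge0.
have Mmu : M <= mu by rewrite /M ge_max mu0; lra.
have Mce : M + c e <= 2 * mu.
  by have := h1 _ eE; rewrite /M; case: (leP 0 (2 * mu - c e)); lra.
have cap : capped A F c' M.
  split=> // p pE; rewrite /c'; case: eqP => // /eqP pe.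
  by apply: le_trans (he p pE pe) _; exact: max0_ge.
have lip := @excess_lip A F c c'.
have {lip} : excess A F c <= excess A F c' + (c e - M).
  apply: le_trans (lip _) _ => [p _|]; first by rewrite /c'; case: eqP => [->|//]; lra.
  rewrite lerD2l (bigD1 e) //= big1 ?addr0 ?/c' ?eqxx // => p /andP[_ /negPf ->].
  by rewrite subrr.
have := H _ _ cap.
have : (k%:R - 2) * M <= (k%:R - 2) * mu.
  by apply: ler_wpM2l; rewrite // subr_ge0 (ler_nat _ 2).
lra.
Qed.

(** Of two complementary halves of [C] one costs at most half of [C]. *)
Lemma half_subset C c : exists2 D : {set {set T}}, D \subset C &
  (#|D| <= uphalf #|C|)%N /\ \sum_(p in D) c p <= 2^-1 * \sum_(p in C) c p.
Proof.
have [|D sD cD] := @subset_card _ C #|C|./2; first by lia.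
have e : \sum_(p in C) c p = \sum_(p in D) c p + \sum_(p in C :\: D) c p.
  by rewrite (big_setID D) /= (setIidPr sD).
have [h|h] := leP (\sum_(p in D) c p) (\sum_(p in C :\: D) c p).
  by exists D => //; split; [lia|lra].
exists (C :\: D); first exact: subsetDl.
by split; [rewrite cardsD (setIidPr sD); lia|lra].
Qed.

(** The term [- 1/2 \sum_C c] of [excess_link] pays for declaring missing the cheaper half of [C]. *)
Lemma excess_hub A F x C c K : x \in A -> C \subset present (neighbours A F x) F ->
  (forall F', F \subset F' -> (missing (A :\ x) F' <= missing (A :\ x) F + uphalf #|C|)%N ->
     excess (A :\ x) F' c <= K) ->
  excess A F c <= K + \sum_(u in neighbours A F x) (1 - (cdeg C u)%:R / 2) * c [set x; u].
Proof.
move=> xA sC H; have [D sD [cD hD]] := half_subset C c.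
have := excess_link c xA sC.
have sDA : D \subset present (A :\ x) F.
  apply: subset_trans sD _; apply: subset_trans sC _; apply: presentS => //.
  by apply/subsetP => u; rewrite !inE => /and3P[-> -> _].
have := excess_add c sDA.
have := H (F :|: D) (subsetUl _ _).
have := missingU (A :\ x) F D => m1 /(_ _) m2.
have {}m2 : excess (A :\ x) (F :|: D) c <= K by apply: m2; lia.
lra.
Qed.

Lemma missing_neighbours A F x : x \in A -> (missing (neighbours A F x) F + degree A F x <= missing A F)%N.
Proof.
move=> xA; rewrite -(missingD1 A F x) leq_add2r; apply: subset_leq_card; apply: setIS; apply: pairsS.
by apply/subsetP => u; rewrite !inE => /and3P[-> -> _].
Qed.

Lemma present_link A F x u : x \in A -> u \in neighbours A F x -> [set x; u] \in present A F.
Proof. by move=> xA; rewrite !inE => /and3P[uA ux ->]; rewrite subUset !sub1set xA uA cards2 (eq_sym x) ux. Qed.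

Lemma nbr_notin A F x : x \notin neighbours A F x. Proof. by rewrite inE eqxx andbF. Qed.

(** Forgetting [k - 1] of the missing pairs makes [near_factor] applicable; the forgotten pairs are
    removed from the result again. *)
Lemma defect_factor N F k x : (missing N F + 3 <= #|N| + k)%N -> (0 < k)%N -> (1 < #|N|)%N -> x \notin N ->
  exists2 C : {set {set T}}, C \subset present N F &
    (#|C| <= #|N| - k)%N /\ (#|N| <= #|C| + k)%N /\ {in N, forall w, cdeg C w <= 2}%N.
Proof.
move=> mN k0 N1 xN.
have [|G sG cG] := @subset_card _ (F :&: pairs N) (minn (missing N F) k.-1).
  by rewrite geq_minl.
have mG : (missing N (F :\: G) + #|G| = missing N F)%N.
  rewrite /missing setIDAC cardsD (setIidPr sG) subnK //; exact: subset_leq_card.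
have [||//|C [u [v [sC cC _ dC]]]] := near_factor (N := N) (F := F :\: G) (x := x); [lia|lia|].
have sC' : C :\: G \subset present N F.
  apply/subsetP => p; rewrite inE => /andP[pG /(subsetP sC)].
  by rewrite !inE (negPf pG).
have c1 : (#|C| <= #|C :\: G| + #|G|)%N.
  by rewrite -(cardsID G C) addnC leq_add2l subset_leq_card // subsetIr.
have [|D sD cD] := @subset_card _ (C :\: G) (#|N| - k)%N; first by lia.
exists D; first exact: subset_trans sC'.
split; first by lia.
split=> [|w wN]; first by lia.
have := dC w wN; suff : (cdeg D w <= cdeg C w)%N by lia.
apply: subset_leq_card; apply/subsetP => p; rewrite !inE => /andP[pD ->].
by have := subsetP sD _ pD; rewrite inE => /andP[_ ->].
Qed.

(** The neighbourhood [N] of [x] has [n - d] vertices and at most [#|N| - 3 + k] missing pairs, so it has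
    a factor [C] with [k] defects. By [excess_hub] half of [C] becomes missing in [A :\ x], which has room
    for [(n - d - k + 1) / 2] more missing pairs exactly when [3 d >= n + 2 + k]; the defects cost [mu]
    each. *)
Lemma hub k n A F c x mu : deficit_bound 0 n -> x \in A -> #|A| = n.+1 -> (2 * k <= n)%N ->
  (missing A F + 4 <= n.+1 + k)%N -> (n + 2 + k <= 3 * degree A F x)%N ->
  tame A F c mu -> excess A F c <= k%:R * mu.
Proof.
move=> Q0 xA cA n9 mA dx.
set N := neighbours A F x.
have cN : (#|N| + degree A F x = n)%N by have := degree_neighbours F xA; rewrite cA -/N; lia.
have mN := missing_neighbours F xA; rewrite -/N in mN.
have xN : x \notin N := nbr_notin A F x.
have sA : A :\ x \subset A := subD1set A x.
have step (C : {set {set T}}) c' nu : C \subset present N F -> (#|C| <= #|N| - k)%N -> tame A F c' nu ->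
    excess A F c' <= \sum_(u in N) (1 - (cdeg C u)%:R / 2) * c' [set x; u].
  move=> sC cC tc; rewrite -[leRHS]add0r; apply: (excess_hub xA sC) => F' sF mF'.
  rewrite -(mul0r nu); apply: Q0.
  - by have := cardsD1 x A; rewrite xA cA; case.
  - have := missingD1 A F x; lia.
  - by apply: tameS tc; apply: presentS.
have [k1|k1] := ltnP 1 k.
  move=> tc; apply: bound_of_capped (k1) _ tc => c' M capM; have [M0 hM] := capM.
  have [C [sC cC [dC lC]]] : exists C : {set {set T}}, [/\ C \subset present N F,
      (#|C| <= #|N| - k)%N & {in N, forall w, cdeg C w <= 2}%N /\ (#|N| <= #|C| + k)%N].
    have [N1|N1] := leqP #|N| 1.
      exists set0; rewrite sub0set cards0 /=; split=> //; split; last by lia.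
      by move=> w _; rewrite (_ : cdeg _ _ = 0)%N // /cdeg; apply: eq_card0 => p; rewrite !inE.
    have mNk : (missing N F + 3 <= #|N| + k)%N.
      move: mN cN mA.
      lia.
    have [||//|//|C sC [cC [lC dC]]] := defect_factor (N := N) (F := F) (k := k) (x := x); [exact: mNk|lia|].
    by exists C.
  apply: le_trans (step C c' M sC cC (capped_tame capM)) _.
  have sCp := subset_trans sC (present_pairs N F).
  apply: (@le_trans _ _ (\sum_(u in N) (1 - (cdeg C u)%:R / 2) * M)).
    apply: ler_sum => u uN; apply: ler_wpM2l; last by apply: hM; exact: present_link.
    by rewrite subr_ge0 ler_pdivrMr // mul1r (ler_nat _ _ 2) dC.
  rewrite -mulr_suml; apply: ler_wpM2r => //.
  rewrite sumrB -mulr_suml -natr_sum -card_set_pairs // sumr_const.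
  have : #|N|%:R <= #|C|%:R + k%:R :> R by rewrite -natrD ler_nat.
  by rewrite natrM; lra.
case: k k1 step mA dx n9 => [|[|//]] _ step mA dx _ tc.
  have [||C sC C2] := two_factor (N := N) (F := F); [lia|lia|].
  have sCp := subset_trans sC (present_pairs N F).
  have := step C c mu sC _ tc; rewrite (two_regular_card sCp C2) subn0 => /(_ (leqnn _)).
  rewrite big1 ?mul0r // => u uN; rewrite C2 // divff ?subrr ?mul0r //.
  by rewrite pnatr_eq0.
have [||//|C [u [v [sC cC [uN vN uv] dC]]]] := near_factor (N := N) (F := F) (x := x); [lia|lia|].
apply: le_trans (step C c mu sC _ tc) _; first lia.
have [mu0 _ h2] := tc.
have xuv : [set x; u] != [set x; v].
  apply: contraNneq uv => /setP/(_ u); rewrite !inE eqxx orbT => /esym/orP[/eqP ux|//].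
  by rewrite -ux uN in xN.
have := h2 _ _ (present_link xA uN) (present_link xA vN) xuv.
rewrite (bigD1 u) //= (bigD1 v) /=; last by rewrite vN eq_sym.
rewrite big1 ?addr0; last first.
  move=> w /andP[/andP[wN wu] wv]; have := dC w wN; rewrite (negPf wu) (negPf wv) !addn0 => ->.
  by rewrite divff ?subrr ?mul0r // pnatr_eq0.
have := dC u uN; rewrite eqxx (negPf uv) addn0 addn1 => -[->].
have := dC v vN; rewrite eqxx eq_sym (negPf uv) addn0 addn1 => -[->].
lra.
Qed.

Lemma missing_setD1 A F f : f \in F -> f \in pairs A -> ((missing A (F :\ f)).+1 = missing A F)%N.
Proof.
move=> fF fA; rewrite /missing (cardsD1 f (F :&: pairs A)) inE fF fA /= add1n; congr _.+1.
by apply: eq_card => p; rewrite !inE -andbA.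
Qed.

Lemma present_setD1 A F f : f \in F -> f \in pairs A -> present A (F :\ f) = f |: present A F.
Proof.
move=> fF fA; apply/setP => p; rewrite in_setU1 !in_setD in_set1.
by case: (p =P f) => [->|]; rewrite ?fA ?fF.
Qed.

Definition reset c f (s : R) p := if p == f then s else c p.

(** Declaring the missing pair [f] present at cost [s] changes the excess by [s] and by the new triangles
    over [f]. *)
Lemma excess_restore A F c f s : f \in F -> f \in pairs A ->
  excess A F c = excess A (F :\ f) (reset c f s) - s
   + 2^-1 * \sum_(t in triangles A (F :\ f) | f \subset t) Num.max 0 (cost (reset c f s) t).
Proof.
move=> fF fA; rewrite /excess present_setD1 // big_setU1 ?in_setD ?fF //=.
rewrite {1}/reset eqxx.
have -> : \sum_(p in present A F) reset c f s p = \sum_(p in present A F) c p.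
  by apply: eq_bigr => p; rewrite in_setD /reset => /andP[pF _]; case: eqP pF => // ->; rewrite fF.
rewrite [\sum_(t in triangles A (F :\ f)) _](bigID (fun t : {set T} => f \subset t)) /=.
have -> : \sum_(t in triangles A (F :\ f) | ~~ (f \subset t)) Num.max 0 (cost (reset c f s) t) =
   \sum_(t in triangles A F) Num.max 0 (cost c t).
  apply: eq_big => [t|t /andP[tA ft]].
    rewrite !inE; case tA: (t \subset A) => //=; case: (_ == 3) => //=.
    have fp : (f \in pairs t) = (f \subset t) by rewrite inE (card_pair fA) andbT.
    rewrite -fp; apply/andP/idP => [[d ft]|d].
      rewrite -setI_eq0; apply/eqP/setP => p; rewrite !inE; apply/negP => /andP[pt pF].
      have := disjointFr d (x := p); rewrite !inE pt pF andbT => /(_ isT) /negbFE/eqP pf.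
      by move: ft; rewrite inE -pf pt.
    split; first by apply: disjointWr d; exact: subD1set.
    by apply/negP => /(disjointFr d); rewrite fF.
  congr (Num.max 0 _); apply: eq_bigr => p pt; rewrite /reset; case: eqP => // pf.
  by rewrite -pf (pair_sub pt) in ft.
ring.
Qed.

Lemma tame_reset A F c f mu : f \in F -> f \in pairs A -> tame A F c mu -> tame A (F :\ f) (reset c f (- (2 * mu))) mu.
Proof.
move=> fF fA [mu0 h1 h2].
rewrite /tame /reset present_setD1 //; split=> // [p|p q].
  by rewrite in_setU1; case: eqP => [_ _|_ /= /h1 //]; lra.
rewrite !in_setU1; case: eqP => [-> _|/eqP pf /= pE]; case: eqP => [-> _|/eqP qf /= qE].
- by rewrite eqxx.
- by move=> _; have := h1 _ qE; lra.
- by move=> _; have := h1 _ pE; lra.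
- exact: h2.
Qed.

(** At cost [- 2 mu] all triangles over the restored pair have nonpositive cost, by tameness, and do not
    matter. *)
Lemma excess_reset A F c f mu : f \in F -> f \in pairs A -> tame A F c mu ->
  excess A F c <= excess A (F :\ f) (reset c f (- (2 * mu))) + 2 * mu.
Proof.
move=> fF fA [mu0 h1 h2]; rewrite (excess_restore c (- (2 * mu)) fF fA).
set c' := reset c f _.
rewrite [X in _ + _ * X]big1 ?mulr0; first lra.
move=> t /andP[tA ft]; apply/max_idPl.
have /set0Pn[x xtf] : t :\: f != set0.
  rewrite -cards_eq0 cardsD (setIidPr ft) (card_pair fA).
  by move: tA; rewrite inE => /and3P[_ /eqP -> _].
have et : t = x |: f.
  apply/eqP; rewrite eq_sym eqEcard subUset ft sub1set; move: xtf; rewrite inE => /andP[xf ->] /=.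
  by rewrite cardsU1 xf (card_pair fA); move: tA; rewrite inE => /and3P[_ /eqP -> _].
have xf : x \notin f by move: xtf; rewrite inE => /andP[].
rewrite et cost_add // ?(card_pair fA) //.
have /pairsP[u [v [uA vA uv ef]]] := fA.
rewrite {1}/c' /reset eqxx ef big_setU1 ?inE //= big_set1.
have xE w : w \in f -> [set x; w] \in present A F /\ [set x; w] != f.
  move=> wf; have xw : x != w by apply: contraNneq xf => ->.
  have nf : [set x; w] != f by apply: contraNneq xf => <-; rewrite set21.
  split=> //; have pt : [set x; w] \in pairs t by rewrite et mem_pairs2 !inE eqxx wf xw orbT.
  by have := triangles_pairs tA pt; rewrite present_setD1 // in_setU1 (negPf nf).
have [|ue un] := xE u; first by rewrite ef set21.
have [|ve vn] := xE v; first by rewrite ef set22.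
rewrite /c' /reset (negPf un) (negPf vn).
have := h2 _ _ ue ve; have : [set x; u] != [set x; v].
  apply: contraNneq uv => /setP/(_ u); rewrite !inE eqxx orbT => /esym/orP[/eqP ux|//].
  by move: xf; rewrite ef -ux set21.
by move=> -> /(_ isT); lra.
Qed.

Lemma excess_restore2 A F c f mu K : f \in F -> f \in pairs A -> tame A F c mu ->
  (forall c', tame A (F :\ f) c' mu -> excess A (F :\ f) c' <= K) ->
  excess A F c <= K + 2 * mu.
Proof.
by move=> fF fA tc H; apply: le_trans (excess_reset fF fA tc) _; rewrite lerD2r; apply/H/tame_reset.
Qed.

End Bounds.

(** * Explicit packings around many isolated vertices *)

Section Isolated.
Variables (T : finType).
Implicit Types (A B N : {set T}) (F S C : {set {set T}}) (p q t : {set T}).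

Definition isolated A F := [set z in A | degree A F z == 0].

Lemma isolatedP A F z u : z \in isolated A F -> u \in A -> u != z -> [set z; u] \notin F.
Proof.
rewrite inE => /andP[zA /eqP dz] uA uz; apply/negP => zuF.
move: dz; rewrite (degree_set F zA) => /eqP; rewrite cards_eq0 => /eqP/setP/(_ u).
by rewrite !inE uA uz zuF.
Qed.

Lemma mem_triangleU1 A F x p : x \in A -> x \notin p -> p \in present A F ->
  (x |: p \in triangles A F) = [forall u in p, [set x; u] \notin F].
Proof.
move=> xA xp pA; have pP : p \in pairs A by move: pA; rewrite in_setD => /andP[].
apply/idP/forall_inP => [tA u up|h].
  have : [set x; u] \in pairs (x |: p).
    rewrite mem_pairs2 !inE eqxx up orbT /=; by apply: contraNneq xp => ->.
  by move/(triangles_pairs tA); rewrite in_setD => /andP[].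
have : x |: p \in [set x |: p | p in present (neighbours A F x) F].
  apply: imset_f; move: pA; rewrite !in_setD => /andP[-> _] /=.
  rewrite inE (card_pair pP) eqxx andbT; apply/subsetP => u up.
  rewrite inE (subsetP (pair_sub pP)) // h // andbT; by apply: contraNneq xp => <-.
by rewrite -triangles_at // inE => /andP[].
Qed.

(** The apexes of the triangles over the pair [p]. *)
Definition common B F p := [set x in B | (x \notin p) && [forall u in p, [set x; u] \notin F]].

Lemma common_pair B F u v : u \in B -> u != v ->
  common B F [set u; v] = neighbours (neighbours B F u) F v.
Proof.
move=> uB uv; apply/setP => x; rewrite !inE negb_or.
case xB: (x \in B) => //=; case xu: (x == u) => //=; case xv: (x == v) => //=; first by rewrite andbF.
rewrite ?andbT (setUC [set u] [set x]) (setUC [set v] [set x]).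
apply/forall_inP/andP => [h|[h1 h2] w]; first by rewrite !h ?set21 ?set22.
by rewrite !inE => /orP[]/eqP ->.
Qed.

End Isolated.

Section Spread.
Local Open Scope ring_scope.
Variables (R : realFieldType) (T : finType).
Implicit Types (A B N : {set T}) (F S C : {set {set T}}) (p q t : {set T}) (c : {set T} -> R).

Lemma sum_triangles_over A F p (w : {set T} -> R) : p \in present A F ->
  \sum_(t in triangles A F | p \subset t) w t = \sum_(x in common A F p) w (x |: p).
Proof.
move=> pA; rewrite -(big_imset (h := fun x => x |: p) w) /=; last first.
  move=> x y; rewrite !inE => /and3P[_ xp _] /and3P[_ yp _] /setP/(_ x).
  by rewrite !inE eqxx (negPf xp) !orbF => /esym/eqP.
apply: eq_bigl => t; apply/andP/imsetP => [[tA pt]|[x]]; last first.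
  rewrite inE => /and3P[xA xp h] ->.
  by rewrite (mem_triangleU1 xA xp pA) h subsetUr.
have cp : #|p| = 2%N by move: pA; rewrite in_setD => /andP[_ /card_pair].
have ct : #|t| = 3%N by move: tA; rewrite inE => /and3P[_ /eqP].
have tsA : t \subset A by move: tA; rewrite inE => /and3P[].
have /set0Pn[x] : t :\: p != set0 by rewrite -cards_eq0 cardsD (setIidPr pt) cp ct.
rewrite inE => /andP[xp xt].
have et : t = x |: p by apply/eqP; rewrite eq_sym eqEcard subUset sub1set xt pt cardsU1 xp cp ct.
exists x => //; rewrite inE (subsetP tsA) // xp /=.
by rewrite -(mem_triangleU1 _ xp pA) ?(subsetP tsA) // -et.
Qed.

(** With [I] the isolated vertices and [W] the others, triangles with three, two, one and no vertices in
    [W] get weights [theta], [X / i], [y] and [s], solved successively so that every pair is covered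
    exactly: [X] makes up for what [theta] leaves on a pair of [W], [Y u] is then the total on the pairs
    from [u] to one isolated vertex. The hypotheses say that the solved weights are nonnegative. *)
Lemma spread_exact A F W (theta : R) c : let I := isolated A F in W = A :\: I ->
  (3 < #|I|)%N -> 0 <= theta <= 2^-1 ->
  (forall p, p \in present W F -> theta * #|common W F p|%:R <= 1) ->
  (forall u, u \in W -> \sum_(v in neighbours W F u) (1 - theta * #|common W F [set u; v]|%:R) <= #|I|%:R) ->
  #|I|%:R * (#|W|%:R - #|I|%:R + 1) <=
    \sum_(u in W) \sum_(v in neighbours W F u) (1 - theta * #|common W F [set u; v]|%:R) ->
  excess A F c <= 0.
Proof.
move=> I eW I3 /andP[th0 th1] hcom hY hsum.
have sIA : I \subset A by apply/subsetP => z; rewrite inE => /andP[].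
have WI x : x \in W -> x \notin I by rewrite eW inE => /andP[].
have WA x : x \in W -> x \in A by rewrite eW inE => /andP[].
have IA x : x \in I -> x \in A by apply: (subsetP sIA).
have AWI x : x \in A -> (x \in I) = ~~ (x \in W) by move=> xA; rewrite eW in_setD xA andbT negbK.
pose i : R := #|I|%:R.
have i4 : 4 <= i by rewrite /i (ler_nat R 4).
have i_0 : i != 0 by apply: lt0r_neq0; lra.
have i_1 : i - 1 != 0 by apply: lt0r_neq0; lra.
have i_2 : i - 2 != 0 by apply: lt0r_neq0; lra.
pose X p : R := 1 - theta * #|common W F p|%:R.
pose Y u := \sum_(v in neighbours W F u) X [set u; v].
pose y u := (1 - Y u / i) / (i - 1).
pose s := (1 - \sum_(u in W) y u) / (i - 2).
(* The weight depends on the part of the triangle in the core. *)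
pose om t := let q := t :\: I in
  match #|q| with 0%N => s | 1%N => \sum_(u in q) y u | 2%N => X q / i | _ => theta end.
have X01 p : p \in present W F -> 0 <= X p <= 1.
  by move=> pW; rewrite /X subr_ge0 hcom //= gerBl mulr_ge0 ?ler0n.
have nbW u v : u \in W -> v \in neighbours W F u -> [set u; v] \in present W F.
  by move=> uW; exact: present_link.
have Y0 u : u \in W -> 0 <= Y u.
  by move=> uW; apply: sumr_ge0 => v vN; have /andP[] := X01 _ (nbW _ _ uW vN).
have y0 u : u \in W -> 0 <= y u.
  move=> uW; apply: divr_ge0; last lra.
  by rewrite subr_ge0 ler_pdivrMr ?mul1r; [exact: hY|lra].
have y1 u : u \in W -> y u <= 2^-1.
  move=> uW; have Yi : 0 <= Y u / i by apply: divr_ge0; [exact: Y0|lra].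
  by rewrite /y ler_pdivrMr; lra.
have s01 : 0 <= s <= 2^-1.
  have e : \sum_(u in W) y u = (#|W|%:R - (\sum_(u in W) Y u) / i) / (i - 1).
    by rewrite -mulr_suml sumrB sumr_const mulr_suml.
  have h : \sum_(u in W) y u <= 1.
    rewrite e ler_pdivrMr; last lra.
    have : #|W|%:R - i + 1 <= (\sum_(u in W) Y u) / i by rewrite ler_pdivlMr 1?mulrC; [exact: hsum|lra].
    lra.
  have h' : 0 <= \sum_(u in W) y u by apply: sumr_ge0.
  rewrite /s; apply/andP; split; first by apply: divr_ge0; lra.
  by rewrite ler_pdivrMr; lra.
have hom t : t \in triangles A F -> 0 <= om t <= 2^-1.
  move=> tA; have qp : (t :\: I) \subset W.
    move: tA; rewrite inE => /and3P[st _ _]; rewrite eW; exact: setSD.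
  rewrite /om; case eq: #|t :\: I| => [|[|[|n]]] //.
  - move/eqP/cards1P: eq => [u eu]; rewrite eu big_set1.
    have uW : u \in W by apply: (subsetP qp); rewrite eu set11.
    by rewrite y0 // y1.
  - have qt : t :\: I \in pairs t by rewrite inE subsetDl eq.
    have qW : t :\: I \in present W F.
      have := triangles_pairs tA qt; rewrite !in_setD => /andP[-> _].
      by rewrite inE qp eq.
    have /andP[X0 X1] := X01 _ qW.
    apply/andP; split; first by apply: divr_ge0 => //; lra.
    rewrite ler_pdivrMr; lra.
  - by rewrite th0.
apply: le_trans (weak_duality c hom) _; rewrite big1 // => p pA.
suff -> : \sum_(t in triangles A F | p \subset t) om t = 1 by rewrite subrr mul0r.
rewrite sum_triangles_over //.
have pP : p \in pairs A by move: pA; rewrite in_setD => /andP[].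
have pF : p \notin F by move: pA; rewrite in_setD => /andP[].
have comI x : x \in I -> x \notin p -> x \in common A F p.
  move=> xI xp; rewrite inE (IA _ xI) xp /=; apply/forall_inP => u up.
  apply: (isolatedP xI); first exact: (subsetP (pair_sub pP)).
  by apply: contraNneq xp => <-.
have comA x : x \in common A F p -> x \in A by rewrite inE => /andP[].
have comp x : x \in common A F p -> x \notin p by rewrite inE => /and3P[].
have split_sum a b : (forall x, x \in common A F p -> x \in W -> om (x |: p) = a x) ->
    (forall x, x \in I -> x \notin p -> om (x |: p) = b) ->
    \sum_(x in common A F p) om (x |: p) =
     \sum_(x in common A F p | x \in W) a x + #|I :\: p|%:R * b.
  move=> ha hb; rewrite (bigID (mem W)) /=; congr (_ + _).
    by apply: eq_bigr => x /andP[xc xW]; exact: ha.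
  rewrite (eq_bigl (mem (I :\: p))); last first.
    move=> x; rewrite /= in_setD; apply/andP/andP => [[xc xW]|[xp xI]].
      by rewrite (AWI _ (comA _ xc)) (comp _ xc).
    by rewrite comI // -(AWI _ (IA _ xI)).
  rewrite (eq_bigr (fun=> b)) ?sumr_const ?mulr_natl // => x.
  by rewrite /= in_setD => /andP[xp xI]; exact: hb.
have DI x B : x \in I -> (x |: B) :\: I = B :\: I.
  by move=> xI; rewrite setDUl (_ : [set x] :\: I = set0) ?set0U //; apply/eqP; rewrite setD_eq0 sub1set.
have DW x B : x \in W -> (x |: B) :\: I = x |: (B :\: I).
  move=> xW; rewrite setDUl; congr (_ :|: _); apply/setP => z; rewrite in_setD !in_set1.
  by case: eqP => [->|]; rewrite ?andbF ?andbT // WI.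
have DIs x : x \in I -> [set x] :\: I = set0.
  by move=> xI; apply/eqP; rewrite setD_eq0 sub1set.
have DWs x : x \in W -> [set x] :\: I = [set x].
  by move=> xW; rewrite -[[set x]]setU0 DW // set0D.
have wlogp (P : Prop) : (forall u v, u \in W -> v \in W -> u != v -> p = [set u; v] -> P) ->
  (forall u z, u \in W -> z \in I -> p = [set u; z] -> P) ->
  (forall z z', z \in I -> z' \in I -> z != z' -> p = [set z; z'] -> P) -> P.
  have /pairsP[u [v [uA vA uv ep]]] := pP => h1 h2 h3.
  have [uW|uW] := boolP (u \in W); have [vW|vW] := boolP (v \in W).
  - exact: h1 ep.
  - by apply: (h2 u v) => //; rewrite AWI.
  - by apply: (h2 v u) => //; rewrite ?AWI // ep setUC.
  - by apply: (h3 u v) => //; rewrite AWI.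
apply: wlogp => [u v uW vW uv ep|u z uW zI ep|z z' zI z'I zz' ep].
- have pW : p \in present W F.
    by rewrite in_setD pF /= ep mem_pairs2 uW vW uv.
  have Dp : p :\: I = p by rewrite ep DW // DWs.
  have cp := card_pair pP.
  rewrite (split_sum (fun=> theta) (X p / i)).
  + rewrite (setDidPl _); last first.
      by rewrite ep disjoints_subset; apply/subsetP => x xI; rewrite !inE negb_or;
      apply/andP; split; apply: contraTneq xI => ->; rewrite WI.
    rewrite (eq_bigl (mem (common W F p))); last first.
      by move=> x /=; rewrite !inE; case xW: (x \in W); rewrite ?andbF // (WA _ xW) andbT.
    by rewrite sumr_const /X -/i -mulr_natr; field.
  + by move=> x xc xW; rewrite /om DW // Dp cardsU1 comp // cp.
  + by move=> x xI xp; rewrite /om DI // Dp cp.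
- have uz : u != z by apply: contraTneq zI => <-; rewrite WI.
  have Dp : p :\: I = [set u] by rewrite ep setDUl DWs // DIs // setU0.
  have Ip : #|I :\: p|%:R = i - 1 :> R.
    rewrite (_ : I :\: p = I :\ z).
      by rewrite /i (cardsD1 z I) zI natrD addrAC subrr add0r.
    apply/setP => x; rewrite ep !in_setD in_set1 in_set2 negb_or.
    case xI: (x \in I); rewrite ?andbF // !andbT.
    by case: (x =P u) => [xu|] //=; move: (WI _ uW); rewrite -xu xI.
  rewrite (split_sum (fun x => X [set u; x] / i) (y u)).
  + rewrite Ip (eq_bigl (mem (neighbours W F u))); last first.
      move=> x /=; rewrite inE [RHS]inE; case xW: (x \in W); rewrite ?andbF // (WA _ xW) /= andbT.
      have xz : x != z by apply: contraTneq zI => <-; rewrite WI.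
      rewrite ep !inE negb_or xz andbT; case xu: (x == u) => //=.
      apply/forall_inP/idP => [h|h w]; first by rewrite setUC h ?set21.
      rewrite !inE => /orP[]/eqP ->; first by rewrite setUC.
      by rewrite setUC; apply: (isolatedP zI) => //; exact: WA.
    by rewrite -mulr_suml -/(Y u) /y; field; rewrite i_0 i_1.
  + move=> x xc xW; rewrite /om DW // Dp cardsU1 !inE cards1.
    have xu : x != u by apply: contraNneq (comp _ xc) => ->; rewrite ep set21.
    by rewrite xu /= setUC.
  + by move=> x xI xp; rewrite /om DI // Dp cards1 big_set1.
have Dp : p :\: I = set0 by rewrite ep setDUl !DIs // setU0.
have Ip : #|I :\: p|%:R = i - 2 :> R.
  rewrite cardsD (setIidPr _); last by rewrite ep subUset !sub1set zI.
  by rewrite (card_pair pP) natrB // ltnW // ltnW.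
rewrite (split_sum y s).
- rewrite Ip (eq_bigl (mem W)); last first.
    move=> x /=; rewrite inE; case xW: (x \in W); rewrite ?andbF // (WA _ xW) /= andbT.
    have nz w : w \in I -> x != w by move=> wI; apply: contraTneq xW => ->; rewrite -AWI ?IA.
    have -> : x \notin p by rewrite ep !inE negb_or !nz.
    apply/forall_inP => w wp; rewrite setUC.
    have wI : w \in I by move: wp; rewrite ep => /set2P[]->.
    by apply: (isolatedP wI); rewrite ?WA ?nz.
  by rewrite /s; field.
- by move=> x xc xW; rewrite /om DW // Dp setU0 cards1 big_set1.
by move=> x xI xp; rewrite /om DI // Dp cards0.
Qed.

Lemma core_pairs A F : F :&: pairs (A :\: isolated A F) = F :&: pairs A.
Proof.
apply/setP => p; rewrite !in_setI; case pF: (p \in F) => //=.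
apply/pairsP/pairsP => [[u [v [uW vW uv ep]]]|[u [v [uA vA uv ep]]]]; exists u, v.
  by move: uW vW; rewrite !in_setD => /andP[_ ->] /andP[_ ->].
rewrite !in_setD uA vA uv ep !andbT; split => //; apply/negP => zI.
  by have := isolatedP zI vA; rewrite eq_sym uv -ep pF => /(_ isT).
by have := isolatedP zI uA uv; rewrite setUC -ep pF.
Qed.

Lemma missing_core A F : missing (A :\: isolated A F) F = missing A F.
Proof. by rewrite /missing core_pairs. Qed.

Lemma degree_core A F v : degree (A :\: isolated A F) F v = degree A F v.
Proof. by rewrite /degree core_pairs. Qed.

Lemma card_core A F : (#|isolated A F| + #|A :\: isolated A F|)%N = #|A|.
Proof.
rewrite -(cardsID (isolated A F) A) (setIidPr _) //.
by apply/subsetP => z; rewrite inE => /andP[].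
Qed.

Lemma degree_core_gt0 A F u : u \in A :\: isolated A F -> (0 < degree A F u)%N.
Proof. by rewrite !inE lt0n; case: (u \in A); rewrite ?andbF //= andbT. Qed.

(** The case [theta = 0] of [spread_exact]: no triangle inside the core is used. *)
Lemma spread_few A F c : (3 < #|isolated A F|)%N ->
  (#|A :\: isolated A F| <= #|isolated A F| + 2)%N ->
  (#|isolated A F| * (#|A :\: isolated A F| + 1) + 2 * missing A F + #|A :\: isolated A F| <=
    #|A :\: isolated A F| * #|A :\: isolated A F| + #|isolated A F| * #|isolated A F|)%N ->
  excess A F c <= 0.
Proof.
set I := isolated A F; set W := A :\: I => I3 WI hm.
have g u : u \in W -> (#|neighbours W F u| + degree A F u + 1 = #|W|)%N.
  by move=> uW; rewrite -(degree_neighbours F uW) degree_core.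
have e u : \sum_(v in neighbours W F u) (1 - 0 * #|common W F [set u; v]|%:R) = #|neighbours W F u|%:R :> R.
  by rewrite (eq_bigr (fun=> 1)) ?sumr_const // => v _; rewrite mul0r subr0.
apply: (@spread_exact A F W 0) => //.
- by rewrite lexx invr_ge0 ler0n.
- by move=> p _; rewrite mul0r ler01.
- move=> u uW; rewrite e ler_nat -/I; have := g u uW; have := degree_core_gt0 uW; lia.
rewrite (eq_bigr _ (fun u _ => e u)) -natr_sum.
have hs : (\sum_(u in W) #|neighbours W F u| + 2 * missing A F + #|W| = #|W| * #|W|)%N.
  rewrite -(missing_core A F) -handshake -/W -[X in (_ + X = _)%N]sum1_card -(sum_nat_const (mem W)) -!big_split /=.
  by apply: eq_bigr => u uW; rewrite -(g u uW) degree_core.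
have : ((#|I| * (#|W| + 1) + 2 * missing A F + #|W|)%:R <= (#|W| * #|W| + #|I| * #|I|)%:R :> R)%R.
  by rewrite ler_nat.
have : ((\sum_(u in W) #|neighbours W F u| + 2 * missing A F + #|W|)%:R = (#|W| * #|W|)%:R :> R)%R.
  by rewrite hs.
rewrite !natrD !natrM; rewrite !natrD; lra.
Qed.

Lemma sum_common B F u : u \in B ->
  (\sum_(v in neighbours B F u) #|common B F [set u; v]| + 2 * missing (neighbours B F u) F
    + #|neighbours B F u| = #|neighbours B F u| * #|neighbours B F u|)%N.
Proof.
move=> uB; set N := neighbours B F u.
rewrite -handshake -[X in (_ + X = _)%N]sum1_card -(sum_nat_const (mem N)) -!big_split /=; apply: eq_bigr => v vN.
have uv : u != v by move: vN; rewrite inE eq_sym => /and3P[].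
by rewrite common_pair // -/N degree_neighbours.
Qed.

(** The case [theta = 1 / (2 (w - 5))] of [spread_exact], where [w] is the size of the core: the triangles
    inside the core relieve the pairs to the isolated vertices, of which there are fewer than core
    vertices. *)
Lemma spread_many A F c : (22 < #|A :\: isolated A F|)%N ->
  (#|A :\: isolated A F| <= 2 * #|isolated A F|)%N ->
  (#|isolated A F| + 3 <= #|A :\: isolated A F|)%N ->
  (missing A F <= #|A|)%N -> excess A F c <= 0.
Proof.
rewrite -(card_core A F); set I := isolated A F; set W := A :\: I => W22 WI IW hm.
have g u : u \in W -> (#|neighbours W F u| + degree A F u + 1 = #|W|)%N.
  by move=> uW; rewrite -(degree_neighbours F uW) degree_core.
pose w : R := #|W|%:R; pose i : R := #|I|%:R.
have w23 : 23 <= w by rewrite (ler_nat R 23).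
have wi : w <= 2 * i by rewrite -natrM ler_nat.
have iw : i + 3 <= w by rewrite -natrD ler_nat.
have hmR : (missing A F)%:R <= i + w by rewrite -natrD ler_nat.
pose th : R := (2 * (w - 5))^-1.
have w5 : 0 < 2 * (w - 5) by lra.
have th0 : 0 <= th by rewrite invr_ge0 ltW.
have comW p : p \in present W F -> (#|common W F p|%:R <= w - 2 :> R)%R.
  rewrite in_setD => /andP[_ pW]; have := card_pair pW => cp.
  have : (#|common W F p| + 2 <= #|W|)%N.
    rewrite -cp -(cardsID p W) addnC (setIidPr (pair_sub pW)) leq_add2l subset_leq_card //.
    by apply/subsetP => x; rewrite in_setD inE => /and3P[-> ->].
  by rewrite -(ler_nat R) natrD; lra.
have thc x : x <= w - 2 -> th * x <= (w - 2) / (2 * (w - 5)).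
  by move=> xw; rewrite mulrC; apply: ler_wpM2r.
have q1 : (w - 2) / (2 * (w - 5)) <= 1 by rewrite ler_pdivrMr //; lra.
have Ysum u : u \in W -> \sum_(v in neighbours W F u) (1 - th * #|common W F [set u; v]|%:R) =
   #|neighbours W F u|%:R - th * (\sum_(v in neighbours W F u) #|common W F [set u; v]|)%N%:R.
  by move=> uW; rewrite sumrB sumr_const -mulr_sumr -natr_sum.
apply: (@spread_exact A F W th) => //.
- by rewrite -/I; lia.
- rewrite th0 lef_pV2 ?posrE //; lra.
- by move=> p pW; apply: le_trans (thc _ (comW _ pW)) q1.
- move=> u uW; rewrite Ysum //.
  have uA : u \in A by move: uW; rewrite in_setD => /andP[].
  have := sum_common F uW; set N := neighbours W F u; set S := (\sum_(v in N) _)%N => hS.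
  have mN : (missing N F + degree A F u <= missing A F)%N.
    by have := missing_neighbours F uW; rewrite missing_core degree_core.
  have gu := g u uW; have du := degree_core_gt0 uW.
  have hSR : S%:R + 2 * (missing N F)%:R + #|N|%:R = #|N|%:R * #|N|%:R :> R.
    by rewrite -!natrM -!natrD hS.
  have mNR : (missing N F)%:R + (degree A F u)%:R <= (missing A F)%:R :> R by rewrite -natrD ler_nat.
  have guR : #|N|%:R + (degree A F u)%:R + 1 = w :> R by rewrite /w -gu !natrD.
  (* [(#|N| - (w - 3)) (#|N| - (w - 4))] is nonnegative because [#|N| - w] is an integer. *)
  have key : 2 * (w - 5) * #|N|%:R - S%:R <= i * (2 * (w - 5)).
    have h1 : 0 <= (#|N|%:R - (w - 3)) * (#|N|%:R - (w - 4)) :> R.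
      have [h|h] := leqP (#|N| + 4) #|W|.
        by move: h; rewrite -(ler_nat R) natrD -/w => h; apply: mulr_le0; lra.
      have : (#|W| <= #|N| + 3)%N by lia.
      by rewrite -(ler_nat R) natrD -/w => h'; apply: mulr_ge0; lra.
    have : 0 <= (2 * i - w) * (w - 6) by apply: mulr_ge0; lra.
    nra.
  have -> : th * S%:R = S%:R / (2 * (w - 5)) by rewrite mulrC.
  have -> : #|N|%:R - S%:R / (2 * (w - 5)) = (2 * (w - 5) * #|N|%:R - S%:R) / (2 * (w - 5)) :> R.
    by field; lra.
  by rewrite ler_pdivrMr.
have hY u : u \in W -> (1 - (w - 2) / (2 * (w - 5))) * #|neighbours W F u|%:R <=
   \sum_(v in neighbours W F u) (1 - th * #|common W F [set u; v]|%:R).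
  move=> uW; rewrite mulr_natr -sumr_const; apply: ler_sum => v vN.
  by rewrite lerD2l lerN2; apply: thc; apply: comW; exact: present_link.
apply: le_trans (ler_sum _ hY).
rewrite -mulr_sumr -natr_sum.
have hs : (\sum_(u in W) #|neighbours W F u| + 2 * missing A F + #|W| = #|W| * #|W|)%N.
  rewrite -(missing_core A F) -handshake -/W -[X in (_ + X = _)%N]sum1_card -(sum_nat_const (mem W)) -!big_split /=.
  by apply: eq_bigr => u uW; rewrite -(g u uW) degree_core.
set S := (\sum_(u in W) _)%N in hs *.
have hsR : S%:R + 2 * (missing A F)%:R + w = w * w :> R by rewrite /w -!natrM -!natrD hs.
have -> : (1 - (w - 2) / (2 * (w - 5))) * S%:R = (w - 8) * S%:R / (2 * (w - 5)) by field; lra.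
rewrite -/i -/w ler_pdivlMr //.
have S1 : w * w - 3 * w - 2 * i <= S%:R by lra.
have S2 : (w - 8) * (w * w - 5 * w + 6) <= (w - 8) * S%:R by apply: ler_wpM2l; nra.
apply: le_trans S2.
have h1 : i * (w - i + 1) * 4 <= (w + 1) * (w + 1).
  by have := sqr_ge0 (w + 1 - 2 * i); rewrite expr2; lra.
have h2 : i * (w - i + 1) * (2 * (w - 5)) * 2 <= (w + 1) * (w + 1) * (w - 5).
  have : 0 <= ((w + 1) * (w + 1) - i * (w - i + 1) * 4) * (w - 5) by apply: mulr_ge0; lra.
  lra.
nra.
Qed.

End Spread.

(** * Symmetry under permutations of the isolated vertices *)

Section Balance.
Local Open Scope ring_scope.
Variables (R : realFieldType) (T : finType).
Implicit Types (A B N : {set T}) (F S C : {set {set T}}) (p q t : {set T}) (c : {set T} -> R) (s : {perm T}).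

Definition balanced (I : {set T}) c := forall s, perm_on I s -> forall p, c (s @: p) = c p.

Lemma imset_perm_inj s : injective (fun p => s @: p).
Proof. exact: imset_inj perm_inj. Qed.

Lemma subset_imset_perm s p A : (s @: p \subset s @: A) = (p \subset A).
Proof.
apply/subsetP/subsetP => [h x xp|h x /imsetP[y yp ->]]; last by rewrite imset_f ?h.
by have := h _ (imset_f s xp); rewrite mem_imset //; exact: perm_inj.
Qed.

Lemma mem_pairs_imset s p A : (s @: p \in pairs (s @: A)) = (p \in pairs A).
Proof. by rewrite !inE subset_imset_perm card_imset //; exact: perm_inj. Qed.

Lemma cost_imset c s t : cost c (s @: t) = cost (fun p => c (s @: p)) t.
Proof.
rewrite /cost (reindex_inj (imset_perm_inj (s := s))) /=.
by apply: eq_bigl => p; rewrite mem_pairs_imset.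
Qed.

Lemma mem_present_imset s A F p : {in pairs A, forall p, (s @: p \in F) = (p \in F)} ->
  (s @: p \in present (s @: A) F) = (p \in present A F).
Proof.
move=> sF; rewrite !in_setD mem_pairs_imset andbC [RHS]andbC.
by case pA: (p \in pairs A) => //=; rewrite sF.
Qed.

Lemma mem_triangles_imset s A F t : {in pairs A, forall p, (s @: p \in F) = (p \in F)} ->
  (s @: t \in triangles (s @: A) F) = (t \in triangles A F).
Proof.
move=> sF; rewrite !inE subset_imset_perm card_imset; last exact: perm_inj.
case tA: (t \subset A) => //=; case: (_ == 3)%N => //=.
rewrite !disjoint_subset; apply/subsetP/subsetP => h p pt; last first.
  have ep : p = s @: (s^-1%g @: p).
    by rewrite -imset_comp (eq_imset (g := id)) ?imset_id // => x /=; rewrite permKV.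
  have qt : s^-1%g @: p \in pairs t by rewrite -(mem_pairs_imset s) -ep.
  have qA := subsetP (pairsS tA) _ qt.
  by rewrite inE /= {1}ep (sF _ qA); have := h _ qt; rewrite inE.
have := h (s @: p); rewrite mem_pairs_imset => /(_ pt).
by rewrite !inE sF // (subsetP (pairsS tA)).
Qed.

Lemma excess_imset A F c s : {in pairs A, forall p, (s @: p \in F) = (p \in F)} ->
  excess (s @: A) F c = excess A F (fun p => c (s @: p)).
Proof.
move=> sF; rewrite /excess; congr (_ - _ * _).
  rewrite (reindex_inj (imset_perm_inj (s := s))) /=.
  by apply: eq_bigl => p; rewrite mem_present_imset.
rewrite (reindex_inj (imset_perm_inj (s := s))) /=.
by apply: eq_big => [t|t _]; [rewrite mem_triangles_imset|rewrite cost_imset].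
Qed.

(** Isolated vertices are joined to all others. *)
Lemma isolated_perm A F s : perm_on (isolated A F) s ->
  s @: A = A /\ {in pairs A, forall p, (s @: p \in F) = (p \in F)}.
Proof.
move=> sI; have sIA : isolated A F \subset A by apply/subsetP => z; rewrite inE => /andP[].
have sA x : (s x \in A) = (x \in A) by rewrite (perm_closed _ (subset_trans sI sIA)).
split=> [|p /pairsP[u [v [uA vA uv ->]]]].
  apply/eqP; rewrite eqEcard card_imset ?leqnn ?andbT; last exact: perm_inj.
  by apply/subsetP => x /imsetP[y yA ->]; rewrite sA.
have sII x : (s x \in isolated A F) = (x \in isolated A F) by rewrite (perm_closed _ sI).
rewrite imsetU !imset_set1.
have suv : s u != s v by rewrite (inj_eq perm_inj).
have ni x y : x \in isolated A F -> y \in A -> x != y -> ([set x; y] \in F) = false.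
  by move=> xI yA xy; apply/negbTE/(isolatedP xI yA); rewrite eq_sym.
have [uI|uI] := boolP (u \in isolated A F); first by rewrite !ni ?sII ?sA.
have [vI|vI] := boolP (v \in isolated A F).
  by rewrite setUC ni ?sII ?sA 1?eq_sym // setUC ni // eq_sym.
by rewrite !(out_perm sI).
Qed.

(** The positive part is subadditive. *)
Lemma excess_concave A F (K : finType) (P : {set K}) (c : K -> {set T} -> R) :
  \sum_(k in P) excess A F (c k) <= excess A F (fun p => \sum_(k in P) c k p).
Proof.
have -> : \sum_(k in P) excess A F (c k) = \sum_(p in present A F) \sum_(k in P) c k p -
    2^-1 * \sum_(t in triangles A F) \sum_(k in P) Num.max 0 (cost (c k) t).
  by rewrite sumrB -mulr_sumr exchange_big /=; congr (_ - _ * _); rewrite exchange_big.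
rewrite /excess lerD2l lerN2; apply: ler_wpM2l; first by rewrite invr_ge0 ler0n.
apply: ler_sum => t tA; rewrite ge_max; apply/andP; split.
  by apply: sumr_ge0 => k _; exact: max0_ge0.
rewrite /cost exchange_big /=; apply: ler_sum => k _; exact: max0_ge.
Qed.

Lemma excess_scale A F c (x : R) : 0 <= x -> excess A F (fun p => x * c p) = x * excess A F c.
Proof.
move=> x0; rewrite /excess -mulr_sumr.
have -> : \sum_(t in triangles A F) Num.max 0 (cost (fun p => x * c p) t) =
    x * \sum_(t in triangles A F) Num.max 0 (cost c t); last by ring.
by rewrite mulr_sumr; apply: eq_bigr => t _; rewrite /cost -mulr_sumr maxr_pMr // mulr0.
Qed.

(** The excess is concave and invariant, so averaging the cost over the permutations of the isolated
    vertices can only increase it; every condition imposed on costs is convex and invariant. *)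
Lemma balance A F c mu : tame A F c mu -> exists c',
  [/\ excess A F c <= excess A F c', tame A F c' mu, balanced (isolated A F) c'
    & forall M, capped A F c M -> capped A F c' M].
Proof.
move=> [mu0 h1 h2]; set I := isolated A F.
pose G := [set s | perm_on I s]; pose r : R := #|G|%:R^-1.
have G1 : (1%g : {perm T}) \in G by rewrite inE; exact: perm_on1.
have cG : 0 < #|G|%:R :> R by rewrite ltr0n; apply/card_gt0P; exists 1%g.
have r0 : 0 <= r by rewrite invr_ge0 ltW.
have rG (x : R) : r * \sum_(s in G) x = x.
  by rewrite sumr_const -mulr_natl mulrA mulVf ?mul1r // gt_eqF.
pose c' p := r * \sum_(s in G) c (s @: p).
have GE s p : s \in G -> p \in present A F -> s @: p \in present A F.
  rewrite inE => /isolated_perm[sA sF] pA.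
  by rewrite -{1}sA mem_present_imset.
exists c'; split.
- rewrite /c' excess_scale // -[leLHS]rG; apply: ler_wpM2l => //.
  apply: le_trans (excess_concave _ _ _ _); apply: ler_sum => s; rewrite inE => sI.
  by have [sA sF] := isolated_perm sI; rewrite -{1}sA excess_imset.
- split=> // [p pA|p q pA qA pq].
    by rewrite -[leRHS]rG; apply: ler_wpM2l => //; apply: ler_sum => s sG; apply: h1; exact: GE.
  rewrite -mulrDr -big_split -[leRHS]rG; apply: ler_wpM2l => //; apply: ler_sum => s sG.
  by apply: h2; rewrite ?GE // (inj_eq (@imset_perm_inj s)).
- move=> t tI p; rewrite /c'; congr (_ * _); rewrite [RHS](reindex_inj (mulgI t)) /=.
  apply: eq_big => [s|s _].
    rewrite !inE; apply/idP/idP => [sI|tsI]; first exact: perm_onM.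
    by rewrite -[s](mulKg t) perm_onM // perm_onV.
  by congr (c _); rewrite -imset_comp; apply: eq_imset => x /=; rewrite permM.
move=> M [M0 hM]; split=> // p pA.
by rewrite -[leRHS]rG; apply: ler_wpM2l => //; apply: ler_sum => s sG; apply: hM; exact: GE.
Qed.

End Balance.

(** * Sharing demands between hubs *)

Section Distribution.
Variable (T : finType).
Implicit Types (H X : {set T}) (b f : T -> nat).

(** A total between 0 and [\sum b] is reached by unit steps. *)
Lemma partial_sum X b r : r <= \sum_(a in X) b a ->
  exists2 f, (forall a, f a <= b a) & \sum_(a in X) f a = r.
Proof.
elim: r => [_|r IH rX]; first by exists (fun=> 0); rewrite ?big1.
have [f fb fr] := IH (ltnW rX).
have [a aX fa] : exists2 a, a \in X & f a < b a.
  apply/exists_inP; rewrite -[X in is_true X]negbK negb_exists_in; apply/negP => /forall_inP h.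
  have : \sum_(a in X) b a <= \sum_(a in X) f a by apply: leq_sum => a /h; rewrite -leqNgt.
  lia.
exists (fun x => f x + (x == a)) => [x|]; first by case: eqP => [->|_]; rewrite ?addn1 ?addn0.
rewrite big_split /= fr (bigD1 a) //= eqxx big1 ?addn0 ?addn1 // => x /andP[_ /negPf ->]; by [].
Qed.

(** Two demands, each of which may be refused by one supplier. The supplier refusing the second demand is
    used first for the first one, as far as possible. *)
Lemma distribute H b (o1 o2 : option T) D1 D2 : o1 != o2 ->
  D1 + D2 <= \sum_(a in H) b a ->
  (forall a, a \in H -> o1 = Some a -> D1 + b a <= \sum_(a in H) b a) ->
  (forall a, a \in H -> o2 = Some a -> D2 + b a <= \sum_(a in H) b a) ->
  exists f1 f2, [/\ forall a, f1 a + f2 a <= b a, \sum_(a in H) f1 a = D1, \sum_(a in H) f2 a = D2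
    & forall a, (o1 = Some a -> f1 a = 0) /\ (o2 = Some a -> f2 a = 0)].
Proof.
move=> o12 hD h1 h2.
pose at_ (o : option T) a := if o == Some a then b a else 0.
pose b0 a := if (o1 == Some a) || (o2 == Some a) then 0 else b a.
pose B o := \sum_(a in H) at_ o a.
have BE o D : D <= \sum_(a in H) b a -> (forall a, a \in H -> o = Some a -> D + b a <= \sum_(a in H) b a) ->
    D + B o <= \sum_(a in H) b a.
  move=> hD' h; case: o h => [x|] h; last by rewrite /B big1 ?addn0.
  have [xH|xH] := boolP (x \in H).
    rewrite /B (bigD1 x) //= /at_ eqxx big1 ?addn0; first exact: h.
    by move=> a /andP[_ ax]; rewrite (inj_eq (@Some_inj _)) eq_sym (negPf ax).
  rewrite /B big1 ?addn0 // => a aH; rewrite /at_ (inj_eq (@Some_inj _)).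
  by case: eqP => // ax; rewrite ax aH in xH.
have hB : \sum_(a in H) b a = B o1 + B o2 + \sum_(a in H) b0 a.
  rewrite /B -!big_split; apply: eq_bigr => a _ /=; rewrite /at_ /b0.
  case: eqP => [e1|_]; case: eqP => [e2|_] //=; rewrite ?addn0 ?add0n //.
  by rewrite e1 e2 eqxx in o12.
have k1 := BE o1 D1 (leq_trans (leq_addr _ _) hD) h1.
have k2 := BE o2 D2 (leq_trans (leq_addl _ _) hD) h2.
(* The first demand takes from the supplier that refuses the second one as much as possible. *)
pose p1 := minn D1 (B o2).
have [|g gb gs] := @partial_sum H b0 (D1 - p1); first by rewrite /p1; lia.
have [|k kb ks] := @partial_sum H (at_ o2) p1; first exact: geq_minr.
pose c2 a := (if o2 == Some a then 0 else b a) - g a.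
have g0 a : (o1 == Some a) || (o2 == Some a) -> g a = 0.
  by move=> h; apply/eqP; rewrite -leqn0; have := gb a; rewrite /b0 h.
have c2s : \sum_(a in H) c2 a + (D1 - p1) + B o2 = \sum_(a in H) b a.
  rewrite -gs /B -!big_split; apply: eq_bigr => a _ /=; rewrite /c2 /at_.
  case: ifP => [e|e]; first by rewrite g0 ?e ?orbT.
  by rewrite addn0 subnK //; apply: leq_trans (gb a) _; rewrite /b0; case: ifP.
have [|f2 f2b f2s] := @partial_sum H c2 D2; first by move: c2s; rewrite /p1; lia.
exists (fun a => g a + k a), f2; split=> [a| |//|a].
- have := f2b a; have := kb a; have := gb a; rewrite /c2 /at_ /b0.
  by case: (o1 == Some a); case: (o2 == Some a) => /=; lia.
- by rewrite big_split /= gs ks subnK // geq_minl.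
split=> e; have := f2b a; have := kb a; have := gb a; rewrite /c2 /at_ /b0 e eqxx ?orbT /=; last lia.
by rewrite (negPf (_ : o2 != Some a)) //; [lia|rewrite -e eq_sym].
Qed.

End Distribution.

(** * What hubs and triangles at isolated vertices give back *)

Section Recovery.
Local Open Scope ring_scope.
Variables (R : realFieldType) (T : finType).
Implicit Types (B N : {set T}) (S C : {set {set T}}) (p q t e : {set T}).
Variables (A : {set T}) (F : {set {set T}}) (c : {set T} -> R).
Let I := isolated A F.
Let W := A :\: I.
Hypothesis balI : balanced I c.

Lemma tperm_onI z z' : z \in I -> z' \in I -> perm_on I (tperm z z').
Proof.
move=> zI z'I; apply: subset_trans (tperm_on z z') _.
by rewrite subUset !sub1set zI.
Qed.

Lemma isoA z : z \in I -> z \in A. Proof. by rewrite inE => /andP[]. Qed.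

Lemma spoke_cost z z' y : z \in I -> z' \in I -> y != z -> y != z' ->
  c [set z; y] = c [set z'; y].
Proof.
move=> zI z'I yz yz'; rewrite -(balI (tperm_onI zI z'I) [set z; y]).
by rewrite imsetU !imset_set1 tpermL tpermD // eq_sym.
Qed.

Lemma inner_cost z z' w w' : z \in I -> z' \in I -> w \in I -> w' \in I -> z != z' -> w != w' ->
  c [set z; z'] = c [set w; w'].
Proof.
move=> zI z'I wI w'I zz' ww'.
have [wz'|wz'] := eqVneq w z'.
  rewrite wz' (setUC [set z'] [set w']); apply: spoke_cost => //; first by rewrite eq_sym.
  by rewrite -wz'.
rewrite (@spoke_cost z w z') // 1?eq_sym //.
rewrite (setUC [set w] [set z']) (setUC [set w] [set w']); by apply: spoke_cost.
Qed.

Lemma isolated_excess z z' : z \in I -> z' \in I ->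
  excess (A :\ z) F c = excess (A :\ z') F c.
Proof.
move=> zI z'I; have tI := tperm_onI zI z'I; have [tA tF] := isolated_perm tI.
have -> : A :\ z' = tperm z z' @: (A :\ z).
  apply/setP => x; rewrite -{1}tA; apply/setD1P/imsetP => [[xz' /imsetP[y yA ex]]|[y /setD1P[yz yA] ->]].
    exists y => //; rewrite in_setD1 yA andbT; apply: contraNneq xz' => yz.
    by rewrite ex yz tpermL.
  split; last exact: imset_f.
  by rewrite -{2}(tpermL z z') (inj_eq perm_inj).
rewrite excess_imset; last by move=> p; rewrite pairsD1 => /andP[pA _]; exact: tF.
rewrite /excess; congr (_ - _ * _); first by apply: eq_bigr => p _; rewrite balI.
by apply: eq_bigr => t _; congr (Num.max 0 _); apply: eq_bigr => p _; rewrite balI.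
Qed.

(** The cost of the triangle [z |: e] at the isolated vertex [z], divided equally among its isolated
    vertices, so that summing over all isolated vertices counts each triangle once. *)
Definition share z e : R := Num.max 0 (cost c (z |: e)) / #|(z |: e) :&: I|%:R.

Lemma share_ge0 z e : 0 <= share z e.
Proof. by rewrite divr_ge0 ?max0_ge0 ?ler0n. Qed.

Lemma neighbours_isolated z : z \in I -> neighbours A F z = A :\ z.
Proof.
move=> zI; apply/setP => u; rewrite !inE; case uA: (u \in A); rewrite ?andbF ?andbT //=.
by case uz: (u == z) => //=; rewrite (isolatedP zI) // uz.
Qed.

(** By symmetry every isolated vertex has the same total share over the images of [S]. *)
Lemma share_sum z S : z \in I -> S \subset present (A :\ z) F ->
  #|I|%:R * \sum_(e in S) share z e <= \sum_(t in triangles A F) Num.max 0 (cost c t).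
Proof.
move=> zI sS; pose g t : R := Num.max 0 (cost c t) / #|t :&: I|%:R.
have g0 t : 0 <= g t by rewrite divr_ge0 ?max0_ge0 ?ler0n.
have all_same z' : z' \in I -> \sum_(t in triangles A F | z' \in t) g t = \sum_(t in triangles A F | z \in t) g t.
  move=> z'I; have tI := tperm_onI zI z'I; have [tA tF] := isolated_perm tI.
  rewrite (reindex_inj (imset_perm_inj (s := tperm z z'))) /=; apply: eq_big => t.
    rewrite -{1}tA mem_triangles_imset // -{1}(tpermL z z') mem_imset //; exact: perm_inj.
  move=> _; rewrite /g cost_imset; congr (Num.max 0 _ / _).
    by apply: eq_bigr => p _; rewrite balI.
  rewrite -[in RHS](card_imset _ (@perm_inj _ (tperm z z'))); congr (_%:R); congr #|pred_of_set _|.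
  rewrite imsetI; last by move=> x y _ _; exact: perm_inj.
  congr (_ :&: _); apply/setP => x; rewrite -[X in _ = (X \in _)](tpermK z z').
  rewrite mem_imset; last exact: perm_inj.
  by rewrite (perm_closed _ tI).
have -> : #|I|%:R * \sum_(e in S) share z e = \sum_(z' in I) \sum_(e in S) share z e.
  by rewrite sumr_const mulr_natl.
apply: (@le_trans _ _ (\sum_(z' in I) \sum_(t in triangles A F | z' \in t) g t)).
  apply: ler_sum => z' z'I; rewrite all_same //.
  rewrite [leRHS](eq_bigl (fun t => t \in [set t in triangles A F | z \in t])); last by move=> t; rewrite [RHS]in_set.
  rewrite triangles_at ?isoA // neighbours_isolated // big_imset /=; last first.
    have nz (r : {set T}) : r \in present (A :\ z) F -> z \notin r.
      by rewrite in_setD pairsD1 => /and3P[].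
    move=> p q /nz pz /nz qz e.
    by rewrite -(setU1K pz) e setU1K.
  by apply: sum_subset sS _ => p _; exact: g0.
rewrite (exchange_big_dep (mem (triangles A F))) //=; last by move=> z' t _ /andP[].
apply: ler_sum => t tA; rewrite (eq_bigl (mem (t :&: I))); last first.
  by move=> x; rewrite /= in_setI tA /= andbC.
rewrite sumr_const -mulr_natl /g mulrCA.
have [->|h] := eqVneq #|t :&: I| 0%N; first by rewrite mul0r mulr0 max0_ge0.
by rewrite divff ?mulr1 // pnatr_eq0.
Qed.

Section Values.
Variables (kap : R) (gam : T -> R) (z : T).
Hypothesis zI : z \in I.
Hypothesis kapE : forall z1 z2, z1 \in I -> z2 \in I -> z1 != z2 -> c [set z1; z2] = kap.
Hypothesis gamE : forall z1 y, z1 \in I -> y \in W -> c [set z1; y] = gam y.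

Lemma notI y : y \in W -> y \notin I. Proof. by rewrite in_setD => /andP[]. Qed.

Lemma sum_set2 u v (f : T -> R) : u != v -> \sum_(x in [set u; v]) f x = f u + f v.
Proof. by move=> uv; rewrite big_setU1 ?inE // big_set1. Qed.

Lemma share_WW u v : u \in W -> v \in W -> u != v ->
  c [set u; v] + gam u + gam v <= share z [set u; v].
Proof.
move=> uW vW uv; have zu : z != u by apply: contraTneq zI => ->; exact: notI.
have zv : z != v by apply: contraTneq zI => ->; exact: notI.
have eI : (z |: [set u; v]) :&: I = [set z].
  apply/setP => x; rewrite in_setI in_setU1 in_set1 in_set2.
  case: eqP => [->|_] /=; first by rewrite zI.
  apply/negbTE; rewrite negb_and orbC -implybE; apply/implyP => xI.
  by rewrite negb_or; apply/andP; split; apply: contraTneq xI => ->; exact: notI.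
rewrite /share eI cards1 divr1 cost_add; last 2 first.
- by rewrite !inE negb_or zu.
- by rewrite cards2 uv.
by rewrite sum_set2 //= (gamE zI uW) (gamE zI vW) addrA; exact: max0_ge.
Qed.

Lemma share_IW z' y : z' \in I -> z' != z -> y \in W ->
  gam y + kap / 2 <= share z [set z'; y].
Proof.
move=> z'I z'z yW; have zy : z != y by apply: contraTneq zI => ->; exact: notI.
have z'y : z' != y by apply: contraTneq z'I => ->; exact: notI.
have eI : (z |: [set z'; y]) :&: I = [set z; z'].
  apply/setP => x; rewrite in_setI in_setU1 !in_set2.
  case: eqP => [->|_] /=; first by rewrite zI.
  case: eqP => [->|_] /=; first by rewrite z'I.
  by case: eqP => [->|_] //=; rewrite (negbTE (notI yW)).
rewrite /share eI cost_add; last 2 first.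
- by rewrite !inE negb_or eq_sym z'z.
- by rewrite cards2 z'y.
rewrite sum_set2 //= (gamE z'I yW) (gamE zI yW) (kapE zI z'I) 1?eq_sym // cards2 eq_sym z'z /=.
by rewrite ler_pdivlMr ?ltr0n //; apply: le_trans (max0_ge _); lra.
Qed.

Lemma share_II z1 z2 : z1 \in I -> z2 \in I -> z1 != z -> z2 != z -> z1 != z2 ->
  kap <= share z [set z1; z2].
Proof.
move=> z1I z2I z1z z2z z12.
rewrite /share cost_add; last 2 first.
- by rewrite !inE negb_or ![z == _]eq_sym z1z z2z.
- by rewrite cards2 z12.
rewrite sum_set2 //= (kapE z1I z2I) // (kapE zI z1I) 1?eq_sym // (kapE zI z2I) 1?eq_sym // (setIidPl _); last first.
  by rewrite !subUset !sub1set zI z1I z2I.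
rewrite cardsU1 !inE negb_or ![z == _]eq_sym z1z z2z cards2 z12 /=.
by rewrite ler_pdivlMr ?ltr0n //; apply: le_trans (max0_ge _); lra.
Qed.

(** The pairs that a hub can be asked to give up: those from the isolated part to a core vertex [u] (for
    [Some u]), or those inside the isolated part (for [None]). *)
Definition spokes (o : option T) : {set {set T}} :=
  if o is Some u then [set [set z; u] | z in I] else pairs I.
(** A balanced cost is constant on [spokes o], with this value. *)
Definition value o := if o is Some u then gam u else kap.
Definition inW o := if o is Some u then u \in W else true.

Lemma spokesP o p : inW o -> p \in spokes o -> exists2 z1, z1 \in I &
  exists2 x, p = [set z1; x] & if o is Some u then x = u else (x \in I) && (z1 != x).
Proof.
case: o => [u|] /= _; first by case/imsetP => z1 z1I ->; exists z1 => //; exists u.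
by case/pairsP => z1 [z2 [z1I z2I z12 ->]]; exists z1 => //; exists z2; rewrite ?z2I.
Qed.

Lemma spokes_cost o p : inW o -> p \in spokes o -> c p = value o.
Proof.
move=> oW /(spokesP oW)[z1 z1I [x ->]]; case: o oW => [u|] /= oW; first by move=> ->; apply: gamE.
by case/andP => xI z1x; apply: kapE.
Qed.

Lemma spokes_core o p : inW o -> p \in spokes o -> p :\: I = if o is Some u then [set u] else set0.
Proof.
move=> oW /(spokesP oW)[z1 z1I [x ->]] ox; apply/setP => y; rewrite in_setD in_set2.
case: o oW ox => [u|] /= oW; rewrite ?in_set1 ?in_set0.
  move=> ->; have [->|_] := eqVneq y z1; last first.
    by case: eqP => [->|]; rewrite ?andbF // notI.
  by rewrite z1I /=; apply/esym/negbTE; apply: contraTneq z1I => ->; exact: notI.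
case/andP => xI _; have [->|_] := eqVneq y z1; first by rewrite z1I.
by case: eqP => [->|]; rewrite ?andbF // xI.
Qed.

Lemma card_spokes o : inW o -> #|spokes o| = (if o is Some _ then #|I| else 'C(#|I|, 2))%N.
Proof.
case: o => [u|] /= oW; last exact: card_pairs.
rewrite card_in_imset // => z1 z2 z1I z2I /set2_inj[[]|[e1 e2]] //.
by rewrite e1.
Qed.

Lemma spokes_present o a : inW o -> a \in W -> o != Some a -> spokes o \subset present (A :\ a) F.
Proof.
move=> oW aW oa; apply/subsetP => p po; have ep := spokes_core oW po.
have [z1 z1I [x px ox]] := spokesP oW po.
have z1a : z1 != a by apply: contraTneq z1I => ->; exact: notI.
have [xA xa xz] : [/\ x \in A, x != a & x != z1].
  case: o oW oa ox {po ep} => [u|] /= oW oa ox.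
    subst x; split; first by move: oW; rewrite in_setD => /andP[].
      by apply: contraNneq oa => ->.
    by apply: contraTneq z1I => <-; exact: notI.
  case/andP: ox => xI z1x; split; [exact: isoA| |by rewrite eq_sym].
  by apply: contraTneq xI => ->; exact: notI.
rewrite in_setD px mem_pairs2 !in_setD1 z1a xa xA (isoA z1I) eq_sym xz !andbT.
exact: (isolatedP z1I).
Qed.

(** After the deletion of a hub there is room for as many further missing pairs as its degree exceeds what
    is needed. They are spent on spokes, so the excess drops to their cost, in which only [gam] and [kap]
    occur. *)
Lemma hub_bound n mu a o1 o2 s1 s2 : deficit_bound R T 0 n -> #|A| = n.+1 -> tame A F c mu -> a \in W ->
  inW o1 -> inW o2 -> o1 != o2 ->
  (missing A F + (s1 + s2) + 4 <= n + degree A F a)%N ->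
  (o1 = Some a -> s1 = 0%N) -> (o2 = Some a -> s2 = 0%N) ->
  (s1 <= #|spokes o1|)%N -> (s2 <= #|spokes o2|)%N ->
  excess (A :\ a) F c <= s1%:R * value o1 + s2%:R * value o2.
Proof.
move=> Q0 cA tc aW o1W o2W o12 hm h1 h2 l1 l2.
have [S1 sS1 cS1] := subset_card l1; have [S2 sS2 cS2] := subset_card l2.
have pS o s S : inW o -> S \subset spokes o -> #|S| = s -> (o = Some a -> s = 0%N) -> S \subset present (A :\ a) F.
  move=> oW sS cS ho; have [oa|oa] := eqVneq o (Some a).
    by rewrite (_ : S = set0) ?sub0set //; apply/eqP; rewrite -cards_eq0 cS ho.
  exact: subset_trans sS (spokes_present oW aW oa).
have sumS o s S : inW o -> S \subset spokes o -> #|S| = s -> \sum_(p in S) c p = s%:R * value o.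
  move=> oW sS <-; rewrite (eq_bigr (fun=> value o)) ?sumr_const ?mulr_natl // => p pS'.
  exact: spokes_cost oW (subsetP sS _ pS').
have dis : [disjoint S1 & S2].
  rewrite -setI_eq0; apply/eqP/setP => p; rewrite in_setI in_set0; apply/negP => /andP[p1 p2].
  have := spokes_core o1W (subsetP sS1 _ p1); rewrite (spokes_core o2W (subsetP sS2 _ p2)).
  move: o12; case: o1 {o1W h1 l1 sS1} => [u|]; case: o2 {o2W h2 l2 sS2} => [v|] //= uv.
  - by move=> /setP/(_ u); rewrite !in_set1 eqxx => /eqP e; rewrite e eqxx in uv.
  - by move=> /setP/(_ u); rewrite in_set1 in_set0 eqxx.
  - by move=> /setP/(_ v); rewrite in_set1 in_set0 eqxx.
have sS : S1 :|: S2 \subset present (A :\ a) F.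
  by rewrite subUset (pS o1 s1) // (pS o2 s2).
have dS : S2 :\: S1 = S2 by apply/setDidPl; rewrite disjoint_sym.
have eS : \sum_(p in S1 :|: S2) c p = s1%:R * value o1 + s2%:R * value o2.
  rewrite (big_setID S1) /= setUK setDUl setDv set0U dS.
  by rewrite (sumS o1 s1) // (sumS o2 s2).
have := excess_add c sS; rewrite eS.
have aA : a \in A by move: aW; rewrite in_setD => /andP[].
suff : excess (A :\ a) (F :|: (S1 :|: S2)) c <= 0%:R * mu by rewrite mul0r; lra.
apply: Q0.
- by have := cardsD1 a A; rewrite aA cA; case.
- have h := missingU (A :\ a) F (S1 :|: S2).
  have : (#|S1 :|: S2| <= #|S1| + #|S2|)%N by rewrite leq_card_setU.
  by have := missingD1 A F a; lia.
- apply: tameS tc; apply: presentS; [exact: subD1set|exact: subsetUl].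
Qed.

(** The demands are distributed over the hubs; a hub [a] has no spokes towards itself, hence the
    hypotheses that the other hubs can take over. *)
Lemma supply n mu (H : {set T}) (b : T -> nat) o1 o2 D1 D2 : deficit_bound R T 0 n -> #|A| = n.+1 -> tame A F c mu ->
  H \subset W -> inW o1 -> inW o2 -> o1 != o2 ->
  (forall a, a \in H -> (missing A F + b a + 4 <= n + degree A F a)%N) ->
  (D1 + D2 <= \sum_(a in H) b a)%N ->
  (forall a, a \in H -> o1 = Some a -> (D1 + b a <= \sum_(a in H) b a)%N) ->
  (forall a, a \in H -> o2 = Some a -> (D2 + b a <= \sum_(a in H) b a)%N) ->
  (forall a, a \in H -> (minn (b a) D1 <= #|spokes o1|)%N) ->
  (forall a, a \in H -> (minn (b a) D2 <= #|spokes o2|)%N) ->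
  \sum_(a in H) excess (A :\ a) F c <= D1%:R * value o1 + D2%:R * value o2.
Proof.
move=> Q0 cA tc HW o1W o2W o12 hb hD h1 h2 l1 l2.
have [f1 [f2 [fb e1 e2 f0]]] := distribute o12 hD h1 h2.
rewrite -[D1 in leRHS]e1 -[D2 in leRHS]e2 !natr_sum !mulr_suml -big_split /=; apply: ler_sum => a aH.
have le1 : (f1 a <= D1)%N by rewrite -e1 (bigD1 a) //= leq_addr.
have le2 : (f2 a <= D2)%N by rewrite -e2 (bigD1 a) //= leq_addr.
have [f10 f20] := f0 a; have fba := fb a; have hba := hb a aH.
apply: (@hub_bound n mu) => //; first exact: (subsetP HW).
- by lia.
- by apply: leq_trans (l1 a aH); rewrite leq_min le1 andbT; lia.
- by apply: leq_trans (l2 a aH); rewrite leq_min le2 andbT; lia.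
Qed.

(** An upper bound for what pairs inside the isolated part can add to a share; there are none if only one
    vertex is isolated. *)
Definition inner_cap : R := if (1 < #|I|)%N then Num.min kap 0 else 0.

Lemma inner_cap_le0 : inner_cap <= 0.
Proof. by rewrite /inner_cap; case: ifP => // _; rewrite ge_min lexx orbT. Qed.

Lemma inner_cap_le : (1 < #|I|)%N -> inner_cap <= kap.
Proof. by rewrite /inner_cap => ->; rewrite ge_min lexx. Qed.

(** Either the pair is nonnegative inside the core, and both spokes towards it enter its share, or it is
    enough to know that spoke and inner costs cannot pull the share below [inner_cap / 2]. *)
Lemma share_outcome e : e \in present (A :\ z) F ->
  (exists u v, [/\ u \in W, v \in W, u != v, e = [set u; v]
     & Num.max 0 (c e) + (gam u + gam v) <= share z e]) \/
  Num.max 0 (c e) + inner_cap / 2 <= share z e.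
Proof.
rewrite in_setD => /andP[_ /pairsP[u [v [uA vA uv ->]]]].
have WI x : x \in A :\ z -> (x \in W) = (x \notin I).
  by rewrite !in_setD1 in_setD => /andP[_ ->]; rewrite andbT.
have k0 := inner_cap_le0; have s0 := share_ge0 z [set u; v].
have uz : u != z by move: uA; rewrite in_setD1 => /andP[].
have vz : v != z by move: vA; rewrite in_setD1 => /andP[].
have two x : x \in I -> x != z -> (1 < #|I|)%N.
  by move=> xI xz; rewrite (cardsD1 z) zI (cardsD1 x) in_setD1 xz xI.
have [uW|uW] := boolP (u \in W); have [vW|vW] := boolP (v \in W).
- have [h|h] := ltP (c [set u; v]) 0.
    by right; lra.
  left; exists u, v; split=> //.
  by have := share_WW uW vW uv; lra.
- right; have vI : v \in I by rewrite -[_ \in _]negbK -WI.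
  rewrite (setUC [set u] [set v]) in s0 *.
  have := share_IW vI vz uW; have := inner_cap_le (two v vI vz); rewrite (gamE vI uW) => h1 h2.
  by case: (leP 0 (gam u)) => h; lra.
- right; have uI : u \in I by rewrite -[_ \in _]negbK -WI.
  have := share_IW uI uz vW; have := inner_cap_le (two u uI uz); rewrite (gamE uI vW) => h1 h2.
  by case: (leP 0 (gam v)) => h; lra.
right; have uI : u \in I by rewrite -[_ \in _]negbK -WI.
have vI : v \in I by rewrite -[_ \in _]negbK -WI.
have := share_II uI vI uz vz uv; have := inner_cap_le (two u uI uz); rewrite (kapE uI vI uv) => h1 h2.
by case: (leP 0 kap) => h; lra.
Qed.

(** The smaller the share of [e], the cheaper are the spokes used in it, and the smaller is the excess
    after deleting the hubs: the two cases of [share_outcome] correspond to two ways of choosing the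
    spokes that the hubs give up. *)
Lemma hubs_recover n mu (H : {set T}) (b : T -> nat) X w e : deficit_bound R T 0 n -> #|A| = n.+1 -> tame A F c mu ->
  H \subset W -> w \in W -> (forall a, a \in H -> (missing A F + b a + 4 <= n + degree A F a)%N) ->
  (2 * X <= \sum_(a in H) b a)%N ->
  (forall a, a \in H -> (X + b a <= \sum_(a in H) b a)%N) ->
  (forall a, a \in H -> (minn (b a) X <= #|I|)%N) ->
  ((1 < #|I|)%N -> (uphalf X <= 'C(#|I|, 2))%N) -> e \in present (A :\ z) F ->
  \sum_(a in H) excess (A :\ a) F c <= X%:R * (share z e - Num.max 0 (c e)).
Proof.
move=> Q0 cA tc HW wW hb h2 hX hi hI eE; have X0 : 0 <= X%:R :> R by rewrite ler0n.
case: (share_outcome eE) => [[u [v [uW vW uv _ h]]]|h].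
  apply: (@le_trans _ _ (X%:R * (gam u + gam v))); last by apply: ler_wpM2l => //; lra.
  rewrite mulrDr; apply: (@supply n mu H b (Some u) (Some v)) => //.
  - by lia.
  - by move=> a aH _; exact: hX.
  - by move=> a aH _; exact: hX.
  - by move=> a aH; rewrite card_spokes // hi.
  - by move=> a aH; rewrite card_spokes // hi.
apply: (@le_trans _ _ (X%:R * (inner_cap / 2))); last by apply: ler_wpM2l => //; lra.
have inner D : (D <= X)%N -> (D <= 'C(#|I|, 2))%N -> \sum_(a in H) excess (A :\ a) F c <= D%:R * kap.
  move=> DX DI; have -> : D%:R * kap = 0%:R * value (Some w) + D%:R * value None by rewrite mul0r add0r.
  apply: (@supply n mu H b (Some w) None 0) => //.
  - by lia.
  - by move=> a aH _; rewrite add0n; apply: leq_trans (hX a aH); exact: leq_addl.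
  by move=> a aH; rewrite card_spokes //; apply: leq_trans DI; exact: geq_minr.
have := inner 0%N (leq0n _) (leq0n _); rewrite mul0r /inner_cap.
case: ifP => i1; last by rewrite mul0r mulr0.
have [k0|k0] := ltP kap 0; last by rewrite mul0r mulr0.
move=> _; apply: le_trans (inner (uphalf X) _ (hI i1)) _; first by lia.
rewrite mulrCA mulrC; apply: ler_wnM2l; first exact: ltW.
by rewrite ler_pdivrMr // -natrM ler_nat; lia.
Qed.

End Values.
End Recovery.

(** * The induction step for small deficits *)

Section Step.
Local Open Scope ring_scope.
Variables (R : realFieldType) (T : finType).
Implicit Types (A B N W H : {set T}) (F S C : {set {set T}}) (p q t e : {set T}) (c : {set T} -> R).

Lemma top_two (J : finType) (E : {set J}) (c : J -> R) : (1 < #|E|)%N -> exists e1 e2 : J,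
  [/\ e1 \in E, e2 \in E, e1 != e2, {in E, forall x : J, c x <= c e1}
    & {in E, forall x : J, x != e1 -> c x <= c e2}].
Proof.
move=> E2; have /card_gt0P[x0 x0E] : (0 < #|E|)%N by apply: ltnW.
case: (@arg_maxP _ _ _ x0 (mem E) c x0E) => e1 e1E m1.
have /card_gt0P[x1 x1E] : (0 < #|E :\ e1|)%N.
  by have := cardsD1 e1 E; rewrite [e1 \in E]e1E; lia.
case: (@arg_maxP _ _ _ x1 (mem (E :\ e1)) c x1E) => e2 e2E m2.
have e2E' : e2 \in E :\ e1 by exact: e2E.
move: e2E'; rewrite in_setD1 => /andP[e21 e2E'].
exists e1, e2; split=> //; first by rewrite eq_sym.
move=> p pE pe1; apply: m2; change (p \in E :\ e1).
by rewrite in_setD1 pe1.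
Qed.

(** Only the two largest costs matter for tameness. *)
Lemma tame_top E A F c e1 e2 : E = present A F -> e1 \in E -> e2 \in E -> {in E, forall p, c p <= c e1} ->
  {in E, forall p, p != e1 -> c p <= c e2} ->
  tame A F c (2^-1 * (Num.max 0 (c e1) + Num.max 0 (c e2))).
Proof.
move=> eE e1E e2E m1 m2; have a1 := max0_ge (c e1); have a2 := max0_ge (c e2).
have b1 := max0_ge0 (c e1); have b2 := max0_ge0 (c e2).
split; first by lra.
  by rewrite -eE => p /m1; lra.
rewrite -eE => p q pE qE pq; have [pe|pe] := eqVneq p e1.
  have qe : q != e1 by rewrite -pe eq_sym.
  by have := m2 q qE qe; have := m1 p pE; lra.
by have := m2 p pE pe; have := m1 q qE; lra.
Qed.

Lemma card_present A F : (#|present A F| + missing A F = 'C(#|A|, 2))%N.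
Proof.
by rewrite -card_pairs -(cardsID F (pairs A)) addnC /missing setIC.
Qed.

Lemma sum_split3 A F H (f : T -> R) : H \subset A :\: isolated A F ->
  \sum_(v in A) f v = \sum_(v in isolated A F) f v + \sum_(v in H) f v
   + \sum_(v in (A :\: isolated A F) :\: H) f v.
Proof.
move=> HW; have sI : isolated A F \subset A by apply/subsetP => z; rewrite inE => /andP[].
rewrite (big_setID (isolated A F)) /= (setIidPr sI) -addrA; congr (_ + _).
by rewrite (big_setID H) /= (setIidPr HW).
Qed.

(** The vertices whose deletion leaves fewer missing pairs than the bound with deficit 0 allows. *)
Definition hubs_of k A F := [set a in A :\: isolated A F | (k.+1 < degree A F a)%N].

Lemma hubs_sub k A F : hubs_of k A F \subset A :\: isolated A F.
Proof. by apply/subsetP => a; rewrite inE => /andP[]. Qed.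

(** What the deletion of the other core vertices costs, in units of [mu]. *)
Definition slack k A F := (\sum_(a in (A :\: isolated A F) :\: hubs_of k A F) (k.+1 - degree A F a))%N.
(** What the deletion of the hubs wastes. *)
Definition surplus k A F := (\sum_(a in hubs_of k A F) (degree A F a - k.+1))%N.

Lemma degree_sum A F : (\sum_(a in A :\: isolated A F) degree A F a = 2 * missing A F)%N.
Proof. by rewrite -missing_core -handshake; apply: eq_bigr => a _; rewrite degree_core. Qed.

Lemma slack_surplus k A F :
  (slack k A F + 2 * missing A F = k.+1 * #|A :\: isolated A F| + surplus k A F)%N.
Proof.
rewrite -degree_sum /slack /surplus mulnC -sum_nat_const.
rewrite !(big_setID (hubs_of k A F) (A := A :\: isolated A F)) /= (setIidPr (hubs_sub k A F)).
rewrite addnCA [RHS]addnAC -!big_split /=; congr (_ + _)%N; apply: eq_bigr => a; last first.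
  by rewrite !in_setD inE in_setD; case: (a \in A); case: (a \in isolated A F) => //=; lia.
by rewrite inE => /andP[_ h]; lia.
Qed.

(** The averaging identity with the bounds for the core vertices other than hubs inserted. *)
Lemma average_step n k A F c mu (x : R) : (forall j, (j <= k)%N -> deficit_bound R T j n) -> (2 < n)%N -> #|A| = n.+1 ->
  (missing A F + 4 = n.+1 + k)%N -> tame A F c mu ->
  \sum_(a in isolated A F) excess (A :\ a) F c + \sum_(a in hubs_of k A F) excess (A :\ a) F c
   - 2^-1 * \sum_(t in triangles A F) Num.max 0 (cost c t) <= x ->
  x + (slack k A F)%:R * mu <= k%:R * (n.+1%:R - 2) * mu -> excess A F c <= k%:R * mu.
Proof.
move=> HQ n2 cA mA tc hx hk.
have A2 : (2 < #|A|)%N by rewrite cA; lia.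
have n1 : 0 < n.+1%:R - 2 :> R by rewrite subr_gt0 (ltr_nat _ 2); lia.
rewrite -(ler_pM2l n1).
have := excess_average F c A2; rewrite cA => ->.
rewrite (sum_split3 _ (hubs_sub k A F)).
have : \sum_(v in (A :\: isolated A F) :\: hubs_of k A F) excess (A :\ v) F c <= (slack k A F)%:R * mu.
  rewrite /slack natr_sum mulr_suml; apply: ler_sum => a; rewrite !in_setD inE in_setD.
  case aA: (a \in A); rewrite ?andbF // andbT; case aI: (a \in isolated A F) => //=.
  rewrite andbT -leqNgt => da; apply: HQ.
  - by have : (0 < degree A F a)%N; [apply: degree_core_gt0; rewrite in_setD aI|lia].
  - by have := cardsD1 a A; rewrite aA cA; case.
  - by have := missingD1 A F a; lia.
  - by apply: tameS tc; apply: presentS => //; exact: subD1set.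
lra.
Qed.

Lemma hub_drop n k A F c mu a : deficit_bound R T 0 n -> #|A| = n.+1 -> (missing A F + 4 = n.+1 + k)%N -> tame A F c mu ->
  a \in hubs_of k A F -> excess (A :\ a) F c <= 0.
Proof.
move=> Q0 cA mA tc; rewrite inE in_setD => /andP[/andP[_ aA] da].
rewrite -(mul0r mu); apply: Q0.
- by have := cardsD1 a A; rewrite aA cA; case.
- by have := missingD1 A F a; lia.
- by apply: tameS tc; apply: presentS => //; exact: subD1set.
Qed.

(** Here the isolated vertices cost [k + 1] each and the hubs nothing; a surplus of at most [n + 1 - 8] is
    affordable. *)
Lemma average_suffices n k A F c mu : (forall j, (j <= k.+1)%N -> deficit_bound R T j n) -> (7 < n)%N -> #|A| = n.+1 ->
  (missing A F + 4 = n.+1 + k)%N -> (surplus k A F + 8 <= n.+1)%N -> tame A F c mu ->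
  excess A F c <= k%:R * mu.
Proof.
move=> HQ n7 cA mA hB tc; have [mu0 _ _] := tc.
apply: (@average_step n k A F c mu ((#|isolated A F| * k.+1)%:R * mu) (fun j hj => HQ j (leqW hj))) => //; first by lia.
  have h1 : \sum_(a in isolated A F) excess (A :\ a) F c <= (#|isolated A F| * k.+1)%:R * mu.
    rewrite natrM -mulrA mulr_natl -sumr_const; apply: ler_sum => a; rewrite inE => /andP[aA /eqP da].
    apply: HQ => //; first by have := cardsD1 a A; rewrite aA cA; case.
      by have := missingD1 A F a; lia.
    by apply: tameS tc; apply: presentS => //; exact: subD1set.
  have h2 : \sum_(a in hubs_of k A F) excess (A :\ a) F c <= 0.
    by apply: sumr_le0 => a aH; exact: (hub_drop (HQ 0%N isT) cA mA tc aH).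
  have h3 : 0 <= \sum_(t in triangles A F) Num.max 0 (cost c t).
    by apply: sumr_ge0 => t _; exact: max0_ge0.
  lra.
rewrite -mulrDl; apply: ler_wpM2r => //.
rewrite -natrD; have -> : n.+1%:R - 2 = (n.+1 - 2)%:R :> R by rewrite natrB //; lia.
rewrite -natrM ler_nat.
have := slack_surplus k A F; have := card_core A F; rewrite cA; nia.
Qed.

(** Besides its surplus every core vertex contributes at least 1 to the degree sum, and a hub contributes
    [k + 1]. *)
Lemma surplus_pair k A F a b : a \in hubs_of k A F -> b \in hubs_of k A F -> a != b ->
  (surplus k A F + #|A :\: isolated A F| + 2 * k <= 2 * missing A F)%N.
Proof.
move=> aH bH ab; rewrite -degree_sum -sum1_card /surplus.
rewrite !(big_setID (hubs_of k A F) (A := A :\: isolated A F)) /= (setIidPr (hubs_sub k A F)).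
have h1 : (\sum_(i in hubs_of k A F) (degree A F i - k.+1) + \sum_(i in hubs_of k A F) 1 + 2 * k <=
   \sum_(i in hubs_of k A F) degree A F i)%N.
  rewrite -big_split /= (bigD1 a) //= (bigD1 b) /=; last by rewrite bH eq_sym.
  rewrite [leqRHS](bigD1 a) //= [X in (_ <= _ + X)%N](bigD1 b) /=; last by rewrite bH eq_sym.
  have := aH; have := bH; rewrite !inE => /andP[_ db] /andP[_ da].
  have : (\sum_(i | (i \in hubs_of k A F) && (i != a) && (i != b)) (degree A F i - k.+1 + 1) <=
    \sum_(i | (i \in hubs_of k A F) && (i != a) && (i != b)) degree A F i)%N.
    by apply: leq_sum => i /andP[/andP[]]; rewrite inE => /andP[_ di] _ _; lia.
  lia.
have h2 : (\sum_(i in (A :\: isolated A F) :\: hubs_of k A F) 1 <=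
  \sum_(i in (A :\: isolated A F) :\: hubs_of k A F) degree A F i)%N.
  by apply: leq_sum => i; rewrite in_setD => /andP[_ iW]; exact: degree_core_gt0.
lia.
Qed.

(** A balanced cost takes one value [kap] inside the isolated part and depends only on the core end of a
    spoke. *)
Lemma balanced_values A F c z : balanced (isolated A F) c -> z \in isolated A F ->
  exists kap, [/\ forall z1 z2, z1 \in isolated A F -> z2 \in isolated A F -> z1 != z2 -> c [set z1; z2] = kap
    & forall z1 y, z1 \in isolated A F -> y \in A :\: isolated A F -> c [set z1; y] = c [set z; y]].
Proof.
move=> bal zI; have other z1 y : z1 \in isolated A F -> y \in A :\: isolated A F -> y != z1.
  by move=> z1I; rewrite in_setD => /andP[yI _]; apply: contraNneq yI => ->.
have hg z1 y : z1 \in isolated A F -> y \in A :\: isolated A F -> c [set z1; y] = c [set z; y].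
  by move=> z1I yW; apply: (spoke_cost bal) => //; exact: other.
have [/exists_inP[z' z'I z'z]|h] := boolP [exists z' in isolated A F, z' != z].
  exists (c [set z; z']); split=> // z1 z2 z1I z2I z12.
  by apply: (inner_cost bal) => //; rewrite eq_sym.
exists 0; split=> // z1 z2 z1I z2I z12.
have eqz x : x \in isolated A F -> x = z.
  by move=> xI; apply/eqP; apply: contraNT h => xz; apply/exists_inP; exists x.
by move: z12; rewrite (eqz _ z1I) (eqz _ z2I) eqxx.
Qed.

Lemma uphalf_bin (i X : nat) : (1 < i)%N -> (X <= 2 * i)%N -> (X <= i)%N || (2 < i)%N -> (uphalf X <= 'C(i, 2))%N.
Proof.
move=> h0 h1 h2; rewrite bin2 -leq_double.
have -> : ((i * i.-1)./2.*2 = i * i.-1)%N.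
  by rewrite -[RHS]odd_double_half oddM; case: (i) => //= i'; case: (odd i').
case: i h0 h1 h2 => [|[|[|i]]] // _ h1 h2; first by lia.
have : (2 * i.+3 <= i.+3 * i.+3.-1)%N by rewrite mulnC leq_mul2l.
by clear h2; lia.
Qed.

(** Provides the two present pairs [e1] and [e2] of [recover_step]. *)
Lemma many_pairs (n k m e : nat) : (10 < n)%N -> (2 * k + 5 <= n)%N -> (m + 4 = n.+1 + k)%N -> (e + m = 'C(n, 2))%N -> (1 < e)%N.
Proof.
move=> n10 hk hm; rewrite bin2 => he.
have h2 : ((n * n.-1)./2.*2 = n * n.-1)%N.
  by rewrite -[RHS]odd_double_half oddM; case: (n) n10 => //= n' _; case: (odd n').
have : (10 * n <= n * n.-1)%N by rewrite mulnC leq_mul2l; apply/orP; right; lia.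
rewrite -h2 -he => h3; clear h2 he; lia.
Qed.

(** Put [X = surplus - (n + 1 - 8)], the number of units to be recovered. Deleting an isolated vertex
    costs only [(k + 1) mu'], where [mu'] is the mean of the positive parts of the two largest costs, on
    [e1] and [e2]. If [mu'] is close to [mu], then the triangles over [e1] and [e2] have a large share or,
    by [hubs_recover], the hubs give back the difference. These effects add up because [X <= #|I|]. *)
Lemma recover_step n k A F c mu : (forall j, (j <= k.+1)%N -> deficit_bound R T j n) -> (10 < n)%N -> #|A| = n.+1 ->
  (missing A F + 4 = n.+1 + k)%N -> (7 < #|A :\: isolated A F|)%N ->
  (forall a, a \in A -> (3 * degree A F a <= n.+1 + k)%N) -> tame A F c mu ->
  excess A F c <= k%:R * mu.
Proof.
move=> HQ n10 cA mA w7 hd tc.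
have [hB|hB] := leqP (surplus k A F + 8) n.+1; first by apply: (@average_suffices n) tc => //; lia.
have [c' [le tc' bal _]] := balance tc; apply: le_trans le _.
move: c' tc' bal => {tc}c tc bal; have [mu0 _ _] := tc.
set I := isolated A F in w7 bal *; set W := A :\: I in w7 *; set H := hubs_of k A F.
have HW : H \subset W := hubs_sub k A F.
pose b a := (degree A F a - k.+1)%N.
have hb a : a \in H -> (b a + 8 <= n.+1)%N.
  move=> aH; have aA : a \in A by move: (subsetP HW _ aH); rewrite in_setD => /andP[].
  by have := hd a aA; rewrite /b; lia.
have eB : surplus k A F = (\sum_(a in H) b a)%N by [].
have [a aH] : exists a, a \in H.
  by apply/set0Pn; apply: contraTneq hB => h0; rewrite eB h0 big_set0 -leqNgt; lia.
have [a' a'H aa'] : exists2 a', a' \in H & a != a'.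
  have /set0Pn[a'] : H :\ a != set0.
    apply: contraTneq hB => h0; rewrite eB (big_setD1 a) //= h0 big_set0 -leqNgt.
    by have := hb a aH; lia.
  by rewrite in_setD1 => /andP[a'a a'H]; exists a'; rewrite // eq_sym.
have hp := surplus_pair aH a'H aa'; have hc := card_core A F; rewrite -/I -/W cA in hp hc.
(* Since [A] has [n.+1] vertices, the averaging identity leaves room for a surplus of [n.+1 - 8]. *)
pose X := (surplus k A F + 8 - n.+1)%N.
have XI : (X <= #|I|)%N by rewrite /X; lia.
have q1 v : v \in H -> (missing A F + b v + 4 <= n + degree A F v)%N.
  by rewrite inE => /andP[_ dv]; rewrite /b; clear - dv mA; lia.
have q2 : (2 * X <= \sum_(v in H) b v)%N.
  by rewrite -eB /X; clear - hp mA w7 hc; lia.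
have q3 v : v \in H -> (X + b v <= \sum_(v in H) b v)%N.
  by move=> vH; rewrite -eB /X; have := hb v vH; clear - hB; lia.
have /card_gt0P[z zI] : (0 < #|I|)%N by rewrite /X in XI; clear - XI hB; lia.
have [kap [kapE gamE]] := balanced_values bal zI; pose gam y := c [set z; y].
have zA : z \in A by move: zI; rewrite inE => /andP[].
have dz : degree A F z = 0%N by move: zI; rewrite inE => /andP[_ /eqP].
have cAz : #|A :\ z| = n by have := cardsD1 z A; rewrite zA cA; case.
have mAz : missing (A :\ z) F = missing A F by have := missingD1 A F z; rewrite dz addn0.
pose E := present (A :\ z) F.
have k2 : (2 * k + 5 <= n)%N.
  have aA : a \in A by move: (subsetP HW _ aH); rewrite in_setD => /andP[].
  by have := hd a aA; move: aH; rewrite inE => /andP[_]; lia.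
have E2 : (1 < #|E|)%N.
  by have := card_present (A :\ z) F; rewrite cAz mAz -/E; apply: (many_pairs n10 k2 mA).
have [e1 [e2 [e1E e2E e12 m1 m2]]] := top_two c E2.
have tmu := @tame_top E (A :\ z) F c e1 e2 (erefl _) e1E e2E m1 m2.
set mu' := 2^-1 * _ in tmu; have [mu'0 _ _] := tmu.
have EA p : p \in E -> p \in present A F by apply: (subsetP (presentS (subD1set _ _) (subxx _))).
have mu'mu : mu' <= mu.
  have [_ h1 h2] := tc; have := h1 _ (EA _ e1E); have := h1 _ (EA _ e2E); have := h2 _ _ (EA _ e1E) (EA _ e2E) e12.
  by rewrite /mu'; case: (leP 0 (c e1)); case: (leP 0 (c e2)); lra.
have iso : \sum_(v in I) excess (A :\ v) F c <= #|I|%:R * (k.+1%:R * mu').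
  rewrite mulr_natl -sumr_const; apply: ler_sum => v vI; rewrite (isolated_excess bal vI zI).
  apply: (HQ k.+1 (leqnn _) (A :\ z) F c mu' cAz _ tmu).
  by rewrite mAz; clear - mA; lia.
pose s1 := share A F c z e1; pose s2 := share A F c z e2.
have s10 : 0 <= s1 := share_ge0 A F c z e1.
have s20 : 0 <= s2 := share_ge0 A F c z e2.
have tri : #|I|%:R * (s1 + s2) <= \sum_(t in triangles A F) Num.max 0 (cost c t).
  rewrite -(sum_set2 (share A F c z) e12).
  by apply: (share_sum bal zI); rewrite subUset !sub1set e1E e2E.
have q4 v : v \in H -> (minn (b v) X <= #|isolated A F|)%N.
  by move=> vH; apply: leq_trans XI; exact: geq_minr.
have q5 : (1 < #|isolated A F|)%N -> (uphalf X <= 'C(#|isolated A F|, 2))%N.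
  by move=> i1; apply: uphalf_bin => //; [apply: leq_trans XI _; rewrite leq_pmull|rewrite XI].
have aW := subsetP HW _ aH.
have rec e : e \in E -> \sum_(v in H) excess (A :\ v) F c <= X%:R * (share A F c z e - Num.max 0 (c e)).
  exact: (@hubs_recover R T A F c kap gam z zI kapE gamE n mu H b X a e (HQ 0%N isT) cA tc HW aW q1 q2 q3 q4 q5).
have X0 : 0 <= X%:R :> R by rewrite ler0n.
(* The mean of [rec e1] and [rec e2]. *)
have hubs : \sum_(v in H) excess (A :\ v) F c <= X%:R / 2 * (s1 + s2) - X%:R * mu'.
  by have := rec e1 e1E; have := rec e2 e2E; rewrite -/s1 -/s2 /mu'; lra.
have n2 : (2 < n)%N by apply: ltn_trans n10.
apply: (@average_step n k A F c mu ((#|I| * k.+1 - X)%N%:R * mu) (fun j hj => HQ j (leqW hj)) n2 cA mA tc).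
  have XR : X%:R <= #|I|%:R :> R by rewrite ler_nat.
  have XIk : (X <= #|I| * k.+1)%N by apply: leq_trans XI _; exact: leq_pmulr.
  have -> : (#|I| * k.+1 - X)%N%:R = #|I|%:R * k.+1%:R - X%:R :> R by rewrite natrB ?natrM.
  have g1 : 0 <= (#|I|%:R * k.+1%:R - X%:R) * (mu - mu').
    by apply: mulr_ge0; [rewrite -natrM subr_ge0 ler_nat|rewrite subr_ge0].
  have g2 : 0 <= (#|I|%:R - X%:R) * (s1 + s2).
    by apply: mulr_ge0; [rewrite subr_ge0|exact: addr_ge0].
  rewrite -/I -/H; clear - iso hubs tri g1 g2.
  lra.
rewrite -mulrDl; apply: ler_wpM2r => //.
rewrite -natrD; have -> : n.+1%:R - 2 = (n.+1 - 2)%:R :> R by rewrite natrB // ltnW // ltnS; apply: ltn_trans n2.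
rewrite -natrM ler_nat.
have := slack_surplus k A F; rewrite -/I -/W.
have XIk : (X <= #|I| * k.+1)%N by apply: leq_trans XI _; exact: leq_pmulr.
move: XIk; rewrite /X; clear - hB hc mA n2.
set B := surplus k A F in hB *; set sl := slack k A F; set w := #|W| in hc *; set i := #|I| in hc *.
move: (missing A F) mA => m mA; nia.
Qed.

End Step.

(** * The induction step for deficit four *)

Section Counts.
Variables (T : finType).
Implicit Types (A B N W H : {set T}) (F S C : {set {set T}}).

(** Double counting of incidences between [H] and the missing pairs. *)
Lemma sum_degree_cap A F H : H \subset A ->
  \sum_(v in H) degree A F v = \sum_(p in F :&: pairs A) #|p :&: H|.
Proof.
move=> sH; transitivity (\sum_(v in H) \sum_(p in F :&: pairs A) (v \in p)).
  apply: eq_bigr => v _; rewrite /degree -sum1_card big_mkcond /= [RHS]big_mkcond /=.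
  by apply: eq_bigr => p _; rewrite [in LHS]in_set; case: (p \in F :&: pairs A) => //=; case: (v \in p).
rewrite exchange_big /=; apply: eq_bigr => p _.
by rewrite setIC -sum1_card big_mkcond /= [RHS]big_mkcond /=; apply: eq_bigr => v _; rewrite in_setI; case: (v \in H); case: (v \in p).
Qed.

(** A missing pair is counted on the left once per end in [H], and once if it avoids [H]; that is once
    more than on the right only for pairs inside [H]. *)
Lemma degree_subset A F H : H \subset A ->
  (\sum_(v in H) degree A F v + missing (A :\: H) F = missing A F + missing H F)%N.
Proof.
move=> sH; rewrite sum_degree_cap //.
have count (B : {set T}) : B \subset A -> missing B F = (\sum_(p in F :&: pairs A) (p \subset B))%N.
  move=> sB; rewrite /missing -sum1_card big_mkcond /= [RHS]big_mkcond /=; apply: eq_bigr => p _.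
  rewrite !inE; case: (p \in F) => //=; case cp: (#|p| == 2); rewrite ?andbF ?andbT //.
  by case sp: (p \subset B); [rewrite (subset_trans sp sB)|case: ifP].
rewrite (count (A :\: H)) ?subsetDl // (count H) // -big_split /= /missing -sum1_card -big_split /=.
apply: eq_bigr => p; rewrite in_setI => /andP[_ pA].
case/pairsP: pA => u [v [uA vA uv ->]].
have -> : #|[set u; v] :&: H| = ((u \in H) + (v \in H))%N.
  rewrite -sum1_card big_mkcond /= (bigD1 u) //= (bigD1 v) 1?eq_sym //= big1 => [|x /andP[xu xv]].
    by rewrite !inE !eqxx orbT; case: (u \in H); case: (v \in H).
  by rewrite !inE (negPf xu) (negPf xv).
by rewrite !subUset !sub1set !in_setD uA vA; case: (u \in H); case: (v \in H).
Qed.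

Lemma missing_bin A F : (missing A F <= 'C(#|A|, 2))%N.
Proof. by rewrite -card_pairs subset_leq_card // subsetIr. Qed.

(** Every core vertex has degree at least 1. *)
Lemma surplus_core k A F :
  (surplus k A F + k * #|hubs_of k A F| + #|A :\: isolated A F| <= 2 * missing A F)%N.
Proof.
have -> : #|A :\: isolated A F| = (\sum_(i in A :\: isolated A F) 1)%N by rewrite sum1_card.
rewrite -degree_sum /surplus.
rewrite !(big_setID (hubs_of k A F) (A := A :\: isolated A F)) /= (setIidPr (hubs_sub k A F)).
have h1 : (\sum_(i in hubs_of k A F) (degree A F i - k.+1) + k * #|hubs_of k A F| + \sum_(i in hubs_of k A F) 1 =
   \sum_(i in hubs_of k A F) degree A F i)%N.
  rewrite mulnC -sum_nat_const -!big_split /=; apply: eq_bigr => i; rewrite inE => /andP[_ di]; lia.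
have h2 : (\sum_(i in (A :\: isolated A F) :\: hubs_of k A F) 1 <=
  \sum_(i in (A :\: isolated A F) :\: hubs_of k A F) degree A F i)%N.
  by apply: leq_sum => i; rewrite in_setD => /andP[_ iW]; exact: degree_core_gt0.
lia.
Qed.

Lemma hubs_subA k A F : hubs_of k A F \subset A.
Proof. exact: subset_trans (hubs_sub _ _ _) (subsetDl _ _). Qed.

(** Pairs between hubs are counted twice in the degree sum of the hubs. *)
Lemma surplus_bin k A F :
  (surplus k A F + k.+1 * #|hubs_of k A F| <= missing A F + 'C(#|hubs_of k A F|, 2))%N.
Proof.
have e : (surplus k A F + k.+1 * #|hubs_of k A F| = \sum_(i in hubs_of k A F) degree A F i)%N.
  rewrite mulnC -sum_nat_const -!big_split /=; apply: eq_bigr => i; rewrite inE => /andP[_ di]; lia.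
rewrite e; have := degree_subset F (hubs_subA k A F); have := missing_bin (hubs_of k A F) F; lia.
Qed.

(** With deficit four a hub can give up at most [i] spokes of one kind, so its surplus [b] counts only as
    [minn (b v) i], and the recovery needs these inequalities. If nothing is truncated they follow from
    the two bounds on the total surplus [B], the first for at least eight hubs and the second for three to
    seven; a truncated surplus forces [w >= 2 i + 14], which leaves much room. *)
Lemma capped_counts (H : {set T}) (b : T -> nat) (i w B : nat) :
  (forall v, v \in H -> 3 * b v + 11 <= w + i)%N -> (forall v, v \in H -> 0 < b v)%N ->
  B = (\sum_(v in H) b v)%N ->
  (B + 4 * #|H| <= w + 2 * i)%N -> (B + 5 * #|H| <= w + i + 'C(#|H|, 2))%N ->
  (7 < w)%N -> (i + 3 <= w)%N -> (12 <= w + i)%N -> (w <= 22)%N || (2 * i < w)%N ->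
  (#|H| = 3 -> B + 13 <= w + i)%N -> (w < B + 8)%N ->
  [/\ 3 <= i, B + 8 <= w + 2 * i, 2 * (B + 8 - w) <= \sum_(v in H) minn (b v) i
   & forall u, u \in H -> (B + 8 - w) + minn (b u) i <= \sum_(v in H) minn (b v) i]%N.
Proof.
move=> hb b0 eB b1 b2 w7 iw N12 wi sp pos.
pose L := (\sum_(v in H) (b v - i))%N; pose S := (\sum_(v in H) minn (b v) i)%N.
pose t := #|[set v in H | (i < b v)%N]|.
have eL : L = (\sum_(v in [set v in H | (i < b v)%N]) (b v - i))%N.
  rewrite /L (bigID (fun v => (i < b v)%N)) /= [X in (_ + X)%N]big1 ?addn0.
    by apply: eq_bigl => v; rewrite inE.
  by move=> v /andP[_]; rewrite -leqNgt -subn_eq0 => /eqP.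
have BSL : (B = S + L)%N by rewrite eB /S /L -big_split /=; apply: eq_bigr => v _; lia.
have tj : (t <= #|H|)%N by apply: subset_leq_card; apply/subsetP => v; rewrite inE => /andP[].
have hL : (3 * L + t * (2 * i + 11) <= t * w)%N.
  rewrite eL /t big_distrr /= -!sum_nat_const -big_split /=; apply: leq_sum => v.
  by rewrite inE => /andP[vH iv]; have := hb v vH; lia.
have hB : (t * i + L <= B)%N.
  rewrite eL /t -sum_nat_const -big_split /= eB.
  rewrite [leqRHS](bigID (fun v => (i < b v)%N)) /=; apply: leq_trans (leq_addr _ _).
  rewrite [leqRHS](eq_bigl (mem [set v in H | (i < b v)%N])) => [|v]; last by rewrite /= inE.
  by apply: leq_sum => v; rewrite inE => /andP[_]; lia.
have f5 : (3 * B + 11 * #|H| <= #|H| * (w + i))%N.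
  rewrite eB big_distrr /= mulnC -!sum_nat_const -big_split /=; apply: leq_sum => v vH.
  exact: hb.
have f6 : (0 < #|H| -> 14 <= w + i)%N.
  by move=> /card_gt0P[v vH]; have := b0 v vH; have := hb v vH; lia.
rewrite -/S; have hS : (S + L = B)%N by rewrite BSL.
suff [i3 c1 c2 c3] : [/\ 3 <= i, B + 8 <= w + 2 * i, B + L + 16 <= 2 * w
   & forall u, u \in H -> L + minn (b u) i + 8 <= w]%N.
  split=> //; first lia.
  by move=> u uH; have := c3 u uH; lia.
have i3 : (3 <= i)%N.
  move: (#|H|) f5 b1 b2 => j f5 b1 b2; clear - f5 b1 b2 pos iw w7.
  by do 8 (case: j f5 b1 b2 => [|j] f5 b1 b2; first by rewrite ?bin0n /binomial /= in b2; lia); lia.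
split=> //.
- move: (#|H|) f5 b1 b2 => j f5 b1 b2; clear - f5 b1 b2 pos iw w7.
  by do 2 (case: j f5 b1 b2 => [|j] f5 b1 b2; first by lia); lia.
- have [t0|t0] := posnP t.
    have L0 : L = 0%N by move: hL; rewrite t0; lia.
    move: (#|H|) f5 f6 b1 b2 sp => j f5 f6 b1 b2 sp; clear - f5 f6 b1 b2 sp pos iw w7 L0 wi.
    by do 8 (case: j f5 f6 b1 b2 sp => [|j] f5 f6 b1 b2 sp; first by rewrite ?bin0n /binomial /= in b2; lia); lia.
  have [t4|t4] := leqP 4 t.
    have : (4 * i <= t * i)%N by rewrite leq_mul2r t4 orbT.
    by clear - hB b1 t4 tj; lia.
  have L3 : (L + 2 * i + 11 <= w)%N.
    by move: (t) t0 t4 hL => [|[|[|[|t']]]] //; clear; lia.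
  have [j2|j1] := leqP 2 #|H|; first by clear - b1 L3 j2; lia.
  have ej : #|H| = 1%N by clear - j1 tj t0; lia.
  have et : t = 1%N by clear - j1 tj t0; lia.
  rewrite ej in f5; rewrite et in hL; clear - f5 hL iw w7 i3.
  lia.
move=> u uH; have := hb u uH; have := geq_minl (b u) i; have := geq_minr (b u) i.
move: (minn _ _) => mu m1 m2 hu.
have [t0|t0] := posnP t.
  have L0 : L = 0%N by move: hL; rewrite t0; lia.
  by clear - L0 m2 hu iw w7; lia.
move: (t) t0 hL hB tj => [|[|[|t']]] // _ hL hB tj; first by clear - hL m1 i3; lia.
  by clear - hL m1 i3; lia.
have : (3 * i <= t'.+3 * i)%N by rewrite leq_mul2r orbT.
by clear - hB b1 tj m1; lia.
Qed.
End Counts.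

Section StepFour.
Local Open Scope ring_scope.
Variables (R : realFieldType) (T : finType).
Implicit Types (A B N W H : {set T}) (F S C : {set {set T}}) (p q t e : {set T}) (c : {set T} -> R).

(** The missing pair [xy] is declared present at cost [s], where [- s] is the second largest cost of a
    path from [x] to [y] (or [s = M] if that is below [- M]); then at most one of the triangles over it
    has positive cost. *)
Lemma excess_forget A F c M n x y : deficit_bound R T 4 n -> #|A| = n -> (missing A F <= n.+1)%N ->
  [set x; y] \in F -> [set x; y] \in pairs A -> capped A F c M -> (1 < #|common A F [set x; y]|)%N ->
  exists w1 w2, [/\ w1 \in common A F [set x; y], w2 \in common A F [set x; y], w1 != w2 &
    excess A F c <= 4 * M + 2^-1 * (Num.max 0 (c [set w1; x] + c [set w1; y])
      + Num.max 0 (c [set w2; x] + c [set w2; y]))].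
Proof.
move=> Q4 cA mA fF fA [M0 hM] C2; set f := [set x; y] in fF fA C2 *.
pose h w := c [set w; x] + c [set w; y].
have [w1 [w2 [w1C w2C w12 m1 m2]]] := top_two h C2.
exists w1, w2; split=> //; rewrite -/(h w1) -/(h w2).
have xy : x != y by move: fA; rewrite mem_pairs2 => /and3P[].
have mf := missing_setD1 fF fA.
have fE : f \in present A (F :\ f) by rewrite present_setD1 // setU11.
have eC : common A (F :\ f) f = common A F f.
  apply/setP => w; rewrite !inE; case: (w \in A) => //=.
  have [wf|//] := boolP (~~ _).
  apply: eq_forallb_in => u uf; rewrite in_setD1.
  by have -> : [set w; u] != f by apply: contraNneq wf => e; have := set21 w u; rewrite e in_set2.
have sumE s : \sum_(t in triangles A (F :\ f) | f \subset t) Num.max 0 (cost (reset c f s) t) =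
    \sum_(w in common A F f) Num.max 0 (s + h w).
  rewrite sum_triangles_over // eC; apply: eq_bigr => w; rewrite inE => /and3P[wA wf _].
  rewrite cost_add ?(card_pair fA) // sum_set2 // /reset eqxx.
  have nf u : ([set w; u] == f) = false by apply/negbTE; apply: contraNneq wf => <-; exact: set21.
  by rewrite !nf.
have bound s : s <= M -> excess A F c <= 4 * M - s + 2^-1 * \sum_(w in common A F f) Num.max 0 (s + h w).
  move=> sM; rewrite (excess_restore c s fF fA) sumE.
  suff : excess A (F :\ f) (reset c f s) <= 4 * M by lra.
  have mQ : (missing A (F :\ f) + 4 <= n + 4)%N by rewrite leq_add2r -ltnS mf.
  apply: (Q4 A (F :\ f) (reset c f s) M cA mQ).
  apply: capped_tame; split=> // p; rewrite present_setD1 // in_setU1 /reset.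
  by case: eqP => [_ _|_ /= /hM].
have one s : s + h w2 <= 0 -> \sum_(w in common A F f) Num.max 0 (s + h w) = Num.max 0 (s + h w1).
  move=> s2; rewrite (bigD1 w1) //= big1 ?addr0 // => w /andP[wC ww]; apply/max_idPl.
  by have := m2 w wC ww; lra.
have a1 := max0_ge (h w1); have a2 := max0_ge (h w2).
have b1 := max0_ge0 (h w1); have b2 := max0_ge0 (h w2).
have [hs|hs] := leP (- M) (h w2).
  have := bound (- h w2); rewrite one; last by lra.
  have h12 := m1 _ w2C; rewrite (max_idPr _); last by lra.
  have hM' : - h w2 <= M by lra.
  by move=> /(_ hM'); lra.
have := bound M (lexx _); rewrite one; last by lra.
case: (leP 0 (M + h w1)) => h3; lra.
Qed.

(** As in [recover_step], but deleting an isolated vertex is handled by [excess_forget], which costs [4 M]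
    and half of the two dearest paths between the ends of a missing pair. The four pairs on these two
    paths play the part of [e1] and [e2]. *)
Lemma recover_step_four n A F c M : (forall j, (j <= 4)%N -> deficit_bound R T j n) -> (10 < n)%N -> #|A| = n.+1 ->
  missing A F = n.+1 -> (7 < #|A :\: isolated A F|)%N -> (#|isolated A F| + 3 <= #|A :\: isolated A F|)%N ->
  (#|A :\: isolated A F| <= 22)%N || (2 * #|isolated A F| < #|A :\: isolated A F|)%N ->
  (forall a, a \in A -> (3 * degree A F a <= n + 5)%N) ->
  (#|hubs_of 4 A F| = 3 -> surplus 4 A F + 13 <= n.+1)%N -> capped A F c M ->
  excess A F c <= 4 * M.
Proof.
move=> HQ n10 cA mA w7 iw wi hd sp capc.
have [c' [le _ bal capb]] := balance (capped_tame capc); apply: le_trans le _.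
have {}capc := capb M capc; move: c' capc bal {capb} => {}c capc bal; have [M0 hM] := capc.
have tc := capped_tame capc.
set I := isolated A F in w7 iw wi bal *; set W := A :\: I in w7 iw wi *; set H := hubs_of 4 A F in sp.
have hc := card_core A F; rewrite -/I -/W cA in hc.
have b1 := surplus_core 4 A F; have b2 := surplus_bin 4 A F; rewrite mA -/I -/W -/H in b1 b2.
have mA4 : (missing A F + 4 = n.+1 + 4)%N by rewrite mA.
have n2 : (2 < n)%N by apply: ltn_trans n10.
have Q4 := HQ 4 (leqnn _).
have zA z : z \in I -> z \in A by rewrite inE => /andP[].
have mAz z : z \in I -> missing (A :\ z) F = n.+1.
  by rewrite inE => /andP[_ /eqP dz]; rewrite -mA -(missingD1 A F z) dz addn0.
have cAz z : z \in I -> #|A :\ z| = n by move=> zI; have := cardsD1 z A; rewrite zA // cA; case.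
have capz z : capped (A :\ z) F c M by apply: cappedS capc; apply: presentS => //; exact: subD1set.
have pick z : z \in I -> exists x y, [/\ [set x; y] \in F, [set x; y] \in pairs (A :\ z), x \in W & y \in W].
  move=> zI; have /card_gt0P[f] : (0 < #|F :&: pairs (A :\ z)|)%N by have := mAz z zI; rewrite /missing => ->.
  rewrite in_setI => /andP[fF /[dup] fA /pairsP[x [y [xA yA xy ef]]]]; exists x, y; rewrite -ef; split=> //.
    move: xA; rewrite !in_setD1 in_setD => /andP[xz ->]; rewrite andbT.
    apply: contraL fF => xI; rewrite ef; apply: (isolatedP xI) => //; last by rewrite eq_sym.
    by move: yA; rewrite in_setD1 => /andP[].
  move: yA; rewrite !in_setD1 in_setD => /andP[yz ->]; rewrite andbT.
  apply: contraL fF => yI; rewrite ef setUC; apply: (isolatedP yI) => //.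
  by move: xA; rewrite in_setD1 => /andP[].
have sl := slack_surplus 4 A F; rewrite mA -/I -/W in sl.
have Q40 a := @hub_drop R T n 4 A F c M a (HQ 0%N isT) cA mA4 tc.
have eN : n.+1%:R - 2 = (n.+1 - 2)%:R :> R by rewrite natrB // ltnW // ltnS; apply: ltn_trans n2.
(* Nothing is to be recovered if restoring one pair, at cost [2 M], is affordable at every isolated
   vertex. *)
have [hX|hX] := leqP (surplus 4 A F + 8) #|W|.
  apply: (@average_step R T n 4 A F c M ((6 * #|I|)%N%:R * M) HQ n2 cA mA4 tc); last first.
    rewrite -mulrDl; apply: ler_wpM2r => //; rewrite eN -natrD -natrM ler_nat.
    by clear - sl hX hc; lia.
  have h1 : \sum_(a in I) excess (A :\ a) F c <= (6 * #|I|)%N%:R * M.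
    rewrite mulnC natrM -mulrA mulr_natl -sumr_const; apply: ler_sum => z zI.
    have [x [y [fF fA _ _]]] := pick z zI.
    have -> : 6%:R * M = 4 * M + 2 * M by lra.
    apply: (excess_restore2 fF fA (capped_tame (capz z))) => c' tc'.
    apply: Q4 (cAz z zI) _ tc'.
    by rewrite leq_add2r -ltnS (missing_setD1 fF fA) mAz.
  have h2 : \sum_(a in H) excess (A :\ a) F c <= 0 by apply: sumr_le0 => a; exact: Q40.
  have h3 : 0 <= \sum_(t in triangles A F) Num.max 0 (cost c t).
    by apply: sumr_ge0 => t _; exact: max0_ge0.
  by rewrite -/I -/H; clear - h1 h2 h3; lra.
set B := surplus 4 A F in sp b1 b2 sl hX; set i := #|I| in hc iw wi *; set w := #|W| in w7 iw wi hX b1 b2 hc sl.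
have wi1 : (w + i = n.+1)%N by clear - hc; lia.
pose b v := minn (degree A F v - 5) i.
have [i3 c1 c2 c3] : [/\ 3 <= i, B + 8 <= w + 2 * i, 2 * (B + 8 - w) <= \sum_(v in H) b v
   & forall u, u \in H -> (B + 8 - w) + b u <= \sum_(v in H) b v]%N.
  apply: (@capped_counts T H (fun v => degree A F v - 5)%N i w B) => //.
  - move=> v vH; have vA : v \in A by apply: (subsetP (hubs_subA 4 A F)).
    by move: vH; rewrite inE => /andP[_ dv]; have := hd v vA; clear - dv wi1; lia.
  - by move=> v; rewrite inE => /andP[_ dv]; rewrite subn_gt0.
  - by clear - b1 wi1; lia.
  - by clear - b2 wi1; lia.
  - by clear - n10 wi1; lia.
  - by move=> /sp; clear - wi1; lia.
pose X := (B + 8 - w)%N; rewrite -/X in c2 c3.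
have [z zI] : exists z, z \in I by apply/card_gt0P; apply: leq_trans i3.
have [kap [kapE gamE]] := balanced_values bal zI; pose gam y := c [set z; y].
have [x [y [fF fA xW yW]]] := pick z zI.
have xy : x != y by move: fA; rewrite mem_pairs2 => /and3P[].
have isoC v : v \in I -> v != z -> v \in common (A :\ z) F [set x; y].
  move=> vI vz; have vW u : u \in W -> u != v.
    by rewrite in_setD => /andP[uI _]; apply: contraNneq uI => ->.
  rewrite inE in_setD1 vz zA // !inE negb_or ![v == _]eq_sym !vW //=.
  apply/forall_inP => u; rewrite in_set2 => uxy; have uW : u \in W by case/orP: uxy => /eqP ->.
  by apply: (isolatedP vI) (vW u uW); move: uW; rewrite in_setD => /andP[].
have C2 : (1 < #|common (A :\ z) F [set x; y]|)%N.
  apply: (@leq_trans #|I :\ z|); first by have := cardsD1 z I; rewrite zI; clear - i3; rewrite -/i; lia.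
  by apply: subset_leq_card; apply/subsetP => v; rewrite in_setD1 => /andP[vz vI]; exact: isoC.
have mz : (missing (A :\ z) F <= n.+1)%N by rewrite mAz.
have [w1 [w2 [w1C w2C w12 hz]]] := excess_forget Q4 (cAz z zI) mz fF fA (capz z) C2.
have edge u v : u \in common (A :\ z) F [set x; y] -> v \in [set x; y] -> [set u; v] \in present (A :\ z) F.
  rewrite inE => /and3P[uA uf /forall_inP h] vf; rewrite in_setD h //= mem_pairs2 uA /=.
  rewrite (subsetP (pair_sub fA)) //=; by apply: contraNneq uf => ->.
have notC u v : u \in common (A :\ z) F [set x; y] -> v \in [set x; y] -> u != v.
  by rewrite inE => /and3P[_ uf _] vf; apply: contraNneq uf => ->.
have q1 v : v \in H -> (missing A F + b v + 4 <= n + degree A F v)%N.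
  by rewrite inE => /andP[_ dv]; rewrite mA /b; clear - dv; lia.
have q4 v : v \in H -> (minn (b v) X <= #|isolated A F|)%N.
  by move=> vH; apply: leq_trans (geq_minl _ _) _; exact: geq_minr.
have Xi : (X <= 2 * i)%N by rewrite /X; clear - c1; lia.
have q5 : (1 < #|isolated A F|)%N -> (uphalf X <= 'C(#|isolated A F|, 2))%N.
  by move=> i1; apply: uphalf_bin => //; rewrite -/I -/i i3 orbT.
have HW : H \subset W := hubs_sub 4 A F.
pose S := \sum_(v in H) excess (A :\ v) F c.
have rec e : e \in present (A :\ z) F -> S <= X%:R * (share A F c z e - Num.max 0 (c e)).
  exact: (@hubs_recover R T A F c kap gam z zI kapE gamE n M H b X x e (HQ 0%N isT) cA tc HW xW q1 c2 c3 q4 q5).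
(* The pairs on the two dearest paths from [x] to [y]. *)
pose E4 := [set [set w1; x]; [set w1; y]; [set w2; x]; [set w2; y]].
have x2 := set21 x y; have y2 := set22 x y.
have E4s : E4 \subset present (A :\ z) F by rewrite !subUset !sub1set !edge.
have tri := share_sum bal zI E4s; set st := \sum_(t in triangles A F) _ in tri *.
pose s e := share A F c z e.
have sumE (g : {set T} -> R) : \sum_(e in E4) g e = g [set w1; x] + g [set w1; y] + g [set w2; x] + g [set w2; y].
  have d1 : [set w1; x] != [set w1; y].
    by apply: contraNneq xy => /setP/(_ x); rewrite !inE eqxx orbT eq_sym (negPf (notC _ _ w1C x2)).
  have d2 : [set w2; x] != [set w2; y].
    by apply: contraNneq xy => /setP/(_ x); rewrite !inE eqxx orbT eq_sym (negPf (notC _ _ w2C x2)).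
  have d3 u v : u \in [set x; y] -> v \in [set x; y] -> [set w1; u] != [set w2; v].
    move=> u2 v2; apply: contraNneq w12 => /setP/(_ w1); rewrite !inE eqxx /=.
    by rewrite (negPf (notC _ _ w1C v2)) orbF => /esym.
  rewrite /E4 -!setUA big_setU1 ?inE; last by rewrite negb_or negb_or d1 !d3.
  rewrite big_setU1 ?inE; last by rewrite negb_or !d3.
  by rewrite /= (sum_set2 _ d2) !addrA.
rewrite (sumE s) -/i in tri.
have r1 := rec _ (edge _ _ w1C x2); have r2 := rec _ (edge _ _ w1C y2).
have r3 := rec _ (edge _ _ w2C x2); have r4 := rec _ (edge _ _ w2C y2).
rewrite -!/(s _) in r1 r2 r3 r4.
set p1 := Num.max 0 (c [set w1; x] + _) in hz; set p2 := Num.max 0 (c [set w2; x] + _) in hz.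
have maxD (u v : R) : Num.max 0 (u + v) <= Num.max 0 u + Num.max 0 v.
  have := max0_ge u; have := max0_ge v; have := max0_ge0 u; have := max0_ge0 v.
  by move=> ? ? ? ?; rewrite ge_max; apply/andP; split; lra.
have l1 : p1 <= Num.max 0 (c [set w1; x]) + Num.max 0 (c [set w1; y]) := maxD _ _.
have l2 : p2 <= Num.max 0 (c [set w2; x]) + Num.max 0 (c [set w2; y]) := maxD _ _.
have capE e : e \in present (A :\ z) F -> Num.max 0 (c e) <= M.
  by move=> eE; rewrite ge_max M0; apply: (capz z).2.
have u1 := capE _ (edge _ _ w1C x2); have u2 := capE _ (edge _ _ w1C y2).
have u3 := capE _ (edge _ _ w2C x2); have u4 := capE _ (edge _ _ w2C y2).
have ss e : 0 <= s e := share_ge0 A F c z e.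
have v1 := ss [set w1; x]; have v2 := ss [set w1; y]; have v3 := ss [set w2; x]; have v4 := ss [set w2; y].
have X0 : 0 <= X%:R :> R by rewrite ler0n.
have Xi' : X%:R <= 2 * i%:R :> R by rewrite -natrM ler_nat.
(* The mean of [rec] over the four pairs. *)
have hS : S <= X%:R / 4 * (s [set w1; x] + s [set w1; y] + s [set w2; x] + s [set w2; y]) - X%:R / 4 * (p1 + p2).
  have : X%:R * (p1 + p2) <= X%:R * (Num.max 0 (c [set w1; x]) + Num.max 0 (c [set w1; y]) + (Num.max 0 (c [set w2; x]) + Num.max 0 (c [set w2; y]))).
    by apply: ler_wpM2l => //; exact: lerD.
  by clear - r1 r2 r3 r4; lra.
have iso : \sum_(v in I) excess (A :\ v) F c <= i%:R * (4 * M + 2^-1 * (p1 + p2)).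
  rewrite mulr_natl -sumr_const; apply: ler_sum => v vI.
  by rewrite (isolated_excess bal vI zI).
apply: (@average_step R T n 4 A F c M ((6 * i - X)%N%:R * M) HQ n2 cA mA4 tc); last first.
  rewrite -mulrDl; apply: ler_wpM2r => //; rewrite eN -natrD -natrM ler_nat.
  by move: Xi; rewrite /X; clear - sl hX hc; lia.
have -> : (6 * i - X)%N%:R = 6 * i%:R - X%:R :> R.
  by rewrite natrB ?natrM //; apply: leq_trans Xi _; rewrite leq_mul2r orbT.
rewrite -/I -/H -/S -/st.
set s4 := s _ + s _ + s _ + s _ in tri hS.
have s40 : 0 <= s4 by rewrite !addr_ge0.
have g1 : 0 <= (2 * i%:R - X%:R) * s4 by apply: mulr_ge0; lra.
have g2 : 0 <= (2 * i%:R - X%:R) * (4 * M - (p1 + p2)) by apply: mulr_ge0; lra.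
by clear - g1 g2 iso hS tri; lra.
Qed.

End StepFour.

(** * Assembling the induction step *)

Section Induction.
Local Open Scope ring_scope.
Variables (R : realFieldType) (T : finType).
Implicit Types (A B N W H : {set T}) (F S C : {set {set T}}) (p q t e : {set T}) (c : {set T} -> R).

(** The neighbourhood of [x] has a full 2-factor, hence no defect is to be paid and the deficit [k] is
    passed on to [A :\ x]. *)
Lemma clique_hub k n A F c x mu : deficit_bound R T k n -> x \in A -> #|A| = n.+1 ->
  (missing A F + 4 <= n.+1 + k)%N -> (2 < #|neighbours A F x|)%N ->
  (missing (neighbours A F x) F + 3 <= #|neighbours A F x|)%N -> (n + 2 <= 3 * degree A F x)%N ->
  tame A F c mu -> excess A F c <= k%:R * mu.
Proof.
move=> HQ xA cA mA N2 mN dx tc; set N := neighbours A F x in N2 mN *.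
have cN : (#|N| + degree A F x = n)%N by have := degree_neighbours F xA; rewrite cA -/N; lia.
have [C sC C2] := two_factor N2 mN.
have sCp := subset_trans sC (present_pairs N F).
have cC := two_regular_card sCp C2.
have := @excess_hub R T A F x C c (k%:R * mu) xA sC; rewrite -/N big1 ?addr0; last first.
  by move=> u uN; rewrite C2 // divff ?subrr ?mul0r // pnatr_eq0.
apply=> F' sF mF'; apply: HQ.
- by have := cardsD1 x A; rewrite xA cA; case.
- by have := missingD1 A F x; rewrite cC in mF'; lia.
by apply: tameS tc; apply: presentS => //; exact: subD1set.
Qed.

(** The counts leave open exactly the case of three mutually missing hubs which meet every missing pair.
    Then the neighbourhood of a hub is complete, and one of the hubs has degree at least a third of [n +
    4]. *)
Lemma three_hubs n A F c mu : deficit_bound R T 4 n -> (10 < n)%N -> #|A| = n.+1 -> missing A F = n.+1 ->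
  #|hubs_of 4 A F| = 3 -> (n.+1 < surplus 4 A F + 13)%N -> (forall a, a \in A -> (3 * degree A F a <= n + 5)%N) ->
  tame A F c mu -> excess A F c <= 4 * mu.
Proof.
move=> Q4 n10 cA mA cH hB hd tc; set H := hubs_of 4 A F in cH.
have sH : H \subset A := hubs_subA 4 A F.
have b2 := surplus_bin 4 A F; rewrite -/H cH mA /= in b2.
have eB : (surplus 4 A F + 15 = \sum_(i in H) degree A F i)%N.
  have -> : 15%N = (\sum_(i in H) 5)%N by rewrite sum_nat_const cH.
  rewrite /surplus -/H -big_split /=; apply: eq_bigr => i; rewrite inE => /andP[_ di]; lia.
have := degree_subset F sH; have := missing_bin H F; rewrite cH mA -eB => m3 mH.
have b3 : 'C(3, 2) = 3%N by [].
rewrite b3 in b2 m3.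
have m0 : missing (A :\: H) F = 0%N by lia.
have eH : missing H F = 3%N by lia.
have HF p : p \in pairs H -> p \in F.
  have /eqP e : F :&: pairs H == pairs H.
    by rewrite eqEcard subsetIr card_pairs cH b3 -eH leqnn.
  by rewrite -e in_setI => /andP[].
have [x xH dx] : exists2 x, x \in H & (n + 4 <= 3 * degree A F x)%N.
  apply/exists_inP; apply/negbNE/negP; rewrite negb_exists_in => /forall_inP h.
  have : (3 * \sum_(i in H) degree A F i <= \sum_(i in H) (n + 3))%N.
    by rewrite big_distrr /=; apply: leq_sum => i /h; lia.
  by rewrite sum_nat_const cH -eB; lia.
have xA := subsetP sH _ xH; have dx' := hd x xA.
have cN : (#|neighbours A F x| + degree A F x = n)%N by have := degree_neighbours F xA; rewrite cA; lia.
have mN : missing (neighbours A F x) F = 0%N.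
  apply/eqP; rewrite -leqn0 -m0; apply: subset_leq_card; apply: setIS; apply: pairsS.
  apply/subsetP => u; rewrite in_setD inE => /and3P[-> ux xu]; rewrite andbT.
  by apply: contra xu => uH; apply: HF; rewrite mem_pairs2 xH uH eq_sym.
apply: (@clique_hub 4 n A F c x mu) => //; rewrite ?mN ?mA; lia.
Qed.

(** The inequality needed by [spread_few], for few missing pairs and a core of at most [i + 2] vertices.
    *)
Lemma quadratic w i m : (m <= w + i)%N -> (w <= i + 2)%N -> (12 <= w + i)%N ->
  (i * (w + 1) + 2 * m + w <= w * w + i * i)%N.
Proof.
move=> hm hw hN.
have [w7|w7] := leqP w 7.
  have [j ei] : exists j, i = (12 - w + j)%N by exists (w + i - 12)%N; lia.
  subst i; clear hN hw; move: hm; case: w w7 => [|[|[|[|[|[|[|[|//]]]]]]]] _;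
  by rewrite ?subSS ?subn0; move: j => j hm; nia.
have [j ej] : exists j, (i + 2 = w + j)%N by exists (i + 2 - w)%N; lia.
have [v ev] : exists v, w = (v + 8)%N by exists (w - 8)%N; lia.
have ei : i = (v + 6 + j)%N by lia.
by subst w i; clear ej w7 hw hN; nia.
Qed.

(** At least twelve vertices, of which the core takes at most two more than half, satisfy [spread_few]. *)
Lemma few_core A F c : (11 < #|A|)%N -> (missing A F <= #|A|)%N ->
  (#|A :\: isolated A F| <= #|isolated A F| + 2)%N -> excess A F c <= 0.
Proof.
move=> A12 mA wi; have hc := card_core A F; apply: spread_few => //; first by lia.
by apply: quadratic => //; lia.
Qed.

(** The cases in turn: a small core, a hub of large degree, recovery; for [k = 4] also a large isolated
    part and the three exceptional hubs. *)
Lemma exact_step n k A F c mu : (10 < n)%N -> (forall j, (j <= 4)%N -> deficit_bound R T j n) -> (k <= 4)%N ->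
  #|A| = n.+1 -> (missing A F + 4 = n.+1 + k)%N -> tame A F c mu -> excess A F c <= k%:R * mu.
Proof.
move=> n10 HQ k4 cA mA tc; have [mu0 _ _] := tc.
have hc := card_core A F; rewrite cA in hc.
have kmu : 0 <= k%:R * mu by apply: mulr_ge0.
have few c' : (#|A :\: isolated A F| <= #|isolated A F| + 2)%N -> excess A F c' <= 0.
  by apply: few_core; rewrite cA; lia.
have [w7|w7] := leqP #|A :\: isolated A F| 7.
  by apply: le_trans (few c _) kmu; lia.
have [/exists_inP[a aA da]|] := boolP [exists a in A, n + 2 + k <= 3 * degree A F a]%N.
  by apply: (@hub R T k n A F c a mu (HQ 0%N isT)) => //; rewrite ?mA //; lia.
rewrite negb_exists_in => /forall_inP hd'.
have hd a : a \in A -> (3 * degree A F a <= n.+1 + k)%N by move=> /hd'; rewrite -ltnNge; lia.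
move: k4; rewrite leq_eqVlt => /orP[/eqP k4|k3]; last first.
  by apply: (@recover_step R T n k A F c mu) => // j jk; apply: HQ; apply: leq_trans jk k3.
subst k; have {}mA : missing A F = n.+1 by lia.
have {}hd a : a \in A -> (3 * degree A F a <= n + 5)%N by move=> /hd; rewrite addSnnS.
have [wi|wi] := leqP #|A :\: isolated A F| (#|isolated A F| + 2)%N; first exact: le_trans (few c wi) kmu.
have [/andP[w23 w2i]|] := boolP ((22 < #|A :\: isolated A F|) && (#|A :\: isolated A F| <= 2 * #|isolated A F|))%N.
  by apply: le_trans (@spread_many R T A F c _ _ _ _) kmu => //; rewrite ?mA ?cA //; lia.
rewrite negb_and -leqNgt -ltnNge => hwi.
have [/andP[/eqP cH hB]|hH] := boolP ((#|hubs_of 4 A F| == 3) && (n.+1 < surplus 4 A F + 13))%N.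
  by apply: (@three_hubs n A F c mu) => //; exact: (HQ 4).
apply: bound_of_capped tc => // c' M capc.
apply: (@recover_step_four R T n A F c' M) => //; first by lia.
by move=> e; move: hH; rewrite e eqxx /= -leqNgt.
Qed.

(** With fewer missing pairs than allowed, a smaller deficit applies; for deficit 0 the plain average
    does. *)
Lemma induction_step n : (10 < n)%N -> (forall k, (k <= 4)%N -> deficit_bound R T k n) ->
  forall k, (k <= 4)%N -> deficit_bound R T k n.+1.
Proof.
move=> n10 HQ; elim=> [|k IH] k4 A F c mu cA mA tc; have [mu0 _ _] := tc.
  move: mA; rewrite addn0 leq_eqVlt => /orP[/eqP mA|mA]; last first.
    have A2 : (2 < #|A|)%N by rewrite cA ltnS; apply: ltn_trans n10.
    have n1 : 0 < n.+1%:R - 2 :> R by rewrite subr_gt0 (ltr_nat _ 2); lia.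
    rewrite mul0r -(pmulr_rle0 _ n1) -cA excess_average //.
    rewrite subr_le0; apply: (@le_trans _ _ 0); last first.
      by apply: mulr_ge0; [rewrite invr_ge0|apply: sumr_ge0 => t _; exact: max0_ge0].
    apply: sumr_le0 => v vA; rewrite -(mul0r mu); apply: (HQ 0%N) => //.
    - by have := cardsD1 v A; rewrite vA cA; case.
    - by have := missingD1 A F v; lia.
    by apply: tameS tc; apply: presentS => //; exact: subD1set.
  by apply: (@exact_step n 0 A F c mu n10 HQ) => //; rewrite addn0.
move: mA; rewrite leq_eqVlt => /orP[/eqP mA|mA]; first exact: (@exact_step n k.+1 A F c mu n10 HQ).
apply: (@le_trans _ _ (k%:R * mu)); last by apply: ler_wpM2r => //; rewrite ler_nat.
by apply: IH (ltnW k4) _ _ _ _ cA _ tc; rewrite -ltnS; move: mA; rewrite !addnS !addSn.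
Qed.

End Induction.

(** * Graphs and packings encoded by numbers *)

Fixpoint bits (p : positive) : seq bool :=
  match p with xI q => true :: bits q | xO q => false :: bits q | xH => [::] end.
(** Reads [b] binary digits at a time, least significant first; [i] counts the remaining ones, [w] is the
    weight of the next and [v] the value so far. *)
Fixpoint digits (b i w v : nat) (s : seq bool) : seq nat :=
  if s is x :: s' then
    let v' := if x then v + w else v in
    if i is i'.+1 then digits b i' (w + w) v' s' else v' :: digits b b 1 0 s'
  else [::].
Definition unpack b p := digits b.-1 b.-1 1 0 (bits p).
Fixpoint pair_up (s : seq nat) : seq (nat * nat) :=
  if s is i :: j :: s' then (i, j) :: pair_up s' else [::].
(** A graph of missing pairs is a list of labels below 16, two for each pair. *)
Definition graph_of p := pair_up (unpack 4 p).
Definition linked (g : seq (nat * nat)) i j := has (fun e => (e.1 == i) && (e.2 == j)) g.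
Definition joined (g : seq (nat * nat)) i j := linked g i j || linked g j i.
Fixpoint weight_row g k j (s ds : seq nat) : seq nat * seq nat :=
  if s is i :: s' then
    if [|| linked g i j, linked g i k | linked g j k]
    then let r := weight_row g k j s' ds in (0 :: r.1, r.2)
    else let r := weight_row g k j s' (behead ds) in (head 0 ds :: r.1, r.2)
  else ([::], ds).
Fixpoint weight_rows g k (s ds : seq nat) : seq (seq nat) * seq nat :=
  if s is j :: s' then
    let r := weight_row g k j (iota 0 j) ds in let q := weight_rows g k s' r.2 in (r.1 :: q.1, q.2)
  else ([::], ds).
(** The weights are stored for the triangles only, ordered by their largest label [k], then the middle
    [j], then [i]; triangles over a missing pair get weight 0. *)
Fixpoint weight_table g (s ds : seq nat) : seq (seq (seq nat)) :=
  if s is k :: s' then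
    let r := weight_rows g k (iota 0 k) ds in r.1 :: weight_table g s' r.2
  else [::].
Definition entry (W : seq (seq (seq nat))) i j k := nth 0 (nth [::] (nth [::] W k) j) i.
(** The entry of the triangle with labels [i < j] and [k]. *)
Definition apex W i j k :=
  if k < i then entry W k i j else if k == i then 0
  else if k < j then entry W i k j else if k == j then 0 else entry W i j k.
Definition cover n W i j := sumn [seq apex W i j k | k <- iota 0 n].
Definition each_pair n (P : nat -> nat -> bool) := all (fun j => all (fun i => P i j) (iota 0 j)) (iota 0 n).
Definition deficit n D g W := sumn [seq sumn [seq if joined g i j then 0 else D - cover n W i j | i <- iota 0 j] | j <- iota 0 n].
(** Weights are numerators over the denominator [D], and [h] is twice the allowed uncovered weight. A
    missing pair must have cover 0, which makes all entries of triangles over it vanish. *)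
Definition valid n D h g W :=
  [&& all (all (all (fun w => w + w <= D))) W,
   each_pair n (fun i j => if joined g i j then cover n W i j == 0 else cover n W i j <= D)
   & 2 * deficit n D g W <= h * D].
Definition certified n D b h g p := valid n D h g (weight_table g (iota 0 n) (unpack b p)).

Section Drawings.
Variable T : finType.
Implicit Types (A B t : {set T}) (F : {set {set T}}) (g : seq (nat * nat)) (lab : T -> nat).

(** The labelling is an isomorphism from the graph of missing pairs inside [A] to [g]. *)
Definition drawn n lab A F g := [/\ {in A &, injective lab}, {in A, forall v, lab v < n}, #|A| = n
  & forall u v, u \in A -> v \in A -> u != v -> ([set u; v] \in F) = joined g (lab u) (lab v)].

Lemma lab_perm n lab A : {in A &, injective lab} -> {in A, forall v, lab v < n} -> #|A| = n ->
  perm_eq [seq lab v | v <- enum A] (iota 0 n).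
Proof.
move=> inj lt cA; have u : uniq [seq lab v | v <- enum A].
  by rewrite map_inj_in_uniq ?enum_uniq // => x y; rewrite !mem_enum; exact: inj.
apply: uniq_perm => //; first exact: iota_uniq.
have s : {subset [seq lab v | v <- enum A] <= iota 0 n}.
  by move=> k /mapP[v]; rewrite mem_enum => vA ->; rewrite mem_iota add0n lt.
have [|_ h] := uniq_min_size u s; last by move=> k; rewrite h.
by rewrite size_iota size_map -cardE cA.
Qed.

Lemma sum_lab n lab A F g (f : nat -> nat) : drawn n lab A F g ->
  \sum_(v in A) f (lab v) = \sum_(k <- iota 0 n) f k.
Proof.
move=> [inj lt cA _]; rewrite -(perm_big _ (lab_perm inj lt cA)) /= big_map.
by rewrite big_enum.
Qed.

Lemma label_of n lab A F g k : drawn n lab A F g -> k < n -> exists2 v, v \in A & lab v = k.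
Proof.
move=> [inj lt cA _] kn; have := perm_mem (lab_perm inj lt cA) k.
rewrite mem_iota kn => /mapP[v]; rewrite mem_enum => vA ->; by exists v.
Qed.

(** Sorting the labels makes the entry a function of the vertex set. *)
Definition weight W lab t :=
  let s := sort leq [seq lab v | v <- enum t] in entry W (nth 0 s 0) (nth 0 s 1) (nth 0 s 2).

Lemma sort3 (i j k : nat) : i < j -> k != i -> k != j ->
  sort leq [:: k; i; j] = if k < i then [:: k; i; j] else if k < j then [:: i; k; j] else [:: i; j; k].
Proof.
move=> ij ki kj; apply: (@sorted_eq _ leq leq_trans anti_leq); first exact: sort_sorted leq_total _.
  by case: ifP => h1; [|case: ifP => h2]; rewrite /= !andbT; apply/andP; split; lia.
rewrite perm_sort; case: ifP => // _; case: ifP => _.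
  by apply/seq.permP => a /=; rewrite addnCA.
by apply/seq.permP => a /=; rewrite !addn0 addnC addnA.
Qed.

Lemma weight_apex W lab A u v x : {in A &, injective lab} -> u \in A -> v \in A -> x \in A ->
  lab u < lab v -> x \notin [set u; v] -> weight W lab (x |: [set u; v]) = apex W (lab u) (lab v) (lab x).
Proof.
move=> inj uA vA xA uv; rewrite in_set2 negb_or => /andP[xu xv].
have uv' : u != v by apply: contraTneq uv => ->; rewrite ltnn.
have pe : perm_eq (enum (x |: [set u; v])) [:: x; u; v].
  apply: uniq_perm; rewrite ?enum_uniq //=; first by rewrite !inE negb_or xu xv uv'.
  by move=> y; rewrite mem_enum !inE.
have -> : weight W lab (x |: [set u; v]) = let s := sort leq [:: lab x; lab u; lab v] in
    entry W (nth 0 s 0) (nth 0 s 1) (nth 0 s 2).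
  by rewrite /weight (perm_sortP leq_total leq_trans anti_leq _ _ (perm_map lab pe)).
have n1 : lab x != lab u by apply: contra_neq xu; exact: inj.
have n2 : lab x != lab v by apply: contra_neq xv; exact: inj.
rewrite sort3 // /apex (negPf n1) (negPf n2); case: ifP => //= _; by case: ifP.
Qed.

Lemma cover_sum n lab A F g W u v : drawn n lab A F g -> u \in A -> v \in A -> lab u < lab v ->
  \sum_(x in A | x \notin [set u; v]) weight W lab (x |: [set u; v]) = cover n W (lab u) (lab v).
Proof.
move=> D uA vA uv; have [inj _ _ _] := D.
rewrite /cover sumnE big_map -(sum_lab _ D) [RHS](bigID (fun x => x \in [set u; v])) /= [X in _ = X + _]big1 ?add0n.
  by apply: eq_bigr => x /andP[xA xp]; rewrite (weight_apex _ inj).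
move=> x /andP[_]; rewrite in_set2 /apex => /orP[] /eqP ->; rewrite ?ltnn ?eqxx //.
by rewrite ltnNge ltnW // gtn_eqF.
Qed.

Lemma pair_ordered n lab A F g p : drawn n lab A F g -> p \in pairs A ->
  exists u v, [/\ u \in A, v \in A, lab u < lab v & p = [set u; v]].
Proof.
move=> [inj _ _ _] /pairsP[u [v [uA vA uv ->]]]; case: (ltngtP (lab u) (lab v)) => h.
- by exists u, v.
- by exists v, u; rewrite setUC.
by move: uv; rewrite (inj _ _ uA vA h) eqxx.
Qed.

Lemma sum_pairs_ordered (V : nmodType) n lab A F g (f : {set T} -> V) : drawn n lab A F g ->
  (\sum_(p in pairs A) f p = \sum_(v in A) \sum_(u in A | (lab u < lab v)%N) f [set u; v])%R.
Proof.
move=> D; have [inj _ _ _] := D; rewrite pair_big_dep /=.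
pose h (q : T * T) := [set q.2; q.1].
have -> : pairs A = [set h q | q in [pred q : T * T | [&& q.1 \in A, q.2 \in A & lab q.2 < lab q.1]]].
  apply/setP => p; apply/idP/imsetP => [/(pair_ordered D)[u [v [uA vA uv ->]]]|].
    by exists (v, u); rewrite // inE /= uA vA.
  case=> [[v u]]; rewrite inE /= => /and3P[vA uA uv] ->; rewrite /h /= mem_pairs2 uA vA /=.
  by apply: contraTneq uv => ->; rewrite ltnn.
rewrite big_imset //=; move=> [v1 u1] [v2 u2]; rewrite !inE /= /h /=.
move=> /and3P[_ _ l1] /and3P[_ _ l2] /set2_inj[[-> ->] //|[e1 e2]].
by move: l1 l2; rewrite e1 e2; lia.
Qed.

Lemma each_pairP n P i j : each_pair n P -> j < n -> i < j -> P i j.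
Proof.
move=> /allP h jn ij; have := h j; rewrite mem_iota jn => /(_ isT)/allP; apply.
by rewrite mem_iota.
Qed.

(** The pairs inside [A] correspond to the label pairs [i < j < n]. *)
Lemma deficit_sum n D0 lab A F g W : drawn n lab A F g ->
  \sum_(v in A) \sum_(u in A | lab u < lab v) (if [set u; v] \in F then 0 else D0 - cover n W (lab u) (lab v))
   = deficit n D0 g W.
Proof.
move=> D; have [inj lt _ e] := D.
rewrite /deficit sumnE big_map -(sum_lab _ D); apply: eq_bigr => v vA.
rewrite sumnE big_map.
transitivity (\sum_(u in A) if lab u < lab v then (if joined g (lab u) (lab v) then 0 else D0 - cover n W (lab u) (lab v)) else 0).
  rewrite big_mkcondr /=; apply: eq_bigr => u uA; case: ifP => // uv; rewrite e //.
  by apply: contraTneq uv => ->; rewrite ltnn.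
rewrite (sum_lab (fun i => if i < lab v then (if joined g i (lab v) then 0 else D0 - cover n W i (lab v)) else 0) D).
rewrite -big_mkcond /= -(subnKC (ltnW (lt v vA))) iotaD big_cat /= add0n [X in _ + X]big1_seq ?addn0; last first.
  by move=> i; rewrite mem_iota => /andP[h]; lia.
by rewrite big_seq_cond [RHS]big_seq; apply: eq_bigl => i; rewrite mem_iota add0n andbb.
Qed.
End Drawings.

Section Packed.
Local Open Scope ring_scope.
Variables (R : realFieldType) (T : finType).
Implicit Types (A B N W H : {set T}) (F S C : {set {set T}}) (p q t e : {set T}) (c : {set T} -> R).

Definition coverage A F (w : {set T} -> R) p := \sum_(t in triangles A F | p \subset t) w t.

(** The packings of the theorem, for the vertices in [A] only and with the missing pairs [F] in place of
    the adjacency relation. *)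
Definition packs A F (w : {set T} -> R) (K : R) :=
  [/\ forall t, t \in triangles A F -> 0 <= w t <= 2^-1, forall p, p \in present A F -> coverage A F w p <= 1
    & \sum_(p in present A F) (1 - coverage A F w p) <= K].

Lemma packs_capped A F w K c M : packs A F w K -> capped A F c M -> excess A F c <= K * M.
Proof.
move=> [h1 h2 h3] [M0 hM]; apply: le_trans (weak_duality c h1) _.
apply: (@le_trans _ _ (\sum_(p in present A F) (1 - coverage A F w p) * M)).
  by apply: ler_sum => p pA; apply: ler_wpM2l; [rewrite subr_ge0 h2|exact: hM].
by rewrite -mulr_suml; apply: ler_wpM2r.
Qed.

Lemma packs_exact A F w : packs A F w 0 -> forall p, p \in present A F -> coverage A F w p = 1.
Proof.
move=> [_ h2 h3] p pA; apply/eqP; rewrite eq_sym -subr_eq0.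
have g q : q \in present A F -> 0 <= 1 - coverage A F w q by move=> qA; rewrite subr_ge0 h2.
apply/eqP; apply: (psumr_eq0P g) pA; apply/le_anti; rewrite h3 /=.
exact: sumr_ge0.
Qed.

(** The covers computed from the table are the coverages, as the entries over missing pairs vanish. *)
Lemma packs_certified (n D0 b h : nat) lab A F g (wd : positive) : drawn n lab A F g -> (0 < D0)%N -> certified n D0 b h g wd ->
  exists w, packs A F w (h%:R / 2).
Proof.
move=> D D1; rewrite /certified; move: (weight_table _ _ _) => Wt /and3P[hw hp hd].
have [inj lt cA e] := D; have D0R : 0 < D0%:R :> R by rewrite ltr0n.
pose wt := weight Wt lab; pose om t : R := (wt t)%:R / D0%:R; exists om.
have om0 t : 0 <= om t by rewrite divr_ge0 ?ler0n.
have small i j k : (entry Wt i j k + entry Wt i j k <= D0)%N.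
  rewrite /entry; have [k1|k1] := ltnP k (size Wt); last by rewrite (nth_default _ k1) nth_nil nth_nil.
  have := all_nthP [::] hw k k1; move: (nth [::] Wt k) => Wk /= hk.
  have [j1|j1] := ltnP j (size Wk); last by rewrite (nth_default _ j1) nth_nil.
  have := all_nthP [::] hk j j1; move: (nth [::] Wk j) => Wkj /= hj.
  have [i1|i1] := ltnP i (size Wkj); last by rewrite (nth_default _ i1).
  exact: (all_nthP 0%N hj i i1).
have zero u v x : u \in A -> v \in A -> x \in A -> u != v -> [set u; v] \in F -> x \notin [set u; v] ->
    wt (x |: [set u; v]) = 0%N.
  move=> uA vA xA uv uvF xp.
  have pA : [set u; v] \in pairs A by rewrite mem_pairs2 uA vA.
  have [u' [v' [u'A v'A l ep]]] := pair_ordered D pA; rewrite ep in uvF xp *.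
  have uv' : u' != v' by apply: contraTneq l => ->; rewrite ltnn.
  have := each_pairP hp (lt _ v'A) l; rewrite -e // uvF => /eqP h0.
  have := cover_sum Wt D u'A v'A l; rewrite h0 => /eqP.
  by rewrite sum_nat_eq0 => /forall_inP/(_ x); rewrite xA xp => /(_ isT)/eqP.
have cov u v : u \in A -> v \in A -> (lab u < lab v)%N -> [set u; v] \notin F ->
    coverage A F om [set u; v] = (cover n Wt (lab u) (lab v))%:R / D0%:R.
  move=> uA vA l uvF; have uv : u != v by apply: contraTneq l => ->; rewrite ltnn.
  rewrite /coverage sum_triangles_over; last by rewrite in_setD uvF mem_pairs2 uA vA.
  rewrite -(cover_sum Wt D uA vA l) natr_sum mulr_suml /common big_mkcond [RHS]big_mkcond /=.
  apply: eq_bigr => x _; rewrite inE; case xA: (x \in A) => //=.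
  case xp: (x \in [set u; v]) => //=; case: ifP => // /negbT; rewrite negb_forall_in => /exists_inP[y yp].
  rewrite negbK => xyF; have xy : x != y by apply: contraFneq xp => ->.
  suff -> : weight Wt lab (x |: [set u; v]) = 0%N by rewrite mul0r.
  move: yp xp; rewrite in_set2 => /orP[]/eqP ey; subst y; rewrite in_set2 => /norP[xu xv].
    have -> : x |: [set u; v] = v |: [set x; u] by apply/setP => y; rewrite !inE orbA orbC.
    by apply: zero => //; rewrite in_set2 negb_or ![v == _]eq_sym xv.
  have -> : x |: [set u; v] = u |: [set x; v] by rewrite setUCA.
  by apply: zero => //; rewrite in_set2 negb_or ![u == _]eq_sym xu eq_sym.
have covle u v : u \in A -> v \in A -> (lab u < lab v)%N -> [set u; v] \notin F -> (cover n Wt (lab u) (lab v) <= D0)%N.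
  move=> uA vA l uvF; have uv : u != v by apply: contraTneq l => ->; rewrite ltnn.
  by have := each_pairP hp (lt _ vA) l; rewrite -e // (negPf uvF).
split=> [t tA|p0|].
- rewrite om0 /= /om ler_pdivrMr // -[2^-1]div1r mulrAC ler_pdivlMr // mul1r -natrM ler_nat.
  by rewrite /wt /weight muln2 -addnn; exact: small.
- rewrite in_setD => /andP[pF /(pair_ordered D)[u [v [uA vA l ep]]]]; rewrite ep in pF *.
  by rewrite cov // ler_pdivrMr // mul1r ler_nat covle.
have -> : \sum_(q in present A F) (1 - coverage A F om q) = (deficit n D0 g Wt)%:R / D0%:R.
  rewrite sum_present (sum_pairs_ordered _ D) -(deficit_sum D0 Wt D) natr_sum mulr_suml.
  apply: eq_bigr => v vA; rewrite natr_sum mulr_suml; apply: eq_bigr => u /andP[uA l].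
  case: ifP => [_|/negbT uvF]; first by rewrite mul0r.
  by rewrite cov // natrB ?covle // mulrBl divff // gt_eqF.
rewrite ler_pdivrMr // mulrAC ler_pdivlMr ?ltr0n // -natrM -natrM ler_nat mulnC //.
Qed.
End Packed.

(** * Completeness of a catalogue of graphs *)

(** The permutation [p] of the labels below [size p] carries [h] onto [g]. *)
Definition renames n (p : seq nat) (h g : seq (nat * nat)) :=
  let h' := [seq (nth 0 p e.1, nth 0 p e.2) | e <- h] in
  [&& size p <= n, uniq p, all (fun i => i < size p) p, all (fun e => (e.1 < size p) && (e.2 < size p)) h,
   all (fun e => joined g e.1 e.2) h' & all (fun e => joined h' e.1 e.2) g].
Definition valency n (g : seq (nat * nat)) i := count (joined g i) (iota 0 n).
(** The number of labels in use when they form an initial segment. *)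
Definition width (g : seq (nat * nat)) := foldr (fun e m => maxn (maxn e.1.+1 e.2.+1) m) 0 g.
(** A list of proper pairs in which every label below the width occurs. *)
Definition framed n g :=
  all (fun e => [&& e.1 != e.2, e.1 < n & e.2 < n]) g && all (fun v => 0 < valency n g v) (iota 0 (width g)).
(** The pairs to be added when graphs are built up so that a leaf is added last whenever there is one:
    from an old label to a new one, between two new ones, or between old ones provided that no leaf
    results. *)
Definition extensions n g : seq ((nat * nat) * nat) :=
  let w := width g in
  (if w < n then [seq ((i, w), w.+1) | i <- iota 0 w] else [::]) ++
  (if w.+1 < n then [:: ((w, w.+1), w.+2)] else [::]) ++
  flatten [seq [seq ((i, j), w) | i <- iota 0 j &
     ~~ joined g i j && all (fun v => 1 < valency n ((i, j) :: g) v) (iota 0 w)] | j <- iota 0 w].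
(** For each graph in [xs] the numbers [ds] name an isomorphic graph in [hs], by a position of three
    digits, and a renaming. *)
Fixpoint listed n (hs : seq (seq (nat * nat))) (xs : seq (seq (nat * nat) * nat)) (ds : seq nat) :=
  if xs is (g, w) :: xs' then
    if ds is a :: b :: c :: ds' then
      let k := a + 16 * (b + 16 * c) in
      (k < size hs) && renames n (take w ds') (nth [::] hs k) g && listed n hs xs' (drop w ds')
    else false
  else true.
Definition slim n d w g := all (fun v => valency n g v <= d) (iota 0 w).
Definition complete_step n d gs hs cs :=
  (size gs == size cs) &&
  all (fun gc => framed n gc.1 && listed n hs [seq x <- [seq (x.1 :: gc.1, x.2) | x <- extensions n gc.1] | slim n d x.2 x.1] gc.2)
    (zip gs cs).

Section Catalogue.
Variable T : finType.
Implicit Types (A B t : {set T}) (F : {set {set T}}) (g h : seq (nat * nat)) (lab : T -> nat).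

Lemma linkedE g i j : linked g i j = ((i, j) \in g).
Proof.
apply/hasP/idP => [[[a b] eg /andP[/eqP <- /eqP <-]] //|h]; by exists (i, j); rewrite //= !eqxx.
Qed.

Lemma joinedE g i j : joined g i j = ((i, j) \in g) || ((j, i) \in g).
Proof. by rewrite /joined !linkedE. Qed.

Lemma joinedC g i j : joined g i j = joined g j i.
Proof. by rewrite /joined orbC. Qed.

Lemma joined_cons a b g i j :
  joined ((a, b) :: g) i j = [|| (a == i) && (b == j), (a == j) && (b == i) | joined g i j].
Proof.
rewrite /joined /= -!orbA; congr (_ || _); rewrite orbCA; congr (_ || _).
Qed.

Lemma drawn_map n lab A F g h (s : nat -> nat) : injective s -> (forall k, k < n -> s k < n) ->
  (forall a b, joined h (s a) (s b) = joined g a b) -> drawn n lab A F g -> drawn n (s \o lab) A F h.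
Proof.
move=> sI sn sj [inj lt cA e]; split=> //.
- by move=> u v uA vA /= /sI; exact: inj.
- by move=> v vA; apply: sn; exact: lt.
by move=> u v uA vA uv; rewrite e //= sj.
Qed.

Lemma drawn_renames n lab A F g h p : renames n p h g -> drawn n lab A F g -> exists lab', drawn n lab' A F h.
Proof.
case/and5P=> pn pu /allP plt /allP hlt /andP[/allP h1 /allP h2] D.
have pm k : k < size p -> k \in p.
  have pl : {subset p <= iota 0 (size p)} by move=> i /plt; rewrite mem_iota.
  by move=> kp; have [|_ e] := uniq_min_size pu pl; [rewrite size_iota|rewrite e mem_iota].
pose s k := if k < size p then index k p else k.
have s1 k : k < size p -> s (nth 0 p k) = k.
  by move=> kp; rewrite /s plt ?mem_nth // index_uniq.
have s2 k : k < size p -> s k < size p by move=> kp; rewrite /s kp index_mem pm.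
have s3 k : (s k < size p) = (k < size p).
  by rewrite {1}/s; case: (ltnP k (size p)) => kp; [rewrite index_mem pm|rewrite ltnNge kp].
have s4 k : k < size p -> nth 0 p (s k) = k by move=> kp; rewrite /s kp nth_index ?pm.
have sI : injective s.
  move=> a b e; have ab : (a < size p) = (b < size p) by rewrite -[LHS]s3 -[RHS]s3 e.
  case: (boolP (a < size p)) => ap; first by rewrite -(s4 a ap) -(s4 b) ?e // -ab.
  by move: e; rewrite /s (negPf ap) -ab (negPf ap).
exists (s \o lab); apply: drawn_map D => //.
  move=> k kn; have [kp|kp] := ltnP k (size p); first exact: leq_trans (s2 k kp) pn.
  by rewrite /s ifN // -leqNgt.
have im x y : (x, y) \in h -> x < size p /\ y < size p by move/hlt => /andP[].
have hg a b : (s a, s b) \in h -> joined g a b.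
  move=> e; have [xa xb] := im _ _ e; rewrite !s3 in xa xb.
  by have := h1 _ (map_f (fun e => (nth 0 p e.1, nth 0 p e.2)) e); rewrite /= !s4.
have gh a b : (a, b) \in g -> joined h (s a) (s b).
  have hm x y : (x, y) \in [seq (nth 0 p e.1, nth 0 p e.2) | e <- h] -> (s x, s y) \in h.
    by case/mapP => [[u v] uv [-> ->]]; have [up vp] := im _ _ uv; rewrite !s1.
  by move/h2; rewrite joinedE => /orP[] /hm hh; rewrite joinedE hh ?orbT.
move=> a b; apply/idP/idP; rewrite joinedE => /orP[].
- exact: hg.
- by rewrite joinedC; exact: hg.
- exact: gh.
by rewrite joinedC; exact: gh.
Qed.

Lemma drawn_cons n lab A F g x y : [set x; y] \in F -> drawn n lab A (F :\ [set x; y]) g ->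
  x \in A -> y \in A -> x != y -> drawn n lab A F ((lab x, lab y) :: g).
Proof.
move=> fF [inj lt cA e] xA yA xy; split=> // u v uA vA uv.
rewrite joined_cons -e // in_setD1 !(inj_in_eq inj) //.
have [ef|nf] /= := eqVneq [set u; v] [set x; y].
  rewrite ef fF; case: (set2_inj ef) => [[-> ->]|[-> ->]]; by rewrite !eqxx ?orbT.
have f1 : (x == u) && (y == v) = false by apply: contraNF nf => /andP[/eqP <- /eqP <-].
have f2 : (x == v) && (y == u) = false by apply: contraNF nf => /andP[/eqP <- /eqP <-]; rewrite setUC.
by rewrite f1 f2.
Qed.

Lemma degree_joined n lab A F g v : drawn n lab A F g -> all (fun e => e.1 != e.2) g -> v \in A ->
  degree A F v = valency n g (lab v).
Proof.
move=> D /allP lp vA; have [inj lt cA e] := D.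
rewrite degree_set // /valency -sum1_count big_mkcond /=.
rewrite -(sum_lab (fun k => if joined g (lab v) k then 1 else 0) D) -sum1_card big_mkcond [RHS]big_mkcond /=.
apply: eq_bigr => u _; rewrite inE; case uA: (u \in A) => //=.
have [->|uv] /= := eqVneq u v; last by rewrite e // eq_sym.
rewrite joinedE orbb; case: ifP => // /lp /=; by rewrite eqxx.
Qed.

Lemma width_joined g i j : joined g i j -> i < width g.
Proof.
rewrite joinedE; elim: g => // -[a b] g IH; rewrite !in_cons /= leq_max.
case/orP => /orP[/eqP[e1 e2]|h]; rewrite ?e1 ?e2 ?leq_max ?leqnn ?orbT //; by rewrite IH ?h ?orbT.
Qed.

Lemma width_framed n g : framed n g -> width g <= n.
Proof.
case/andP => /allP h _; elim: g h => // -[a b] g IH h.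
rewrite /= !geq_max; have /and3P[_ -> ->] := h _ (mem_head _ _).
by apply: IH => q qg; apply: h; rewrite in_cons qg orbT.
Qed.

Lemma valency_width n g i : 0 < valency n g i -> i < width g.
Proof. by rewrite -has_count => /hasP[j _]; exact: width_joined. Qed.

(** Labels from the width on occur in no pair. *)
Lemma drawn_exchange n lab A F g a b : drawn n lab A F g -> width g <= a < n -> width g <= b < n ->
  drawn n ((fun k => if k == a then b else if k == b then a else k) \o lab) A F g.
Proof.
move=> D /andP[wa an] /andP[wb bn]; set s := fun k => _.
have ss : involutive s.
  move=> k; rewrite /s; case: (k =P a) => [->|/eqP ka]; last case: (k =P b) => [->|/eqP kb].
  - by rewrite eqxx; case: eqP.
  - by rewrite eqxx.
  by rewrite (negPf ka) (negPf kb).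
apply: drawn_map D; first exact: inv_inj.
  by move=> k kn; rewrite /s; case: ifP => // _; case: ifP.
have far k : (width g <= k) -> forall l, joined g k l = false.
  by move=> wk l; apply: contraTF wk => /width_joined; rewrite ltnNge.
have fs k : (s k == k) || ((width g <= k) && (width g <= s k)).
  by rewrite /s; case: (k =P a) => [->|_]; [rewrite wa wb orbT|case: (k =P b) => [->|_]; rewrite ?eqxx ?wa ?wb ?orbT].
move=> k l; case/orP: (fs k) => [/eqP ek|/andP[h1 h2]]; last by rewrite !far.
rewrite ek; case/orP: (fs l) => [/eqP -> //|/andP[h1 h2]].
by rewrite ![joined g k _]joinedC !far.
Qed.

Lemma degree_setD1 A F f v : f \in F -> f \in pairs A -> degree A F v = (v \in f) + degree A (F :\ f) v.
Proof.
move=> fF fA; rewrite /degree (cardsD1 f) !inE fF /= -[(f \subset A) && _]/(_) ; move: (fA); rewrite inE => /andP[-> ->] /=.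
congr (_ + _); apply: eq_card => q; rewrite !inE; by case: (q == f) => //=.
Qed.

Lemma listed_renames n hs xs ds g w : listed n hs xs ds -> (g, w) \in xs ->
  exists h p, h \in hs /\ renames n p h g.
Proof.
elim: xs ds => // -[g' w'] xs IH [|a [|b [|c ds]]] //= /andP[/andP[kh rn] ls].
rewrite in_cons => /orP[/eqP[-> _]|]; last exact: IH ls.
by exists (nth [::] hs (a + 16 * (b + 16 * c))), (take w' ds); rewrite mem_nth.
Qed.

(** A missing pair is removed, a pair with a leaf if there is one, and the induction hypothesis labels the
    rest. The ends that have become isolated carry labels from the width on; after exchanging labels they
    are the first of these, and the removed pair is one of the extensions. *)
Lemma catalogue_step n d m gs hs cs : complete_step n d gs hs cs ->
  (forall A F, #|A| = n -> missing A F = m -> exists lab g, g \in gs /\ drawn n lab A F g) ->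
  forall A F, #|A| = n -> missing A F = m.+1 -> {in A, forall v, degree A F v <= d} ->
    exists lab h, h \in hs /\ drawn n lab A F h.
Proof.
case/andP => /eqP sz /allP chk IH A F cA mA dA.
have enough lab g e w : g \in gs -> (e, w) \in extensions n g -> drawn n lab A F (e :: g) ->
    all (fun e => e.1 != e.2) (e :: g) -> w <= n -> exists lab h, h \in hs /\ drawn n lab A F h.
  move=> gg ex D lp wn.
  have [k ks ek] : exists2 k, k < size gs & nth [::] gs k = g.
    by exists (index g gs); rewrite ?index_mem ?nth_index.
  have /chk /= /andP[_ ls] : (g, nth [::] cs k) \in zip gs cs.
    by rewrite -ek -(nth_zip _ _ _ sz) mem_nth // size_zip -sz minnn.
  have [|h [p [hh rn]]] := listed_renames ls (g := e :: g) (w := w).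
    rewrite mem_filter (map_f (fun x => (x.1 :: g, x.2)) ex) andbT; apply/allP => v; rewrite mem_iota add0n /= => vw.
    have [x xA <-] := label_of D (leq_trans vw wn).
    by rewrite -(degree_joined D lp xA) dA.
  by have [lab' D'] := drawn_renames rn D; exists lab', h.
have /card_gt0P[f0] : 0 < #|F :&: pairs A| by have := mA; rewrite /missing => ->.
rewrite in_setI => /andP[f0F f0A].
have base f : f \in F -> f \in pairs A -> exists lab g,
    [/\ g \in gs, drawn n lab A (F :\ f) g & framed n g].
  move=> fF fA; have [|lab [g [gg D]]] := IH A (F :\ f) cA.
    by have := missing_setD1 fF fA; rewrite mA => -[].
  exists lab, g; split=> //.
  have [k ks ek] : exists2 k, k < size gs & nth [::] gs k = g.
    by exists (index g gs); rewrite ?index_mem ?nth_index.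
  have /chk /andP[] // : (g, nth [::] cs k) \in zip gs cs.
  by rewrite -ek -(nth_zip _ _ _ sz) mem_nth // size_zip -sz minnn.
have low lab g F' v : drawn n lab A F' g -> framed n g -> v \in A ->
    (lab v < width g) = (0 < degree A F' v).
  move=> D /andP[/allP lp /allP fr] vA; have lp' : all (fun e => e.1 != e.2) g.
    by apply/allP => e /lp /and3P[].
  rewrite (degree_joined D lp' vA); apply/idP/idP; last exact: valency_width.
  by move=> lw; apply: fr; rewrite mem_iota.
have [/exists_inP[y yA /eqP dy]|nl] := boolP [exists y in A, degree A F y == 1].
  have [f fF [fA yf]] : exists2 f, f \in F & f \in pairs A /\ y \in f.
    have /card_gt0P[f] : 0 < #|[set p in F :&: pairs A | y \in p]| by move: dy; rewrite /degree => ->.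
    by rewrite inE in_setI -andbA => /and3P[fF fA yf]; exists f.
  have [x [ef xA xy]] : exists x, [/\ f = [set x; y], x \in A & x != y].
    case/pairsP: fA yf => u [v [uA vA uv ->]]; rewrite in_set2 => /orP[]/eqP ->.
      by exists v; rewrite setUC eq_sym.
    by exists u.
  subst f; have [lab [g [gg D fr]]] := base _ fF fA.
  have lp : all (fun e => e.1 != e.2) g by case/andP: fr => /allP lp _; apply/allP => e /lp /and3P[].
  have dy0 : degree A (F :\ [set x; y]) y = 0.
    by have := degree_setD1 y fF fA; rewrite dy set22 add1n => -[].
  have wy : width g <= lab y by rewrite leqNgt (low _ _ _ _ D fr yA) dy0.
  have [inj lt _ _] := D; have wn : width g < n by apply: leq_ltn_trans wy (lt _ yA).
  have D1 := drawn_exchange D (a := lab y) (b := width g); rewrite wy lt // leqnn wn in D1.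
  have {}D1 := D1 isT isT; set lab1 := _ \o lab in D1.
  have l1y : lab1 y = width g by rewrite /lab1 /= eqxx.
  have [inj1 lt1 _ _] := D1.
  have [xw|xw] := ltnP (lab1 x) (width g).
    apply: (enough lab1 g (lab1 x, lab1 y) (width g).+1) => //.
    - by rewrite l1y /extensions wn mem_cat (map_f (fun i => ((i, width g), (width g).+1))) ?mem_iota.
    - exact: drawn_cons.
    by rewrite /= l1y lp ltn_eqF.
  have x1 : lab1 x != width g by rewrite -l1y (inj_in_eq inj1).
  have xw1 : width g < lab1 x by rewrite ltn_neqAle eq_sym x1.
  have wn1 : (width g).+1 < n by apply: leq_ltn_trans xw1 (lt1 _ xA).
  have D2 := drawn_exchange D1 (a := lab1 x) (b := (width g).+1); rewrite xw lt1 // leqnSn wn1 in D2.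
  have {}D2 := D2 isT isT; set lab2 := _ \o lab1 in D2.
  have l2y : lab2 y = width g.
    by rewrite /lab2 /= l1y ltn_eqF // ltn_eqF.
  have l2x : lab2 x = (width g).+1 by rewrite /lab2 /= eqxx.
  apply: (enough lab2 g (lab2 y, lab2 x) (width g).+2) => //.
  - by rewrite l2y l2x /extensions wn1 !mem_cat inE eqxx !orbT.
  - by apply: drawn_cons; rewrite 1?setUC // 1?eq_sym // setUC.
  by rewrite /= l2y l2x lp ltn_eqF.
case/pairsP: (f0A) => x [y [xA yA xy ef]]; rewrite ef in f0F f0A.
have [lab [g [gg D fr]]] := base _ f0F f0A.
have lp : all (fun e => e.1 != e.2) g by case/andP: fr => /allP lp _; apply/allP => e /lp /and3P[].
have big v : v \in A -> 0 < degree A F v -> 1 < degree A F v.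
  move=> vA; rewrite [1 < _]ltn_neqAle eq_sym => ->; rewrite andbT.
  by move: nl; rewrite negb_exists_in => /forall_inP; apply.
have [inj lt _ e] := D.
have ends v : v \in [set x; y] -> v \in A -> lab v < width g.
  move=> vf vA; rewrite (low _ _ _ _ D fr vA); have := degree_setD1 v f0F f0A; rewrite vf add1n => dv.
  by have := big v vA; rewrite dv; apply.
have finish u v : u \in A -> v \in A -> lab u < lab v -> [set u; v] = [set x; y] ->
    exists lab h, h \in hs /\ drawn n lab A F h.
  move=> uA vA uv euv; have uv' : u != v by apply: contraTneq uv => ->; rewrite ltnn.
  have vw : lab v < width g by apply: ends => //; rewrite -euv set22.
  have Dc : drawn n lab A F ((lab u, lab v) :: g) by apply: drawn_cons => //; rewrite euv.
  have lpc : all (fun e => e.1 != e.2) ((lab u, lab v) :: g) by rewrite /= lp ltn_eqF.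
  have wn := width_framed fr.
  apply: (enough lab g (lab u, lab v) (width g)) => //.
  rewrite /extensions !mem_cat; apply/orP; right; apply/orP; right.
  apply/flattenP; exists [seq ((i, lab v), width g) | i <- iota 0 (lab v) &
     ~~ joined g i (lab v) && all (fun w => 1 < valency n ((i, lab v) :: g) w) (iota 0 (width g))].
    by apply: (map_f (fun j => [seq ((i, j), width g) | i <- iota 0 j &
     ~~ joined g i j && all (fun w => 1 < valency n ((i, j) :: g) w) (iota 0 (width g))])); rewrite mem_iota.
  apply: (map_f (fun i => ((i, lab v), width g))); rewrite mem_filter mem_iota /= uv andbT.
  rewrite -e // euv in_setD1 eqxx /=; apply/allP => k; rewrite mem_iota /= => kw.
  have [z zA ez] := label_of D (leq_trans kw wn); rewrite -ez -(degree_joined Dc lpc zA); apply: big => //.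
  have : 0 < degree A (F :\ [set x; y]) z by rewrite -(low _ _ _ _ D fr zA) ez.
  by rewrite (degree_setD1 z f0F f0A) => hz; apply: leq_trans hz (leq_addl _ _).
case: (ltngtP (lab x) (lab y)) => h; first exact: (finish x y).
  by apply: (finish y x) => //; rewrite setUC.
by move: xy; rewrite (inj _ _ xA yA h) eqxx.
Qed.

Lemma drawn_empty A F : missing A F = 0 -> exists lab, drawn #|A| lab A F [::].
Proof.
move=> m0; exists (fun v => index v (enum A)); split=> //.
- move=> u v uA vA /(congr1 (nth u (enum A))); rewrite !nth_index ?mem_enum //.
- by move=> v vA; rewrite cardE index_mem mem_enum.
move=> u v uA vA uv; move: m0 => /eqP; rewrite cards_eq0 => /eqP/setP/(_ [set u; v]).
by rewrite in_setI mem_pairs2 uA vA uv !andbT in_set0.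
Qed.

Fixpoint sublists r (s : seq nat) : seq (seq nat) :=
  if s is x :: s' then (if r is r'.+1 then map (cons x) (sublists r' s') else [::]) ++ sublists r s'
  else if r is 0 then [:: [::]] else [::].

Lemma filter_sublists P s : filter P s \in sublists (size (filter P s)) s.
Proof.
elim: s => //= x s IH; case: ifP => _; rewrite mem_cat; last by rewrite IH orbT.
by rewrite /= (map_f (cons x) IH).
Qed.

Definition attached n (g : seq (nat * nat)) X := [seq (k, n) | k <- X] ++ g.

Lemma joined_attached n g X i j :
  joined (attached n g X) i j = [|| (i \in X) && (j == n), (j \in X) && (i == n) | joined g i j].
Proof.
have mem a b : ((a, b) \in attached n g X) = ((a \in X) && (b == n)) || ((a, b) \in g).
  rewrite mem_cat; congr (_ || _); apply/mapP/andP => [[k kX [-> ->]] //|[aX /eqP ->]]; by exists a.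
by rewrite !joinedE !mem -!orbA; congr (_ || _); rewrite orbCA.
Qed.

Lemma drawn_attach n lab A F g y : framed n g -> drawn n lab (A :\ y) F g -> y \in A ->
  exists lab' P, [/\ drawn n.+1 lab' A F (attached n g [seq k <- iota 0 n | P k]),
    size [seq k <- iota 0 n | P k] = degree A F y
    & {in A :\ y, forall v, P (lab v) = ([set y; v] \in F)}].
Proof.
move=> fr D yA; have [inj lt cA e] := D.
pose P k := [exists v in A :\ y, (lab v == k) && ([set y; v] \in F)].
have PE v : v \in A :\ y -> P (lab v) = ([set y; v] \in F).
  move=> vA; apply/exists_inP/idP => [[u uA /andP[/eqP uv]]|vF]; last by exists v; rewrite // eqxx.
  by rewrite (inj _ _ uA vA uv).
exists (fun v => if v == y then n else lab v), P; split=> //; last first.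
  rewrite degree_set // size_filter -sum1_count big_mkcond /= -(sum_lab (fun k => if P k then 1 else 0) D).
  rewrite -sum1_card big_mkcond [RHS]big_mkcond /=; apply: eq_bigr => v _; rewrite inE.
  case vA: (v \in A :\ y); move: (vA); rewrite in_setD1; last by rewrite andbC => /negbT; rewrite negb_and; case: (v \in A); case: (v == y).
  by case/andP => -> -> /=; rewrite PE.
have inA v : v \in A -> v != y -> v \in A :\ y by rewrite in_setD1 => -> ->.
have ltn v : v \in A -> v != y -> lab v < n by move=> vA vy; apply/lt/inA.
split.
- move=> u v uA vA; case: (eqVneq u y) => [->|uy]; case: (eqVneq v y) => [->|vy] //.
  + by move=> h; have := ltn v vA vy; rewrite -h ltnn.
  + by move=> h; have := ltn u uA uy; rewrite h ltnn.
  by apply: inj; exact: inA.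
- move=> v vA; case: (eqVneq v y) => [_|vy]; first exact: ltnSn.
  exact: leq_trans (ltn v vA vy) (leqnSn n).
- by have := cardsD1 y A; rewrite yA cA.
have nX v : v \in A -> v != y -> (lab v == n) = false by move=> vA vy; rewrite ltn_eqF // ltn.
have memX v : v \in A -> v != y -> (lab v \in [seq k <- iota 0 n | P k]) = ([set y; v] \in F).
  by move=> vA vy; rewrite mem_filter mem_iota add0n ltn // andbT PE ?inA // andbT.
have nn : (n \in [seq k <- iota 0 n | P k]) = false by rewrite mem_filter mem_iota add0n ltnn !andbF.
have gn k : joined g n k = false.
  by apply: contraTF (width_framed fr) => /width_joined; rewrite -ltnNge.
move=> u v uA vA uv; rewrite joined_attached.
case: (eqVneq u y) uv => [->|uy]; case: (eqVneq v y) => [->|vy] uv //.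
- by rewrite nn memX // gn eqxx andbT orbF.
- by rewrite nn memX // joinedC gn eqxx andbT !orbF setUC.
by rewrite !nX // !andbF e // inA.
Qed.

End Catalogue.

(** * The catalogue on ten vertices *)

Definition graphs0 : seq positive := [::
  0x1]%positive.
Definition weights0 : seq positive := [::
  0x1033000f3300c003003cc0000ccc0030c00cc0c03300033cc00300303c003]%positive.
Definition children0 : seq positive := [::
  0x110000]%positive.
Definition graphs1 : seq positive := [::
  0x110]%positive.
Definition weights1 : seq positive := [::
  0x18070140a04c0cd12100079181320e000f0a4030458003034200cd02c]%positive.
Definition children1 : seq positive := [::
  0x13210000201001210001]%positive.
Definition graphs2 : seq positive := [::
  0x13210; 0x12010]%positive.
Definition weights2 : seq positive := [::
  0x1143100b63030009344c2003432c060c14207004c40338206c90c; 0x40cc08430cc01cc080027e1042000f02a3400c8000c4d06030c78]%positive.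
Definition children2 : seq positive := [::
  0x154321000241023003410320034320100343210003; 0x121000024310003321000431200043210001]%positive.
Definition graphs3 : seq positive := [::
  0x1212010; 0x1302010; 0x1543210; 0x1324010; 0x1322010]%positive.
Definition weights3 : seq positive := [::
  0x1330000cf000300c3cc3000c0300f30cc00f30000ccf0f0300; 0x430c00c300f0c330000f003cc0c303c00033030c030c03c303;
  0x1814208205d2a0089304010833c41c2108720c39c023100ca; 0x73000c003030030cf0030c30c030cc3c0033cc033030330c0;
  0x1a0050c403406c03280700071cb3108284240ac808c70c0143]%positive.
Definition children3 : seq positive := [::
  0x143210009310200a320100a321000a; 0x154321000642130007431200074321000743210008;
  0x176543210003632104500463210540046541023004654103200465432010046543210004;
  0x14653210004325410005542310001543210001325140005325410006; 0x1321000054321000514320002143020074320100234120007]%positive.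
Definition graphs4 : seq positive := [::
  0x132312010; 0x152324010; 0x132214010; 0x176543210; 0x154326010; 0x154322010; 0x154302010; 0x141302010;
  0x140302010; 0x143212010; 0x121302010]%positive.
Definition weights4 : seq positive := [::
  0x140d4008cf0207043002e10c28b4048c741d00300330ccc; 0x1318040e041348193060f00024d2c0836c34021304f03c;
  0x4434403300eb4070120c3104b003a3010cc0304ccc4833; 0x10b400a2c4840034d18c123310464338c010ce025e047;
  0x400cc303e070043200c3e103310203c3c0c00005d3337; 0x1c840200433104cc700c00cc3730830c4330e3c00c01f0;
  0x5031420c87082130803830675421030f18c40190c802b2; 0x1038408c430c2d045801c485c210700db405603cd400c0e;
  0x130181e0000c8330a108c00f800f403c01e15198d5020311; 0x10c60501c32002f110e040780cc038300c0c2b010e40fc;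
  0x10c180c843300603cc00d0082099a018318c0c329649c10]%positive.
Definition children4 : seq positive := [::
  0x13210019230101954321001740213018413020184230101843210018;
  0x176543210010643105201165132400116451032011645103201465432100116543210014;
  0x14321000c654321000b53041201354231001345103201554321000d351240015;
  0x19876543210008854321067009854321076009876321045009876321054009876541023009876541032009876543201009876543210009;
  0x16875432100095432761000a327645100103276541001054762310010547632100105432716000a76543210006;
  0x17654321000a36145200113615420011541632000b6541032007546320100b6543210007;
  0x132765410006362451001436254100142546310007354621000735461200076543210002;
  0x1365412000753142001524530100d34520100d534120016415320003;
  0x14653210002543210003534210003524310003514320003543210000;
  0x12654310005523410012524310012431052004432051004432150004;
  0x1231001913200195421300044210300e3421000f3412000f24310001]%positive.
Definition graphs5 : seq positive := [::
  0x15040302010; 0x14140302010; 0x15460302010; 0x15440302010; 0x15432302010; 0x15432616010; 0x15432706010;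
  0x15432602010; 0x19876543210; 0x17654328010; 0x17654322010; 0x16532214010; 0x14332214010; 0x13251214010;
  0x13231214010; 0x13221402010; 0x17652324010; 0x15232614010; 0x15232414010; 0x15232314010; 0x15232604010;
  0x15232403010; 0x15232402010; 0x15432312010; 0x13231402010; 0x13231302010]%positive.
Definition weights5 : seq positive := [::
  0x1c801000c3490cbc001202743e183093c846d800941009; 0x648047000230387c0029430833d030c35c0f5080d880;
  0x1005dc240c0c3120c20acc0c01e00303f05130330cc8; 0x5080c8301834cc0392000708d69040c0cb7361c06111;
  0x1c120000e071c20f00810c91b354231d849213c1183; 0x118c00c0c3870300c02ac20127c0e1c010c50d3e38;
  0x484912c300180c3320d2810c0f105388c0330338c3; 0x1006302c784094982c0118448e3004e109c53302789;
  0x12220cc2dc1020c9f0042242d932844300693c038; 0x7090081132cc0c03c008ac08a2127d81ec0600338;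
  0x1c00342030cc2901c1086c0f23048933c4cc16840a; 0x440e0a8011d03330801f001e2130880d220ccce330;
  0x402a031213830c84d411802054ac108b02c84dc7281; 0x41c8088801e06c12501c2c05839380001ccd50336e0;
  0x4831024c00a8c60390308003289c0c483720cc37130; 0x1012648c020ccc18464843804f0581500c8e48232760;
  0x1444c3058d00330a3008d8008ca460823c34323e44; 0x430271020c032c430f000fc001b30021093d2b4278;
  0x41650c0360910686cc000902e0a430030f0f084f35; 0x1030c03c060e4c0313088303403380c07c0308770a3;
  0x14038c200c0cc01cc44313a0f080c0021e833207133; 0x436002430cc0330c00f081c6300d1d20e0838010c77;
  0x1108310c8a1134c800c3038cc310f00200c70340f82c; 0x1000f2340d0960c1503220ce1d000e00d0f0630465e;
  0x120070780430c33443600705702c00f06e01cc20c807; 0x1204c0e400d0c303800f0226c3440c95c44543b440c3]%positive.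
Definition children5 : seq positive := [::
  0x17654321003e643215003f653214003f654213003f654312003f654321003f6543210041;
  0x14321003b654321003951324003c54231003a54321003a54321003c532410040;
  0x18765432100357354216003776453210036765432100367654213003776543120037765432100375476321003e;
  0x15376214003736521400386543210032654213003365431200336543210033563214003f;
  0x17654321002b645321002c654321002c654231002d654321002d654321002f5436120039;
  0x18765432100285432107602b763245100297632541002976542310029765432100295432607102b5432617002b;
  0x19876543210023861543270026871543260026876324510024876325410024876542310024876543210024876543210026548327610035;
  0x1361875420026315476200207645321001c7654321001c615473200277654321001e7654321002037546120037; 0x1;
  0x1765432981001b985432671001898543276100189876324510018987632541001898765423100189876543210018765432918001b7698543210023;
  0x1987654321001b85432106701985432107601987632104501987632105401917654832001a18376540202687654320101a381765420026;
  0x148765321001a75643210011765432100116532741001665734021016736540120274765320102074653210027;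
  0x11043201023401010043210101234001043210010654321001353210400f54012300f53401200f52340100f54321000f;
  0x145763201020654321001456432010215634021021640513201f4326501033632514001f;
  0x104321010042310104320103b465320102f54320103040215302e40315202e43502103a54321000a;
  0x143210010365124002d54103202e53124002e41530203c54321000e31542003c;
  0x15498763210018867543210009876543210009476853210019576841032019476835210019485761032024576814032019584763210024;
  0x158761403201953247610011753261400155326740101173526140015756140320255732406101c5732614001c;
  0x154321000654763210029465321002a532106402c463521002a6543210007532406102c532416002c;
  0x154321000576524031016654231001264501320126405213021640135201d6524031021652314001d;
  0x15648732100245432761001c647532100255632741001c64735210025765432100035632714001c57326410036;
  0x141765230027465231001d1526430021452631001f461523000445261300216524130038;
  0x15476321001e465321001f564103201f463521001f4106532032561403201f5326410032;
  0x176543210017362451000836254100086540213022654130202265423010226543210022;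
  0x1432100011324001023140010465321002225310400c54231000254132000d54231000d325410034;
  0x132100005423100312410303d4130200b4230100b2413003d]%positive.
Definition graphs6 : seq positive := [::
  0x1323121302010; 0x1433231402010; 0x1523221403010; 0x1725232604010; 0x1523221604010; 0x1545232314010;
  0x1535232414010; 0x1625232414010; 0x1645232614010; 0x1867652324010; 0x1323121504010; 0x1323121402010;
  0x1533251214010; 0x1325121403010; 0x1325121402010; 0x1433221504010; 0x1433221402010; 0x1756532214010;
  0x1655332214010; 0x1654332214010; 0x1653251214010; 0x1766454322010; 0x1765432412010; 0x1765432312010;
  0x1765492328010; 0x1765442328010; 0x1765432218010; 0x1987654322010; 0x1745432602010; 0x1544332602010;
  0x1547232602010; 0x1544232602010; 0x1543271602010; 0x1543241602010; 0x1543231602010; 0x1985432706010;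
  0x1548232706010; 0x1544232706010; 0x1543281706010; 0x1543221706010; 0x1875432616010; 0x1547232616010;
  0x1544232616010; 0x1765432302010; 0x1645432302010; 0x1546232302010; 0x1544232302010; 0x1543261302010;
  0x1543241302010; 0x1543221302010; 0x1645440302010; 0x1546140302010; 0x1545140302010; 0x1875460302010;
  0x1745460302010; 0x1547160302010; 0x1544160302010; 0x1654140302010; 0x1524140302010; 0x1324140302010;
  0x1514140302010; 0x1412140302010; 0x1765040302010; 0x1615040302010; 0x1215040302010; 0x1605040302010]%positive.
Definition weights6 : seq positive := [::
  0x1c0c00030330333303000cc0f3c0330f30fc00cc0; 0x43c0003c0f000cf00c330c0c03c03fc0c030f00cc;
  0x100c30f000f3300300f33000cf0c03033300333cc; 0x1030c00fcc0c0c03c30c000f00f30cc0300cf33c;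
  0x40330c303c00c30c00fc3300c3033c0c030cc03f; 0x130300330c00fc030c0f000cc3c03cccc0300f33;
  0x13300c300000f3c3300c0c0cc3c00cc303f33f0; 0x70c00c00330c00ff0000c03cf0c0303fcccc0f0;
  0x4c0c030cc003c30c303c00c33c0f0cc00c0ff03; 0x430c0cccc003300c0ccf0c30c3c0330033f0cc;
  0x4c030f00030300fc0f0003c333003c0f033ccc0c; 0x100d880d040cc32c045d0e107d02444b20ca41b64;
  0x4c00cc0c00c33c33030000f03f03003cc3ccccc0; 0x1cc000c000f00f0f00c003cc3330c30f0f3c0c030;
  0x1003cc00c00f330c300c3c3003300c0cf30ccf00c; 0x40f00c0c3030c0cc033c0c0c330333030c30c0cf;
  0x1000fc3000c303cc0cc0c30f0030030f0ccc3cc30; 0x1c03000c30cc33c030003f3003c0f303fc003cc;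
  0x430333000c00ccf00ccc0cc300c300fc030fcf0; 0x70300003c3033cc000cc0cf030cf0c330c0cccc;
  0x10c0c0c0c333033003c30cc000f0f0cc303030cf; 0x10f0003c3c0300cc0c303cc3003cc3300cf0333;
  0x103034263c03503108d85831905c57810724bc3; 0x100c303ccc00c33000fc3030cc0c3f00000fff0;
  0x13c00f0030fc0f000c030f30033ccc3c30c303; 0x4c0c2288408828c6648048b81357091334f3c0;
  0x4c0c0c30300fcc0303300cc3303c33300f3303; 0x1033330cc03c330003c0fc03300fc0f300c303;
  0x43061248238133070c114800f35045f52bc02f0; 0x1c300030033330c3c00300300ff0303fc330f0c0;
  0x1303030c0c00cf0c033c0030cf033c03033033f0; 0x4030c3303c03c00f00cc00c330c0cc330c30f303;
  0x403c003fc00c03c0c0c0f03cc00f3030300c3cf; 0x100ccc0c3000c3cc0c0f0c300f000f0f00c0fc3c;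
  0x10c0303c033300f0c00c300cf033030c30cf30cc; 0x40f3c00c033ccc000ccf030c303c30c0c330c3;
  0x13303030000fc0c303cc0f00cc0f030f00f003f; 0x4f0003c03003303cc300c003fc0c3c00cfc0c33;
  0x13c00cc00c000fc330c3003f0c30303ccc03fc0; 0x61033401083087a5031700dc20d10c4f863a384;
  0x1330000fc30033c0c3000f3c3ccc30030c3fc0; 0x40cc0c303c300cc003fc30000f0f0f0030c3cf;
  0x10330300ccc300f00333300cc0333c00c3300ff; 0x130c0c0c00303f03033030cc0f0c033c33ccc30;
  0x433030030c0330cc03c3300ccc003f0cc033cc3; 0x1c00303003c3c330c00003f0cc3c000ccfc3f0c0;
  0x40c0c03cc30c00f03c003cc300c30cccc00ccc0f; 0x430c00cc0f00c3c300300c33c30c033c03f03c3;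
  0x1c0300030c0f0ccc000f0c0333c0ccf03c00f033; 0x130c0300c0c030cf00f000fc03c0cc03f00cf30c;
  0x4c300303030cf00cc0300cc0f30f0c00c30fc0cc0; 0x100f0cc00030fc03300cf0030c300cc03f3c30cc0;
  0x40f0030c00f3c0c000fc0330c30cc33030c300c3c; 0x100f00c3c30330c03c30c0c3c0c0cf3000c33330;
  0x4c30300c003cc30c0f030330f00330ccccf000c3; 0x4c0c030c03cc03c303000c30f33003c333c3030c;
  0x1c00300c033cc3c003000f0ff00f000c33ccc0303; 0x7030030003c33c0c00330f0c30c3cc0c3cf003c0;
  0x10153303012f00b40528cc0e4450e103b053a0193; 0x1c30000c0c0cc30f000c0cc3ccc0cc03fc3c00330;
  0x4003c0cc0c3cc300033f00303300f30f0003c0c33; 0x4033033003303f00033f0000ccc03fc00303330f0;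
  0x10c3000f0c3c0c033033030303c3c30c3c0c30c0c0; 0x4030cf0003c0cc30033c300f30033300c3c3033003;
  0x7000c030c0303cf00030cccc30cc0cccc30c0f3000; 0x7000c0033c03c3c0003330ccc3303c0c333000330030]%positive.
Definition children6 : seq positive := [::
  0x154321009e4210309f4310209f4320109f4321009f;
  0x11342009b2341009b4321009d4321009b654321009952314009a54021309c54312009a54321009a54321009c;
  0x154321009376543210091645301209265432100926541230094645301209765432100946543210097;
  0x1987654321008b86543107208c87451326008c86743105208c87651324008c86745103208c8674510320a287654321008c8765432100a2;
  0x1876543210084754360120857634521008575634012085765432100856745103208f765432100885736124008f;
  0x101542308223450108331524008252041308313405208223450108254321008240253108254321008376543210080604312508162513040816520413081645103208162345010816543210081;
  0x131250407f34250107f34251007f15042307f15043207f54230107f54231007f54320107f54321007f7654321007d643102507e651320407e645102307e645103207e654320107e654321007e;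
  0x187654321007a7534621007b7634521007b6751320408d7654321007b765432100a16754320108d6754321008d;
  0x1654321007487654321007270543216076763452100737156320407676543210073765432100757456320107676543210076;
  0x1953247108606c953248107606c953248107606f987643105206c987651324006c987645103206c987645103206f987654321006c987654321006f;
  0x135214007f7654321006764532100686543210068564231008956432100896543210069653402107c;
  0x14321009b4312006643210066654321006354321006454231009654312006554321006554321006b;
  0x13245010834053210933542010835432100607654321005d624351005e36504210784605321092654321005e654321005f3654021079;
  0x15421300837654321005a426301505e536210405e46523010945643210094645230105b654321005b;
  0x176543210057634512005863540210586543210058643510205964532010596543210059;
  0x121435008221534009334521009334125008276543210053654321005465123400555612340087564321008765432100556543210056;
  0x1134200663410209b4321009b14302066654321005251340209551432009515340205c45320106215432005c;
  0x1987654321004486754321004587654321004587654321004776583041206e76584231006e76548103207087654321004b765381240070;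
  0x1654321003f87654321003e756432100487654321004963572104048740612350406357401204f7654321004074061235049;
  0x187654321003d7564321004a7654321004a6573210405365740123053657340120536572340105365743210053;
  0x187654321003a7564321004c7654321004d7043651204c7234651004c7324651004d7654321003b7403651204d;
  0x19876543210036312058764045832105476037312087645045832107654037756418320045876541032037756483201045876543210037;
  0x1987654321003186753140206e87653140206e76853410203e87632540103276548102303e876543210032876325401033876543210033;
  0x1987654321002e54382671007254382761007276382451007276382541007287654021302f87654130202f87654230102f87654321002f;
  0x1;
  0x17654329810036596783104206c597683104206c7681039542044897632105402b7681095423044897654103202b76543291800369876543210028;
  0x1765432981003154967832100445497683210044769458321004476954832100447654938021031897654103202c9876543210023397654128002c;
  0x1;
  0x1769832541002b68754321003717543860204b68574321003738671542008c75486231007075486321007167548320104b87654321001e;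
  0x168754103203215473206040610723450497651342008e5671432008561075432050654732010407654321001c;
  0x1769854321002d65487321002975486103202984576321007185476321007165483721002986754103201a75481603202987654321001a;
  0x16875432100295432761003861037542050367154200886107542304d671054320205432716003876543210019;
  0x1679854320102365487321003354867320103a68457320104b68547320104b654837120033854716032029854326071029876543210016;
  0x16875432100335143760204c67534102040376520140857236541004f73265410050547132600385714326001f;
  0x168754321002f5427310605d6372451007663725410076547623100915476132005a5476231005a76543210013; 0x1;
  0x17654983210028865497321002b875496321002b794586321006f795486321006f7654938210028549786321008b875491326002b9876543210010;
  0x1769854321002865432871003775432861003776103854204737865102408c76108542304757863104208c75432816003787654321000f;
  0x1975432186002c68543297010237854329601023973281456002b973281546002b975481236002b975481326002b975432816002d5497328160012;
  0x1379854126002c654328710033754328610033845371260070854371260070754836021032547863210084754328160029387541260011;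
  0x1965432781002a965432871002a8754321096022968732451002a968732541002a968754231002a968754321002a87543260910228754326190022;
  0x1769854321002a65487321002775410863202684576321006d85476321006d65483721002754876321007a754608132026754618032026;
  0x1564103207468754321002754321076039610375420463756241007b610754230465736421007b5432607103954326170039;
  0x1987654321002285432106702685432107602687632104502687632105402617654832002517654823002587654320102438176542000e;
  0x168732105402676543210039756432100397163542008d65417320051654172300516547320104e67543210021;
  0x1187546230025541076320347451623005175416230051546173200571754306201b546271300346754321001b;
  0x15124300827610543203465142300436153024089561423005815462300185462301042654231001d;
  0x1687543201024547632100357456320104e7546320104e54736120034547261300345476320106767543210017;
  0x141352008241253008253412007f53410206076543210035653410204163520140865461023043546103204356432010686543210015;
  0x176542310030263451007726354100775461203063654031201454632010636542310014;
  0x136287541001a3276541001932756410019736254100906254731002063547210020635471200207654321000b;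
  0x13628754100167316542001f7345612001f735461200202546730103b3546720103b7361542002076543210009;
  0x1435102060327654100133624510097362154005b246510305f346510205f362451005b6543210007;
  0x1693254781001069325487100108732549610012693287451001069328754100108762549310012876354921001287635491200129876543210005;
  0x1673298541001063287541000f37254861001e63285741000f6837254100a267254831001e67354821001e67354812001e8765432100a0;
  0x1986354712001286354172001137254861001668345712001e68354712001e67254831001667354821001668354712001a548716320006;
  0x15638714200115314762001f6375412001c7653142008f5614732001f5614723001f6354712001957146320004;
  0x143287651000e73564120021736541200217365142001b72654130017736541200177365412001b47653210003;
  0x13452010605376412001736541200156523014018635410203c36541020696523041018541632000a;
  0x121403066314020664230106643201066465321000d51320406a52410306a53410206a54320106a345210002;
  0x15376412001b365142001d352641005956320410185623041018362514008a541632000c;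
  0x123401066432010664132009d3651420014352104065451203061354102065534120098145320008;
  0x159847632100055846732100a05847632100a07648532100067658432100067658342100067658243100067658143200068765432100a4;
  0x187561432000675164320004467532100095674321000956734210009567243100095761432000b61754320001;
  0x125764310003621435000a621534000a621543000a612543000c621543000c2654310000;
  0x16875432100a4765432100017564321000174653210001736542100017265431000171654320001765432100a3]%positive.
Definition graphs7 : seq positive := [::
  0x161605040302010; 0x176605040302010; 0x152415040302010; 0x154717060302010; 0x174546050302010; 0x187549060302010;
  0x187546040302010; 0x154516040302010; 0x154515040302010; 0x154617040302010; 0x154615040302010; 0x164547040302010;
  0x164545040302010; 0x154326160302010; 0x154328180706010; 0x154423280706010; 0x154823290706010; 0x154823270603010;
  0x198543270602010; 0x154323170602010; 0x154323160302010; 0x154324160302010; 0x154327180602010; 0x154327160302010;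
  0x154423221602010; 0x154423270602010; 0x154723280602010; 0x154723260302010; 0x154433270602010; 0x154433260302010;
  0x174543280602010; 0x174543260502010; 0x174543260402010; 0x174543260302010; 0x198765432302010; 0x176543291218010;
  0x176543231218010; 0x176543221802010; 0x176545242328010; 0x176544232818010; 0x176544232908010; 0x176544232802010;
  0x176549232818010; 0x176549232804010; 0x176549232803010; 0x176549232802010; 0x198765432312010; 0x176543231802010;
  0x176543231302010; 0x198765432412010; 0x176548232412010; 0x176543241802010; 0x176543241402010; 0x176543241302010;
  0x198766454322010; 0x176645432802010; 0x176645432402010; 0x176645432302010; 0x187653251214010; 0x165327151214010;
  0x165325131214010; 0x187654332214010; 0x187655332214010; 0x165645332214010; 0x165533271214010; 0x165533241214010;
  0x165533231214010; 0x165533221402010; 0x198756532214010; 0x186756532214010; 0x176756532214010; 0x185756532214010;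
  0x175656332214010; 0x175655332214010; 0x175654332214010; 0x175653281214010; 0x175653261214010; 0x175653251214010;
  0x175653231214010; 0x175653221604010; 0x175653221504010; 0x175653221402010; 0x165433221402010; 0x176433221504010;
  0x165433221504010; 0x143326121504010; 0x143322160504010; 0x176325121402010; 0x163325121402010; 0x132512160402010;
  0x176325121403010; 0x132512160403010; 0x132512150403010; 0x176533251214010; 0x153623251214010; 0x153326151214010;
  0x153325141214010; 0x153325131214010; 0x153325121402010; 0x165323121402010; 0x154323121402010; 0x132513121402010;
  0x132413121402010; 0x176323121504010; 0x164323121504010; 0x132613121504010; 0x132413121504010; 0x132312150402010;
  0x186765232914010; 0x186765232414010; 0x186765232314010; 0x186765232904010; 0x186765232403010; 0x186765232402010;
  0x187645232614010; 0x164735232614010; 0x164535232614010; 0x164725232614010; 0x164523261704010; 0x164523261604010;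
  0x164523261403010; 0x164523261402010; 0x187625232414010; 0x173625232414010; 0x162523241402010; 0x176535232414010;
  0x153523241604010; 0x153523241402010; 0x176545232314010; 0x154523231604010; 0x154523231403010; 0x154523231402010;
  0x187523221604010; 0x173523221604010; 0x153523221604010; 0x143523221604010; 0x152327121604010; 0x152323121604010;
  0x152322160402010; 0x198725232604010; 0x172523281604010; 0x172523241604010; 0x172523231604010; 0x172523260403010;
  0x172523260402010; 0x176523221403010; 0x164523221403010; 0x154523221403010; 0x152326121403010; 0x152324121403010;
  0x152323121403010; 0x152322160403010; 0x152322140302010; 0x165433231402010; 0x143325131402010; 0x143323121402010;
  0x143323150402010; 0x143323140302010; 0x154323121302010; 0x132312140302010; 0x174548060302010; 0x172625232414010;
  0x172523280604010; 0x170605040302010; 0x176805040302010]%positive.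
Definition weights7 : seq positive := [::
  0x10c03102d750281c2070f0c4c8f0204334441dc80; 0x120430333130c0b084d0347930780cc38c031004c;
  0x1021c024f00d832502300bf0645548f020ba112; 0x7c000030c09d2c90300627c30fc30c243c0c85;
  0x10c0c183930017a204c31624c2435b1c0e00770; 0x14c812314f82000b03c0dca140d0f2d06003b4;
  0x7003051d142cb082424d38e1c4338c0f10b001; 0x40c84603c90240fc01803cc6c0607611d8e1190;
  0x4402c40b704d2700c9200f700e04cf03046f00c; 0x1024900f64a0c580a812312207c606240176b30;
  0x1000f0cc1175f040c03333030cc0c00fc5c530c; 0x40c63030030fc2432412c0cc600f06c0f084325;
  0x5308010730c3e02014e4340f330c3328048ec04; 0x1204903320948cd013207c94a0b4131195c7a;
  0x43601cb0900071a744381ce060130c94b7e1; 0x1c42009231483c0c183c0162ccc9c8440e337;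
  0x4c848d0c0650764821c0ce0c0322589c3387; 0x1043838628300385832c0f114cc1420d21cde;
  0x6035300bc30c2c50b381331c068489095332; 0x443160c604132a2c51020f05e1002ec70cfc4;
  0x483110d40303c9c00cd0368930c2934878c17; 0x460c000f3810ccc43510303cca0934cc3035b;
  0x18088430f047030f04481d3c0c2333380783c; 0x180130888c6210ce0208233c4c0d9d328d087;
  0x100f00438cc8715143180c0ed12c1d092352c3; 0x1120c0ccc804817809c38334c072320444c96e;
  0x4828a020210cb70330820dc12204a9f2052cd; 0x500cb04700818a780c0c52ec404365d30ec34;
  0x424c00cd8c030f030918d00735b02280a44bb; 0x18070401832a2780025cc048f87130a1d0b09c;
  0x168050d00c07c3c04d3070330c82ccf0300cf; 0x4c08412f003330924605623382d081d03d74c;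
  0x1021308dc0d81c20a80cc0a0740f13230c017b; 0x140d482104e28cc1028e0750320cc3d3f000f;
  0x143284c42d264170e1388a4c16c84336570; 0x4324f006cc0c2135340a5310c2c3b514f13;
  0x493003c442344b430c1c3a1c3c034d3cc83; 0x12d004c810c31c341e0c4c8cc34d43c33832;
  0x48581383403d0349c3044734dc43903cb83; 0x1831d000d848149d0f1a3203bc40e70c9a4;
  0x40f08c4cc1c0ac40ccd02140f1f0cc0334f; 0x484ca08082340f427061cc810d43ce630c8c;
  0x4e4325110d4d3306d8cc0036235dc10c2b; 0x4864c3c1035c16b01c0d13c80d00363bc32; 0x45373041c43c03dc137000333c31300fccc;
  0x12640b44cc830d200d0b093017a21dd0c1e2; 0x10330c63cc902198c44334acc915311b285;
  0x14c440e05c4320e06212ccd096535c31c863; 0x1300c0330c00ff0045c303c05dccd44cc3f1;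
  0x12d04171ac4380d22282725341d99867025; 0x1043875300d06c094d6c03c03828c201f3e5;
  0x1027210c835c02c36003c3c0013b3c37082e; 0x41c080f1d07040b40b43530cc20fd00d3b07;
  0x11a1000f1c1d018c3310880f1333f00b0bcc; 0x10c38d1906e081c18d0ed2034c30931d352;
  0x134800cc180ee143092180f1c01bc0cde1d8; 0x1144322860931c1413a3030cc47294803df42;
  0x1180c036227418c1284c24833117cc433799; 0x1107700c00cd7c0730350cd0c30f0cc3f0c4;
  0x5003a30130332311702375080c2934717320b; 0x500b041c30f45852c000f1c930f0120e8f0c3;
  0x463002880fd0530618c831e70474ccc9217; 0x4c0c09c18c0330ccc03303d47334b0423f1;
  0x4a0502132813d3031462100b38d833481dbc; 0x42611248380d30cc0c00f111cd40fc46a969;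
  0x45c040d80e3200e80d204261f1030fe0333d; 0x100e4052b601b1529400344ce80719307c2ec;
  0x1930000d00b33c310060d0ce1d31730c3788c; 0x11743330345330c0cc3cc0c30d14cf00cf1;
  0x43242071c8994201ca4c05d235c8330cd39; 0x44d103c14c27c10c306235404f03cfd0f60;
  0x11710cc00b0cd18003e3085333300cd30ff0; 0x1a080130070b72141487315259961b8d709c;
  0x4c144e100c2731813203362064630b1f093d; 0x101c820acc0390314c40e30f40b007319fd8;
  0x103c1620534b010d0ee00f04035d30ccb266; 0x451843602f110d400f98077413c090d18cf6;
  0x128082c41c04d30cd80134c0ac03c48f982f0; 0x110c501b83072a0030f084b0822d1b043e3d;
  0x41620c0c3d7004cc0c0c41dc30c0ccf322cc; 0x148304436210f10c20f0c1c0cc4d0ec103ecc;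
  0x443088703530ca00338243cc42228354e3cc; 0x1402303509cc4984308888e11c5c40f8233cc;
  0x4210c38607142c52283420d4d30c4e3465e2; 0x1c0211083153233430034b0c33138b0cdc871;
  0x404c880d0ccd2c08c4304421f4700d23b08e3; 0x10207c48240342cd4d02302c8c00b088f31cf0;
  0x1210c4230822c5c44a50908e82c84791ced80; 0x4405c6304a10f0c330143083b00f081ce89cc;
  0x4608403c3091a07420f01043e868631c0353d4; 0x1003380712c34c82820384887414a3f0d1a34;
  0x454330601120e0f201c623070c0c07ce1e0d30; 0x4012c15c135f1023060a09532610c4d4c70e0a;
  0x400f08a31143d088822884cc5340773132e2; 0x700c0414a203c66030303c03cd4d28e3031b4;
  0x1164420290d2226703080032b918079a1c22f0; 0x10a201230573003d00b40733708300fd0c0ac3;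
  0x108d03060d1440ec08703cc52282806d81f08d; 0x11017130a024ca90c242300f1c1384473890bc;
  0x1040b042dc82c1c00f08c44a880da0dc00f37; 0x408880c341d38c4603074034cc08f40f09b23;
  0x410e024c075c24304d700c8238228ccc03330d; 0x400e41c23840789405c473c0584a05da0334e4;
  0x400d89331081b4552218cb0094b03d03b1d9; 0x1430220908d3419880c2c48a1382803cd361b;
  0x1409204739003336009492553310cf31208f22; 0x10a08453020c34f00c650d2436230d2070bc5c;
  0x4288001b234310b231006c08dc30d30b12f034; 0x120a6c03684870184362c80457d39d821b4;
  0x11e034202582094c8947515c499e30da734; 0x4c8112345c08a510c6c048fb118c0ef221c;
  0x433072570b043033000f303b10d1e23c883; 0x1540d2090e033844914c8cb3444b88f34cc0;
  0x4423615075888240c35ca4232283c626d028; 0x5302c03080ccc1c1d1ec0730300cf39730c;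
  0x14023c11c0c08764230f13a410c03a60f8d3; 0x1c0068005c0bf031500c8471c70ce05f2b62;
  0x48306130230c8c209325cc103710cc2c703f; 0x7000d800b34033c810a088370d80fc333478;
  0x50d13041273002b013760331903c9c10f06f; 0x103031531b04e0310c8b00730c83903134dec;
  0x4414c324380f841900d20a1e8223000f8fc43; 0x4cc0cc000c0333c30c30f0d1417c4fd41f4;
  0x114c4c064130703cc250701f0930276c43cf; 0x1c003105033d4388060e04334b1385f85c0307;
  0x1a0140130c43fc12051c0069d3c5ba3803f; 0x1b4008020105ecf0700087407f4307cc3b78;
  0x165010098310be09034210c83e803d27435ca; 0x118030f06083310cc304d318193d88721b53;
  0x12c040b40850c5f10230c0cd83c08cc43c36d; 0x41a431110c03927201c58b00e40331e24fb05;
  0x10c1200f060cce10498330443d5431f80e013a; 0x70c0300c0c0c9c61083ec4c1ec0279f1140d;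
  0x100a5c090334925690704401ea103770f8e0c; 0x14c44c0210281c7c3500e430d3031b22cbd06;
  0x40d530840270c333025710882c0c42e71d719; 0x50308d100f039910c5c1a104cf3002e0391ec;
  0x601311808301cec5050b00ba0c0ac847cd1f0; 0x10033e0110803db03244ca30431201c8f34b340;
  0x18c10d1388c310e229c7007c40893c04a137; 0x433010b28821c03cc00c3c3c0801f92072b3;
  0x4221730201801abcc00842991c003cf66cf1; 0x1c00c090d800f03f000609c33342177c837a0;
  0x1321000f510e244c3c3000307b0fc3005b0996; 0x110d18228101db0941c0ac831830c80d3703039;
  0x100cc9240c64334409cc87900607e30f06352; 0x4630020d32118c3409813853713432c469662;
  0x190060088381ea80220c41334b20dcc8c84731; 0x1004e7200c88113c219828c5c40d425631e475;
  0x100cc3030f000ccc03303cc3c0543507c5c437; 0x140294508233c05d0d00324bc8409682b17f01;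
  0x414d08070ce1303c300c04707c0c133e0f3091; 0x100f0019a8441d3401b027ccc018cb130223216;
  0x4030c3810786cc000b7c0c480d562c49228f1; 0x40c3024c0336c0c034830f240e1601f5281c4a;
  0x4432020d2304c87013841e70c46c0c3c08d28c; 0x1018309c00ccccc1c413440c2b04ac01f33c4c0;
  0x104c20d4406e901c09c21950f11c20cc9363034; 0x15028430401cf3490160d00fe1028f00fc33c;
  0x404b102300e7474018cb042a84232c42833703]%positive.
Definition near_weights7 : seq positive := [::
  0x76000032310f10b060714ce421c4ec2b00340c; 0x1a2001300720e03c133016082f30e30342b0d;
  0x474402a350188c2d14080b8951c1236903536]%positive.
Definition fine_weights7 : seq positive := [::
  0xb000631c020320c30c6070a030410de6181700001b002210c1b0681000006150;
  0x232800084180006d00002d84824010084096080db00491825332c6000100]%positive.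
Definition children7 : seq positive := [::
  0x1; 0x1; 0x1; 0x1; 0x1; 0x1; 0x1; 0x1; 0x1; 0x1; 0x1; 0x1; 0x1;
  0x1876543210167715432601697645321016876543210168725461301697354612016976543210169;
  0x191765432801649867543210160987654321016098763245101619876325410161987654231016198765432101619876543210164;
  0x1976154328015d986154327015d987154326015d3876952410159987632541015b9876543210159987654321015b987654321015d; 0x1;
  0x179615428301579861543270151987154326015179618245301567961825430156987654321014e79615482301589876543210151; 0x1;
  0x1987654321014d867543210143876543210143876453210145876543210145876542310154876543120149876543210149;
  0x12618754301657654321013a7645321013b7654321013b7654321013d7654312014076543210140;
  0x16543210132361875420162765432101307654321013176543210133765423101357654321013576543210138;
  0x1967854321012739865417201519876543210127987645321012998765432101297986542310151983654712012c987654321012c;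
  0x1736198542016036154872016237254861012887645321012487654321012468254713012d68354712012d876543210126;
  0x136187540212d537610421256375104213576543210116765432101187654321011c76543210121;
  0x1357698241014e63154872012e73154862012e87654321010e87654321010f87654231015087654321011273654812012e;
  0x1763154982012c398654271014e783154962012c987645321010a987654321010a798654231014e987654321010b783654912012c;
  0x1736198542016436154872016617354862012d87645321010787654321010767154832012f68154723010d67354812012d;
  0x1756198342015768154327012b78154326012b76185342015e87654321016e76154832015f57643821010e78654321012b;
  0x1261875430166715423601254675231010876543210100615473201217654321010976542310125;
  0x17631549820129386197542015d7831549620129386195742015d987654321016d8761935420156789654321010a7896543210129;
  0x1376198542015163187452012b13574862012a68174325012e6817432500ff76183542015368174325010c68574321012a;
  0x1765198324012c65187324012e3715486200f767185324012e68732105411267183542010c8765432100f48765432100f7;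
  0x173619854201613618754201637815432601243618574201638765432100f2786542310107786543210107786543210124; 0x1; 0x1;
  0x176549832010ef98546732100dd98547632100dd98764532100dd98765432100dd76548021930ee76548031920ee839076542116098765432100e2;
  0x176549810320ee98546732100d998547632100d998764532100d998765432100d976549312800ee819376540216498765432100ec3198765420164;
  0x176981054320ed98675432100cf98765432100cf83761095420d983761094520d989761054230dd859376104216176918054320ed98765432100d5;
  0x176543210980ed98675432100c998765432100c938769524100ca98763254100cd98765432100ca98765432100cd76543280910ed76543281900ed;
  0x1;
  0x131769854200ea98675432100b798765432100b798765432100b898765432100ba98765432100bc891376540212c38769154200ea359876241014e;
  0x1; 0x1; 0x1; 0x1; 0x1;
  0x129765431080e798543267100b598543276100b598763245100b598763254100b598765423100af98765413200eb98765423100eb769854321014d;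
  0x198765423100f08542310670d28542310760d28762310450d28762310540d22817654031658765413020e48765423010e4281765430165;
  0x1;
  0x139765410280e998541067320b098541076320b083769514020c798761054320b389765410230e9958376140215783765491020c858764190320b8;
  0x113765498020e598543267100b498543276100b483769541020e995763280140c898765423100ae59764180320b898763254100ea3598761420151;
  0x198763210540ee8321054670d08321054760d03768514020e11857632041665768320140db8761054320d78763254010dc85176324012d;
  0x198765432100ef8543210670d18543210760d14768532010de8763210540d88765410230db8765410320db8765432010e3381765420162;
  0x1;
  0x113765498020e658973264100b198543276100b298763245100b198763254100b281937654200c698765432100ad89765432010e6398176542015d;
  0x151983276400ea5873210640bf8321054760bb17685324009b81532760412e1837654200bf8765410320bb53281760409b85176324012e;
  0x198765432100ed5873210640d48543210760d68763210450d48763210540d61765483200da1765482300da8765432010df381765420163;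
  0x1978654321007e987654321007e54879632100e549873201650bc03879465120e524879365100e549876501320bc694587320112739876521400bc;
  0x1674598320112787654321008074586320112a4876532010f773084652112a74283650112a4873265010f73874065210f7;
  0x1564320113234287650112840763251130736540210f8657432011304765012311847650132118734065210f8;
  0x1965784321007996587432100799875643210079987654321007991876523400e891876504320e890876543210e894876532100e892876534010e8;
  0x19786543210076987654321007687964053120a396874021350c787659432010a396874012350e969874035120ae94876532100e994876523100c7;
  0x11024653075041653207435264010742315640075120356407504165320754605321074231564007410246530745634012074352640107546053210756543210074654321007587654321007873251046073740612350737536210407376450123073756340120737352640107376543210073;
  0x174986532100e965874321007f78653402109984071652309d78465013209e76583402109a8654071320bf84765320112b8653271400b9;
  0x1352640107565432100656543210067653402113253621400753876540120de7653402108b76543210064657432010906573402108c765432100666753402113165703241090;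
  0x146053210754876523100e17653402108f740612350617401652308f67402153125657240310944765230112576543210061;
  0x165432100754876532100db764053120907654321005c6532741008f65407312092476510321357654321007237651240108; 0x1;
  0x1987654321005b978564321005b49327510860b149328610750b186753294100a286759340210a293408675120c694867532100e694328675100c6;
  0x17654321005547983201650ca4326587100d44327586100d44327685100d47328410650cb7834021650cb8765340120577324081650ce876543210057;
  0x147329810650b148329710650b148329610750b1498732016515987329410650c387934021650c3987653401205187324091650c59876543210051;
  0x17654321004d98754063120a340871563207784012753609984012753609c84750632107787540631209e84075126309e87563402109987563402109c;
  0x176984021350c764012873509974012863509987640213515e78401652309c7401283650b976358401205274081652309d87654321004a;
  0x176543210055798654321007987654321007a86754321007a87654321004f876532104045876540123045876534012045876523401045876543210045;
  0x1765984321007e84976532100e684967532100e697324081650c578943265010b478934065210b479654081320b7794865320112979653281400b7;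
  0x164987532100e587324561007f83240751609b8324075160a16758432010976758340210978754061320bd84675320112a8753261400bd;
  0x147983201650bc63240871509b73240861509b4873210651507843201650bd7834021650bd87653401203f4786532010f787654321003f;
  0x174986532100dd4876532100df4867532100df8765432100507843201650d17402183650d07403182650d074865320112487654321003c;
  0x174983265100ae43287105609e4327586100bf87654321005267532841009747583602109e8312475600524753281600bf784326510153;
  0x137982140650b84328765100bf4328675100bf38721406510e7328410650bd7832140650b98765432100397328140650bb87432651010c;
  0x174986532100d94876532100da4867532100da8765432100547841032650d07831240650d0748651032107876543210044738651240107;
  0x14876510230e0756432100467654321004665327410093654073120937165430214a657134200957165342014a;
  0x152987634010e85867432100455876432100454763285100985762384100c05768340210a08765012430a05763281400c0285764310152;
  0x1231465007465123400356543210035324165007443265101324873265100984237105604e7651043204723746510086765104320707654012307032716540086274365100fc;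
  0x132416500745873261400c03450762108632617540086237461500845407612303b437250610847634502111475326140114;
  0x14326510132265874310152254376100fc264375100fc65237410114657321401066572341010665327140114;
  0x154987632100ec5867432100445876432100444768532100dc5768432010dc4768351200dc84376510212f84576320112f85476321012f;
  0x14876351200dc576432100726340752109463517420094763451200415463721011c4763205110957632140109;
  0x165487321012f3576402111c367512401093574602111c56732140109763251400f6765132400f6;
  0x154987632100eb5867432100435876432100434768521300c25768430210c25768340210c14768251300c1485763201149584762310149;
  0x1564872310149542176300f96475231014b562174300f9762351400f564725130115765123400f3;
  0x154321002554321002754321002954321002a4576231014a623401511e2643051119263405111746251301374326150122;
  0x154987632100e75867432100425876432100428764021350c20768435210a88764015230ab8764051320c24807635211438763521400be;
  0x146023510746874051320c2763240510887356401204067450123071736240510877640531214b673240510f97406153204c;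
  0x165432100204608735211435764321007d763540210f960743521146765340210fd763240510f9764035210fa;
  0x140235102554321001f04235102505234102940532102545230102904532102540763521144326401507b635210411a5634021134356401207b635214011a;
  0x132045102552043102a3504210254076352113a6402135120064352113c640152313f6405132120654321001c;
  0x134512001a54321001a04351202504532102576403521095654321005f6450123060634512005f453621011e435612011e6532140102;
  0x14876532100e47564321003e7654321003e657423010a66573402109647651302140476523011407465321014c;
  0x154321001813540202523540102525310401f765423010a6653402106b6543210017546021306365413021416542301141354602111d;
  0x12354010254576230114046531201205642301141463512011f54062311236543210031;
  0x1432100143402101543210015465320116b35201401e45021301e35041202b45231002b;
  0x154987632100e258674321003c58764321003c4768532100e35768432100e35762183400d75763182400d754876320112638576124014f;
  0x156340120675876432100e3576340120667564320108d7645321003d647350210926472503109257643201138371264500fb;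
  0x1546873201126534076210f84675320113856743201138574061231165740613211675326140113;
  0x143501201f42350102743250102754763201169465320116a645321007c563214011b562314011b6321450101;
  0x125310401f5476321014c365402111d364502111d563214010356431200315643210031; 0x1;
  0x154329876100c954329786100c9953284761001184769532100c985761094320cf84769352100c9987654321001185764091320cf85764190320cf;
  0x198765240310a297865240310a298524031760c38769542310076876945013207689405276130b489401376520b089524076310b489523176400b0;
  0x1;
  0x141529876300c641529786300c6498761523005184952376100b081529476300b484765293100b7487691523000e84529176300b49841527630156;
  0x154987632100ad54978632100ad953248107600d84769532100b785769410320b784769352100b7894576103210a85769140320b7895476321010a;
  0x16978543210013698754321001359870432160b587953264100ac59871632040b587935264100ac95876410320c459874632010b559876432100b5;
  0x17654321000b98735264100ac64105873205a8735204160a964107852305a8735216040a986410527308a86410735208a8735246010a98735264100a9;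
  0x1403165206740516320674051623067654321000a61304520676430152067463105206761504320676150423067456320100a64501320674651032067645012306746510230675876410320cc53274016058641032750815327610405864105273081641053720815327640105853274610058;
  0x175986410320c456410873208a75328401605376410853208a75328610405376410835208a87564103215a753286401053753284610053;
  0x157986432100b545328610704253287461000c7853264100a98532716400437835264100a9853274610053853274610043587326410145;
  0x1654321000a5874610320d25732041613b753264100a55327160403e735264100a5765432100095327460103e5732641013b;
  0x1654321000625346100744651032067253164007445623010203875264100a8746510320484756230106d7521304607152736410089752430160497524301607173526410146;
  0x146510230675876410320be5324761003a753264100895327016404c73526410089756410321105327046104c573264100fa;
  0x16978543210011698754321001154879632100cd64879532100cd65871094320d564879352100cd946587103215565874091320d565874190320d5;
  0x164987352100cd6410587320574867352100ce4857362100ce6731084520d68736452100128461073520fe6734081520d66734180520d6;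
  0x146587013214f450176320fb460175320fb65741032111460173520fb6571403211165417032113;
  0x154987632100b68675432100108765432100104763285100d35761084320d34765283100d34765382100d35764081320d35764180320d3;
  0x13245601065456321000a52436010655342601065156324000a5874160320d3532741060563275416008253267410059527341600825372416008253267140059573241600f1;
  0x131524000534521000554320101f51324000545102301f54321000534520101f15402301f7653412008e654320106864510230686345201068641530213961540230686534120139;
  0x198762354100a486754321000f87654321000f87601453209f87623541009f87654230109f87640521309f87625314009f87652403109f;
  0x15261340006321546007532645100065413260035524316007568752403109f4527310606c7456231004b257431600837136254004b6723540106e2371546008376325410105;
  0x112540302724513001a14523002701254302551243000552410301854231001831452002576235410091654231005d641523006964510231366215403069456230105e6251340136;
  0x141025301a54321000454132002531542000445310202553204101a3145200251354020257654132002f436102502351632040231564023023645310202c3465201023654132002c;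
  0x1697854321000e698754321000e53879640120c864879532100c853879460120c864879352100c8965387401215856873291400ba9564873210158;
  0x164987352100c864105873205247352861009a6857340210a167352841009a6873540120398654073120ff6735281400bb86473521015f;
  0x164501230656875312400d87640531208c6407123505c7460531208c6407125305c674053121336407532103d76532140104;
  0x156432100355876012430a057640123070675321040707345601203b7436521003b756043121064352607108476523410106;
  0x156983271400ba65324871003f5864071320bb6853271400bb5846071320bb6835271400bb68540713210f6583240710f458632714010f;
  0x16873152400d776524031092675423100617452603109264057312041674013521006540713211676523140111;
  0x165487321010d53764012121647532101215374601212164735210121563271400f6; 0x1;
  0x1675324981005156978132400b275968140320c576958132400b275948160320c576938152400b2697581403215b798165403200d795632814016d;
  0x175984160320d55874160320d67532841060507854160320d67532684100547834160520d687541603215c7532681400547583241600f2;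
  0x176983152400b368752403109d78640521309d68572403109d78460521309d67528401303968740135216e76408523103978652314016e;
  0x1674198523015864187523015f4715286300ff64185723015f6715284300ff76452831010f68471523016c6745281300ff;
  0x1765498321010b564873210112475861032112764853210112675841032112764835210112675814032112;
  0x154987632100af86754321000c87654321000c4768523100ab5768403120ab4765283100c14857630121544765281300c1584763210154;
  0x125346100065876403120ab532710460483756210406f7643521003a527364100877564031214852716430087573264100fd;
  0x141035201a43015201a43125002951234001a53104202953214001a54231001831452002a76345210037631045203463125400346345210036635401203261452300366345210032;
  0x14875261300c15324761004040617532087526174300875273614008575406132115573240610f574526130115;
  0x153214001a54231000545230102745321002976305241093654230106a526301405f6350412062653041203335261401176524130137;
  0x15423100187652403109665423100636450312063452631011f6403152103452613011f6523140103;
  0x1564873210154543276100fd64752310148563274100fd645273101157654321000264527130115;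
  0x131452002a5476231013d465231013f564031213f46352101234615230123;
  0x14876532100aa43725610008437265100086572134003074650213147657413200306574231003074653210147;
  0x13254100045420130293452100045423100297654231003043620150226253401024654201302e6453201024645320102d654231002e;
  0x14312001443210014421300156543210038543210019254013028153402026253401026254310028;
  0x1521340029543210000541320029542310029547632101474263105021562134002e5642310001564132002e564231002e;
  0x1142300152413001542130015465321013e25310401d45310201d45320101d;
  0x1765432100a7362451000736254100076542103142654310214265432011426543210142;
  0x1421300154312001543210015465321014235210401b542130016543120016543210016; 0x1;
  0x174659810321556451087320fe7451086320fe7461085320fe76510843215c7461083520fe76540813215c76541803215c;
  0x1765432981016d586497321015b785432961016d786495321015b785632941016d786493521015b9876543210003785632914016d; 0x1;
  0x1]%positive.
Definition graphs8 : seq positive := [::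
  0x15343323150402010; 0x15242322160403010; 0x17252322160403010; 0x19272523280604010; 0x15452325131402010;
  0x15352324131402010; 0x16564523261403010; 0x16452326141604010; 0x17664523261704010; 0x16472523261604010;
  0x16453523261604010; 0x17564735232614010; 0x18676523221403010; 0x18676625232904010; 0x18676523221904010;
  0x18676545232314010; 0x18676535232414010; 0x18676925232414010; 0x18676625232414010; 0x18676945232914010;
  0x14332413121402010; 0x13241312140302010; 0x13251312140302010; 0x16454323121402010; 0x15453323121402010;
  0x15443323121402010; 0x15343325121402010; 0x15352325131214010; 0x15332513121604010; 0x15332513121403010;
  0x15332513121402010; 0x15352325141214010; 0x16453326151214010; 0x16353326151214010; 0x16553623251214010;
  0x15362325121604010; 0x15362325121403010; 0x15432512150403010; 0x15332512150403010; 0x14332512150403010;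
  0x15232512150403010; 0x14232512150403010; 0x13251412150403010; 0x13251312150403010; 0x15432512160403010;
  0x15332512160403010; 0x14232512160403010; 0x17654325121403010; 0x17642325121403010; 0x13251312160402010;
  0x14352322160504010; 0x14332312160504010; 0x15343326121504010; 0x16543623221504010; 0x16543523221504010;
  0x17643523221504010; 0x16543323121402010; 0x17565823221504010; 0x17565423221504010; 0x17565523221604010;
  0x17565323121804010; 0x17565323121504010; 0x17565323121402010; 0x17565325121804010; 0x17565325121604010;
  0x17565325121402010; 0x17565833281214010; 0x17565328121403010; 0x17565328121402010; 0x17565433221804010;
  0x17565433221402010; 0x17565534332214010; 0x17565536232214010; 0x17565534232214010; 0x17565533221804010;
  0x17565533221604010; 0x17565533221403010; 0x17565746332214010; 0x17565637232214010; 0x18575654332214010;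
  0x18575653231214010; 0x18575653221904010; 0x18575653221604010; 0x18575653221403010; 0x18575653221402010;
  0x17675654332214010; 0x17675653231214010; 0x17675653221804010; 0x17675653221403010; 0x17675653221402010;
  0x18786756532214010; 0x19886756532214010; 0x17565533221402010; 0x16554533221402010; 0x16553326121402010;
  0x16553325121402010; 0x16553423231214010; 0x16553323121704010; 0x16553323121504010; 0x16553323121402010;
  0x17565533241214010; 0x16563533241214010; 0x16553723241214010; 0x16553623241214010; 0x16553523241214010;
  0x16553324121504010; 0x16553324121403010; 0x16553324121402010; 0x17665533271214010; 0x16574533271214010;
  0x16554533271214010; 0x16573533271214010; 0x16553433271214010; 0x16553423271214010; 0x16553327121402010;
  0x16564533221704010; 0x16564533221403010; 0x16564533221402010; 0x19787655332214010; 0x18765745332214010;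
  0x18765645332214010; 0x18795654332214010; 0x18775654332214010; 0x16532513121604010; 0x16532513121504010;
  0x16573327151214010; 0x19787653251214010; 0x18765733251214010; 0x18765327151214010; 0x17675645432302010;
  0x17674645432302010; 0x17664547332402010; 0x17664547232402010; 0x17664546232402010; 0x17664543271402010;
  0x17664543261402010; 0x17664543251402010; 0x17664543231402010; 0x17675645432802010; 0x17665543241302010;
  0x17664543241302010; 0x17654326141302010; 0x17654325141302010; 0x17665543241402010; 0x17654633241402010;
  0x17654533241402010; 0x17654623241402010; 0x17654523241402010; 0x17654326141402010; 0x17654324131402010;
  0x17654324121402010; 0x18676543241802010; 0x17685543241802010; 0x17665543241802010; 0x17664543241802010;
  0x17654326141802010; 0x17665548232412010; 0x17664548232412010; 0x17654638232412010; 0x17654538232412010;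
  0x17654438232412010; 0x17654823261412010; 0x19886765432412010; 0x19876546332412010; 0x19876545332412010;
  0x17664543231302010; 0x17654324131302010; 0x17654323121302010; 0x17684543231802010; 0x17664543231802010;
  0x17654833231802010; 0x17654433231802010; 0x19876645432312010; 0x17664549232802010; 0x17654923241803010;
  0x17654923221803010; 0x17665549232804010; 0x17654639232804010; 0x17654926232804010; 0x17654925232804010;
  0x17654923261804010; 0x17654923251804010; 0x17654939232818010; 0x19676544232802010; 0x17695544232802010;
  0x17665544232802010; 0x17694544232802010; 0x17664544232802010; 0x17654934232802010; 0x17654634232802010;
  0x17654534232802010; 0x17654423261802010; 0x17654423251802010; 0x17654423241802010; 0x17654423231802010;
  0x17654634232908010; 0x17654534232908010; 0x17654624232908010; 0x17654423261908010; 0x17654423231908010;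
  0x17654423221908010; 0x19676544232818010; 0x17654934232818010; 0x17654634232818010; 0x17654534232818010;
  0x17654924232818010; 0x17654624232818010; 0x19676545242328010; 0x17664545242328010; 0x17654635242328010;
  0x17654435242328010; 0x17654524232818010; 0x17654524232618010; 0x17654524232908010; 0x17654524232806010;
  0x17654524232804010; 0x17654524232803010; 0x17694543221802010; 0x17664543221802010; 0x17654433221802010;
  0x17654324121802010; 0x17694543231218010; 0x17684543231218010; 0x17664543231218010; 0x17654823231218010;
  0x17654423231218010; 0x17654323121908010; 0x17654323121804010; 0x17654323121802010; 0x17694543291218010;
  0x17664543291218010; 0x17654933291218010; 0x17654833291218010; 0x17654433291218010; 0x17654329121804010;
  0x17654329121803010; 0x17654329121802010; 0x19876645432302010; 0x19876544232302010; 0x19876543241302010;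
  0x19876543221302010; 0x17574543260302010; 0x18474543260302010; 0x17454433260402010; 0x17454823260402010;
  0x17454523260402010; 0x17454423260402010; 0x17454328160402010; 0x17454326160402010; 0x17454325160402010;
  0x17454323160402010; 0x17574543260502010; 0x17454327160502010; 0x17454324160502010; 0x17574543280602010;
  0x17454324180602010; 0x17454433260302010; 0x15453433260302010; 0x15443523260302010; 0x15443423260302010;
  0x15453433270602010; 0x15443325170602010; 0x15443324170602010; 0x18454723260302010; 0x17454723260302010;
  0x15443723260302010; 0x19454723280602010; 0x15492723280602010; 0x15472324180602010; 0x15472322180602010;
  0x18554423270602010; 0x18454423270602010; 0x15453423270602010; 0x15443423270602010; 0x15482423270602010;
  0x15452423270602010; 0x15442325170602010; 0x15442324170602010; 0x17454423221602010; 0x16454423221602010;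
  0x15473423221602010; 0x15463423221602010; 0x15453423221602010; 0x15443423221602010; 0x15442327121602010;
  0x15442326121602010; 0x15442325121602010; 0x15442324121602010; 0x15442323121602010; 0x15442322170602010;
  0x15442322160502010; 0x15442322160402010; 0x18454327160302010; 0x15442327160302010; 0x15432817160302010;
  0x19654327180602010; 0x18654327180602010; 0x19454327180602010; 0x16454327180602010; 0x15443327180602010;
  0x15432917180602010; 0x15432716180602010; 0x15432714180602010; 0x15432712180602010; 0x17654324160302010;
  0x17554324160302010; 0x16554324160302010; 0x17454324160302010; 0x16454324160302010; 0x15472324160302010;
  0x15452324160302010; 0x15442324160302010; 0x15432714160302010; 0x15432514160302010; 0x17654323160302010;
  0x17454323160302010; 0x16454323160302010; 0x15473323160302010; 0x15463323160302010; 0x15443323160302010;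
  0x15432713160302010; 0x15432413160302010; 0x15432312160302010; 0x18654323170602010; 0x17654323170602010;
  0x18454323170602010; 0x16454323170602010; 0x15463323170602010; 0x15443323170602010; 0x15432813170602010;
  0x15432613170602010; 0x15432413170602010; 0x15432312170602010; 0x19854323170602010; 0x15493823270603010;
  0x15483823270603010; 0x15443823270603010; 0x15482329170603010; 0x15482328170603010; 0x15482324170603010;
  0x15482322170603010; 0x15483823290706010; 0x15482324190706010; 0x15482323190706010; 0x15482322190706010;
  0x15493423280706010; 0x15453423280706010; 0x15492423280706010; 0x15452423280706010; 0x15442329180706010;
  0x15442323180706010; 0x15442322180706010; 0x19654328180706010; 0x15492328180706010; 0x15462328180706010;
  0x15442328180706010; 0x15432918180706010; 0x15432816180706010; 0x15432812180706010; 0x18754326160302010;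
  0x17454326160302010; 0x15432716160302010; 0x15432614160302010; 0x15432612160302010; 0x17252322180604010;
  0x19474543280602010; 0x18454433270602010]%positive.
Definition weights8 : seq positive := [::
  0x100c3033300f0c3048cb40f30a08717018f20; 0x41920483330711c3300cc8c4c0f4788f0023;
  0x1024ce400910c8f00fd20c2430943d463974; 0x103cc0303c30c3c03c0c03030cc3f0c003f;
  0x1020d459300a58a30c024db1211c38b30e51; 0x1806405088d2d4d022105cbf088588de48a;
  0x624074000c62cd8202f04d273017369fc0; 0x7000c00ccf030f03003f3030fc03c0f0f; 0x133000cc303f00303cc30c03cf0c00f0cf;
  0x7003000cfc3c03030330333c3c30cccc3; 0x1c3000033c0ccc30c033300f33f300f33; 0x103c0c0c33300c3330f03c0033ccf0c0f;
  0x407211d117f01213520c790be08f29711; 0x7420306334d13008c13ce1d08f17a3806; 0x160608dc830c41c7403792f508398e945;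
  0x680254103c32cc0a0314cfc833cff300; 0x608264081c0f434486d3d1c83b5ce33; 0x1c036006c8371008b3c715672f608dc2;
  0x1930202087543833010b36c25c1fc97a1; 0x193208e6551210e692c0c17d38e344c2; 0x1000f0c3030cf0c0cc03c30c300f3c0f0cc0;
  0x100c300f030f0c30330cc00f33030cf0f00c; 0x102c401e00cd8c3003d22439c486a1713238;
  0x7000d0020b3c27400c34ac5b1700ef20e9; 0x11113342023247343801c0f8c10760df3c8; 0x44c20087038c6c4432086b038f00e0d0fc5;
  0x45c0403c053e03808a83030dd7123c10ee1; 0x1002d4317140de4708022659c01c6c8f15b;
  0x16090013704563710350395cd0f32320b32; 0x106420234234e7033001b054f432813e3d08;
  0x403c080d072c43a00d04cccc9108cf23b30; 0x1801c3004cc0db8015706330b08dc68cd98;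
  0x120a011365033c810390f43346cc300e30f; 0x4121a03470286a0c0c9c0321c5b052d0d76;
  0x1141cc1800b23383063088c1a240f30ceb4; 0x108340348cd322408673100cec390864c2f;
  0x4300d17009984e54c4230572a0549377c70; 0x6202048412398cc0432137673030b63c330;
  0x10828084c12df08321030d17348c822ecd02; 0x4311604908227c838103348b4036a47e660;
  0x1090c0079608dc2220818e0cdc301cca03d8; 0x1006301380b76c0a045c0093e0521fc780f0;
  0x105070c60234b820333408279423e01d17c8; 0x115120324039d35303034458f027928a7881;
  0x44c2003380e5c1908c486330ce0a8313323; 0x1830101c027cc0e020b18243ec0c6cc83c30;
  0x1800d00c4c336c2400e0cc4ce0e318f0d308; 0x1894020800f73074840330cec8cdbf3300; 0x42208d140cd30b00a80f30716d06ccfc08;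
  0x108a00474871362043878071dc31230cc0ec; 0x54a0000b8307d3143040e523d70a0d38332;
  0x480371800424f2c1321c234b003b1272de0; 0x1b040020a404f6700c520c8db24ed2c0fc0; 0x680810061572e2430122874db20f033ce4;
  0x102223414d80f0c802924f032844ccc8cec; 0x12052c0c02233c83300823cc2c03fcf350; 0x4030c303cc0f0000cc0cf0cc0cc0cf03cf;
  0x189050304a1c74c04ed13228c318c25ecc; 0x4003cb43211e12208b105d8904c71c3be4; 0x4117019bc02cc12c04669012c1f08cc9ce;
  0x12064b0443174a12881e7200b457f213e; 0x1120941d844e48c1835903e05321d20ef6; 0x4090c0791d3c2405d03623612911b923d;
  0x10c3204c0d30cc221de300308b4c4b30fc; 0x50830428b7c001e114343f12280ccd34f2; 0x4087030c39c94148c493360911d267513e;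
  0x18340251e00fc08c10fc2205b9a748cf0; 0x40e14171a18c508781e8700473a33163d; 0x42822610f0435306c630d801e0cf813f8;
  0x140c8c227021c434717348802f2c37333; 0x4030c3300fcc300cc0cc0ccc3300cc33f; 0x100cc4830cb3304618c80cc4c517322e4f;
  0x121c0270190f2450724ccc10a870b4c2cf; 0x101b000fe11c85463041e34280e34c88fd; 0x403c222d203d047030ccf005136c0dece;
  0x10270c48c01e41a02733c91080ccc9339e; 0x50a400b1c88740c218273988213a24cc79; 0x154120c838e0cc08c3000ec3237cccf34;
  0x544c083386311320c8421cc713cc3dd4d; 0x10cc0cc00f3300c0cccc03030cc3cc3cf; 0x1003ccc03333300033333c03303c00cff;
  0x1807154f31a008809329c03f08db009fc; 0x5425062c8c300b008ccb3089f304c4cfc; 0x43030f030c3c0c030c3c3330c0cf03f30;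
  0x40f000fcc00fc00c0c0f330f033033ccc; 0x40f00c30cc3c3030c0f0c300f330f3cc; 0x40c303c30fc000cc30f033c00fcccccc;
  0x45940cc838308c03e24ca033316ccd3c; 0x101e003c39f0050a503303d20a2f3433c; 0x103033c00fcc00c03c3c3c3003cfc30f0;
  0x4cc003ccc30cc000fc33cc0cf033f300; 0x130c0f0c3c0330f0c0cc0cccc3330ccc; 0x102d043808c3f1040bc80cc1c4638317fc;
  0x54d0003202fcc140c80d4f30b84cc3132b; 0x4820902c480fe0624108331f00fc04eecc; 0x130510330096dd1448805f02e0d67852d71;
  0x50b0005ccc06c651090b09f0886f0866dc; 0x1500d30824826d801ad11c94c2787419cf; 0x1018c74054924cd4038c2f1420d06e32333;
  0x4294008a0f01e840e103d906b301b48c3e; 0x405c6850280fc200d887cc843041f5a6f; 0x740800308c0fd304024de02f18e3331a7;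
  0x702044083c0ef1042324d10de4dcd46cb; 0x1423031403c328c4487803c350ec05db1f; 0x1a00801c3106cac4210249f5302fcc0cfc;
  0x6300402296123b03104b0687887a931c0f; 0x5191003206d97201313312a0f814e4c36d; 0x18160008b248d0b01310b33d45c53b447b;
  0x4021f900f30108c6c81cf210033c72c3e; 0x644813001f3148f100803da708f9ce6c1; 0x121c0360028c34704e0d0f884d2c48338f;
  0x1e0010c148b403b510240eb5c2d78c9665; 0x112488312113b032884c44c78c135c2dec; 0x1030c03c06c9f00945a00e01e88c8c5cf6;
  0x1130885800cf14706c1d12c13139e07b26; 0x70091080765b11b002109db3089dceb55; 0x60c04070360fc20082c92d3173348323c3;
  0x190c00088d64d380820d538c38a39d06a6; 0x182804c5738cc04e4374368ad32c2390; 0x60a0138c402d230079cc53cc8d9326d2;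
  0x78040a50308b11cc0673398d2ccc39e0; 0x13030f0f0003cc03c0f00f30fc00cfcc; 0x430c0c30cf300c0cc0cf0cf030330cfc;
  0x104474231c528d138103c83135c450ba27c; 0x10d11028a1c30365430a4512b02d7c45cc7; 0x40c33180609c87093b107008d84e033f83;
  0x555120c38bc20cc803b0f0ce719c3304; 0x104b0919989410df012c1983cde084f23; 0x184606c0340b0cc2224cc9b0cb10c9a742;
  0x10c30330f0030f003c0fc0f00c3033cf3; 0x1c03000cf0cc0f03000fcc33033f33c03; 0x10c303308a4530c03e3140cc8cf0825e3c;
  0x40228c61c8f3000c9a1584c1730c1c388f; 0x1cc000034e80f0712033122e5369b4b04a4; 0x11107c0cb0843a00b708308c84bc037e74;
  0x5116002f3047620c803c2f082889d30d33; 0x14545c080cc8c892030f26c0230df33c13; 0x101c200f8d0c72027012d74902dd2306e3;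
  0x1c3000c03f0f0000c3ccc3033f0cf00cf; 0x1420c494709c43203512e8b400baa1d7d; 0x71050018338ce51044cc137a1d27dc332;
  0x420a0834364371060f0c045f3c1230f9b; 0x1880221401b731915148c84e6d83b2fc4; 0x40c9120e34174c111d0be028073c2978e;
  0x431801688718d14c0e4c1083dd5b04fb8; 0x54c1380020e417c05c59338c187b4fe08; 0x1244580a10cc2f0243340e10bc471cfb0c;
  0x10330c0308d4b03231903703831f88ac32; 0x1001e882b0483077110d8b244036cd93b8; 0x100365c160c493800f351d89026e2624f5;
  0x100721352494ec030980dc432338d31778; 0x107242c12326c40e421330236d788f165; 0x186101c843702e00acc5cc37940dc0b2d;
  0x1521423032c9284c1558cc803b4a5f56c; 0x701200c60ec0f40909c1f45999380f392; 0x46063c002c1ccc036b023089c30f433c7;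
  0x13408a50036837013982ca033c063b735; 0x4a0223130434dc04e4cc3830ccc0c8f0f; 0x1280920c4954b12270d281323721ccbc3;
  0x1b40200830153f23040cec3a0cf73cc30; 0x44384233025cc521c7403d303e1350bca; 0x424629145c6300f0c5d01e048da5974b9;
  0x1894228524d610b7876861c834b71d80; 0x122803f4a8170c0c3841b6038b5f301a; 0x10757412ccd30186603e07927c3808e5;
  0x1901801630bc0780d00e06f0c0fe1b913; 0x4084c23478079801b202b42564de1563e; 0x103300c300ff00c00f0f0c30c3cf00ff0;
  0x1309093048c33c09921c61cc32333cc2c; 0x107200f0c30bc012c43f210a20756990f; 0x7c000c003330cf30030fc03ccfc3c3300;
  0x40a804b2d00f8073012d83242733c0f32; 0x103c30f0cf02208c3283c555c323c38c; 0x14740e24cc0d00e57c580279340c1e373;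
  0x4b060a1901b9890894d2c02b24b74678; 0x155820c2cb030298183b0724c9c13363c; 0x4720cc470e20cc233124cc00cec833c7;
  0x4cc10e30a41d5903e08828c089b4711f; 0x1c03030c3030cc03cf003cc30ccf0c03f; 0x1228930431e218cc40a07c033332cc333;
  0x601d03b44994d0c332188c330c1cb3c3; 0x4c0cc330003f030333c0330c3cc33c33; 0x1cc0333cc300f3ccc303cc30c0c0333;
  0x10b4027d81c2b411d0d088a1c8d5e70c8; 0x12610cc702f0a090c32630624c3ad30f0; 0x4d110c3900d560c8d0c8f40cdc807be81;
  0x52300e1d620c2c30c05e2c530c0eac0b5; 0x107820d08a810c32347a3408235c33903e; 0x103384db00d20f252360095e820463f56;
  0x503881830c1f00cc88ac4c0d03f2838dc; 0x49843210888c4a6700724e1c08f6f3089; 0x48528311302a290f02578090cc2f9391d;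
  0x614840303c96683043c209c8f0f3c3c21; 0x10a5009cc1b11077443c0d2329c4e4f032; 0x616043000f52d48d00f0b243a1ff03c21;
  0x6c04701231977003296c5502f8ef1033; 0x430c8d1c803c1d5d128270b034c0bc77; 0x1432134d2460cd18d34263030b04e363d;
  0x60a00d24ca347031854b8330790b9c33; 0x4a14990821730e49429c4c2c3d216d8a; 0x1083532c300f222331194c1b0c303f2f0;
  0x4395228c08b3318c95038b1362c323c; 0x43c33033300f0c3c3300fc330f0033c; 0x1303822c0006dd13c33c1c4a183cf683;
  0x1138c152600c1c94e35c22d136c1a887; 0x1c0cc0c3030f0c0cfc0f003f00c330cf; 0x424de010e800a19a4f603415b8cc11df;
  0x112ce4008dc3288ccb100e04ff033c1a; 0x16811904c46130ec20707e202b1cf2935; 0x451c0a830a33051d4e041e75243c1f2b;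
  0x43c00f0c0c00cf0f00f0c33f00f0f033; 0x1cc03000f00cc3c0cf03ccc0f303c3c3; 0x70303000f0f0c300cf0c3300cf33c3c3;
  0x43900f342093b403c1173468349d43b3; 0x103c0c330c0c0c3cc0cc303c030f3303f; 0x442c4b030238c83c0c0831c23d39307e8;
  0x18a003401b0a886131e090bb4b4a354a3; 0x430ccc0ccc0ccc0f300c3303c0fcc0c3; 0x1300c33030c3330c30c0ccc0c3333cc3c;
  0x102d04b030c3f0088b0c11d705cc91bcb; 0x4a112280340a94c57448ce1d523833f30; 0x10330cc3cc300cfc030c3cc300cc0fc3;
  0x550c02e0c14792074b3266d844c0fc33; 0x73000c00f0330cc300fc0f3c3c0c3c3c; 0x132406c003e14c293187813b0c3c1d286;
  0x1022831a0a04f4133075cc324c3342f0b; 0x5560074862f082432317168dcc9223c3; 0x1089409c82993118d14a1170da9720cdb;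
  0x1030c30c0f0cf000cf0cc0c3c330330fc; 0x56526892309808e81c0f6484a30d2723; 0x7180128dc0d80307b2883c8a601f80e3;
  0x4b18a344346309643807b085b024e9a8; 0x5c50a484e434a4037c0728d76154b0b8; 0x53804a33300d4a03621d4d8f02730c8b;
  0x190c28242298807323330721cd1c83723; 0x170844d08d0f149060bc84ca1a831ed34; 0x10784d44b29420d0cc660210f99c3217d;
  0x185809cd30e018cd80fb40704b8c3383; 0x418d26380f11b0303690b53a9123c1d1; 0x175004be00dc30d0b0e3310b3294fc48;
  0x103c186e117430c4d670990ff01c9262; 0x4c030c3c00c0cf0c303330cc0f3c3303c; 0x1030c03f0c30cc0c300333c30c330fc0c3;
  0x1030345689067301654e208c2c220740f47c; 0x1213030e802830d24d303b063300c570bcc;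
  0x4e040624c01983e088018a72871a57cc80c; 0x10321e040901e4b453231393002707b97016;
  0x42820d2c0c0681c4e3c312360e04c243ce; 0x4201c393c01093803db0c3408f1b0087ce; 0x1131480ac02160f21302e2624343713cc26;
  0x1105302d80e0bc0e4002130fc2443b7331c; 0x4030c33d80338432410bc0b052b4cd0b0e; 0x4084d233233104ac4088c43c463f32402f;
  0x181031480cec2c1403a40d9328c84f09d23; 0x40330f330033303c0c03cc0330c0333fc; 0x421c07824d0d343429001bc2123374328f;
  0x1903001330b903c4c04c02db20e27cd6407; 0x461080b10c8dd800d82313663c01836c1ca;
  0x6004c1c0330f830220c1b04f4393c32c303; 0x4470523010f0c8c82253061f074079ce303; 0x403338400c4ed20933900432c6087c3ccc;
  0x600a0c40cc483d4492c1243a4332f0a05f; 0x134200784081ef038400c81fc3c030f8c4e; 0x104c90b10ac15700e4cc8c78064c2284eb;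
  0x411a123c80806d70c0608f0d02cd4ad1a6; 0x108c1c481804e27882034d07c04ce6cf809; 0x170802cc18e2435043b30b0a03418cd30f;
  0x1c24105278c8281049ccc5c409bc32481ce; 0x70450068c704b0cc02a123c330f24d142f; 0x120370c0400f3833902232240c31e3c74c3;
  0x700c1140788f3400cb41ceb1243c4d04f8; 0x1420c038cccc0d0556600e3c808f010f0f3; 0x1c804030331330e00c3c130f2c25bc18323;
  0x108280d2c3040ec02d3c01cd1cc0cc00cfe; 0x40c39300a17030c33cc0c0c222c1519c4db;
  0x4240d59308013cc2343c4cc80e0b0236137; 0x108311233c034834e0c0900db136c80d63d;
  0x705101206c1e39210244313e942d731b530; 0x104b00c33188cc400fa2240783c3c04d13b;
  0x4448812c380fc4154294303746b80711d39; 0x4c0c108e001ccf1530085c8cca23ca1f30; 0x100c351c0b039c110c8cec09492058f3476;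
  0x11470843108723303c0922c74612330f638; 0x12154183208303b03c02227b03302d0f4dc;
  0x1502840da00722794403308e60c2f835e90; 0x1023181c0703cc2013b0e113834780d4e3c;
  0x408c418cd08c09c82251f00f03c1dd02d38; 0x40a8020d8704cb0132319381923b0612726;
  0x12130030c0d0fe004e0618d0e349c887c23; 0x40660c2619102cc0cd4d234c0e43180e1f8;
  0x140381c041ec83200c9b08c7190cc52cc91c; 0x1007200cec14c95cc000c8d33048ce71c988;
  0x64c040c4242e1d4070b33cc8c1b5360a3; 0x50a4350108430fc02e0d8236025de4bc1c; 0x100b70c0150f2a040ee04b120e47320e97;
  0x70c108831b4e10581734888bc3746c80d; 0x43300ce0a58038330c0f0cc3308b0538f; 0x4c302d420ba234403284d30e0c31e890f;
  0x128830310018b5dc1840779009f32cf549; 0x1486308030133c3488c8887201c7c7cc36; 0x190680812ce30c1380c0f22017b4c862e5;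
  0x103180a8a938045633201318d4d0c34b3b; 0x7441c000530cb8c03680b98c0333c27a34; 0x457003302c8cb01c282002f2c30707d0f3;
  0x1301804b81340f80b43030c360ff00dce2; 0x100ccc125105dd84652498ca011cde992d; 0x780040840d2acd4006c4c3338cdd4f0c29;
  0x423110c823196c314502129cd060f9cf0d; 0x1108c120f4481b2c12020ce74090bf070ad; 0x6402600851f08ccc102c037b0883df3303;
  0x10d02c08406c0bd8700490c9e010fc8ff80; 0x444a060309b458b0600212ee0c0921f3f41; 0x410ca1604317c6308640488dc0733a87c3;
  0x5908000b04eccc608420171fa444f83a3c; 0x1100e03c8c04f841d1137901c1bc2712da; 0x1300300f033c3300f000f0cf0f003c3f0c;
  0x4120e04c34322d04384b45d20360f0cc8f; 0x100c38702086f02c2400f909c043cb3cd13; 0x100f0c211091ccc003f300f3024f0438a8d;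
  0x440d4249983043e0c104a2b602833355b88; 0x6014b00520e00fc0710b47c90627687b09; 0x100a2032703246c885043c3560706e270b3;
  0x4c3000f00303c3c00f00ccfc3300c33333; 0x101381ca1c4335033355098b13c00a898f; 0x121902c41333032438880e45cc8d2dc54b;
  0x11075074702a8306c0350e8824dc3c0c5f; 0x58093008121f4988c0290cb60c0d3cda2c; 0x110c88070cc327040e702318c90c7818a3d;
  0x181c00070e46e30082c30603e3c3c446333; 0x4c03630080d12cc360c9cc1490e09a2ccd; 0x403c120ec01c43b024306c3c00b9c4d32e;
  0x1c00c051324ce0d0600f12cb190f43a250b; 0x4414c84c38433c108d0c2cc30e070c5c3f; 0x421e1c8813d03603d5e4c36031501c8e3;
  0x100f6563088c32418ccc080d04b1f061f3; 0x1714302183010cfd102ec5422ccccd21f0; 0x4c03a08042233d03c303c3491532e0cc33;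
  0x4932d005223c36820c3828c0531f90cdc; 0x1f002011204f2334223dcb034a5cc43223; 0x1180c1e00e0dc8488a042ddc0d40f03c2f;
  0x7402060831308f4035c8dd20a7350199b2; 0x13c03c00c0ccc3c0c330c000fc3303f33; 0x50c85271880b083394c0db02308213c7f;
  0x4d086c00c5a55c81414ec86211f3918d7; 0x121904e253320348c4311c78c060f020ff; 0x63401c1330cca00b4406f30065cc30b37;
  0x10c3048cf0143192c44e00f24c489321b7; 0x10c3c303033c033330030cc03c30c33f03; 0x10f0003c3c0c3c03300f00cfc00c3330f3;
  0x40e4ccc600cc3192c8c05d4501c1383bf; 0x18700070338c0c32201b038f9041f30ccf; 0x420a1742c43030ea010c13713092f230f3;
  0x1330b40c070b2c5380f12110721b4f374; 0x1330f0030c0f0f00fc03c0c030330c33f; 0x4744288b018047a220cf3418134ccb16b;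
  0x4330c0cf0000c3c33c30e1c4260138bf1; 0x60a0701b2c09208da9330015b0c21d27b; 0x438403f60000de0cc2702c303300cff07;
  0x10d2822064308cc0b70c330430740cefc3; 0x100f00c3f0c00330033c3c0f0f3c0c33c; 0x4027009f0d0b2430c0c18c0f0c5d8c337;
  0x100c648c830d438c09603249908cd6c73a; 0x421630035403e1c03c2d431d20711b839b; 0x400f000fcc03f030c0303303c0cf30cc3c;
  0x400f0cccc00cc3303033cc0c003c300fcf0; 0x100f0c3c33030cccc00cc03c0f003c0fc3; 0x40c30c3c300f0c30cc00c3c30f0c00fc3c]%positive.
Definition leaf_graphs : seq positive := [::
  0x1a072625232414010; 0x1a372625232414010; 0x1a872625232414010; 0x1a172523280604010; 0x1a272523280604010;
  0x1a372523280604010; 0x1a972523280604010]%positive.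
Definition leaf_weights : seq positive := [::
  0x200c108301028b0002020186412c00c00800034004404c20030c00030110580080036c30c04c86;
  0x5b000c06600018c06000d86818400040130030406c16000430a40c00230d81b86015000c00c34;
  0xc1820020060121a2030036006810402820030010c26080c260200301821860060304804260a4;
  0x2220300300a0882480424436180000400800c004a4116000c00c30110c06c00902194080182c84;
  0xb069080431001170781030146001240c0032200604019e0061802c36303285590c20c002812b0f1;
  0x220900030030190490030130000db0400410580000986d800000061b0000000184d849a0186402;
  0x45006206031084d080060350c3048228d400c00c01b60150c4000c34011c809890000301911b0]%positive.
Definition leaf_children : seq positive := [::
  0x1a8976543210002a9876543210002a9865347210001a9875346210001a9876345210001a9876513204000a9876543210001a9876543201000a9876543210000;
  0x1a9876543210006a9674513280003a9856347210005a9874513260003a9876345210005a9876513240003a9876543210005a9876543210004a9876543210003]%positive.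
Definition spread_graphs : seq positive := [::
  0x1a4a3a1a072625232414010; 0x1a5a3a1a072625232414010; 0x1a8a3a1a072625232414010; 0x1a8a4a1a072625232414010;
  0x1a9a8a1a072625232414010; 0x1a6a5a3a072625232414010; 0x1a8a5a3a072625232414010; 0x1a9a8a3a072625232414010;
  0x1a7a6a5a372625232414010; 0x1a8a6a5a372625232414010; 0x1a9a8a5a372625232414010; 0x1a4a3a2a172523280604010;
  0x1a5a3a2a172523280604010; 0x1a9a3a2a172523280604010; 0x1a6a4a2a172523280604010; 0x1a9a4a2a172523280604010;
  0x1a5a4a3a172523280604010; 0x1a6a4a3a172523280604010; 0x1a9a4a3a172523280604010; 0x1a7a5a3a172523280604010;
  0x1a9a5a3a172523280604010; 0x1a8a6a4a172523280604010; 0x1a9a6a4a172523280604010; 0x1a7a5a3a272523280604010;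
  0x1a9a5a3a272523280604010; 0x1a9a7a5a372523280604010]%positive.
Definition spread_weights : seq positive := [::
  0x1cc300f30000330030cf303000c3333c30c30c0ccf0; 0x472e127840c0908100f60c10043b02c31b03c3884e4;
  0x160dac73900053006222640e40c9432330870403f13; 0x4f03cc30c000f0000fc30c0c03c03cc330030cc0cf;
  0x730333c0c030030f0033c3030c0c3330300cf03c30; 0x760816f60003041189307d02030c33c32184b2cc189;
  0x130fc0fc0c010280433c0c5049c9240f10871dc1393; 0x4cfc0f4d400231b031c0f2001803c4f00f01c840db;
  0x1e1024f0030c0341686172340c43c0230103f8c23d0; 0x487f1b80c17005605182a05106c83293000cb07a78;
  0x133f0f540c5c04c00ccf14c1030cf0340c30cc0333; 0x190e5c2c2808030716304c4331000db00cc3305ec830;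
  0x70330ff00000c03ccfc000300ccf03f0030c300c303; 0x4e46ccd80c4880330c1f03080113892c08033c42907;
  0x6344cb3090480711080b3805f0480c9d048c0034f370; 0x166d443c40e0c3230f0130a0410c0cc04036c5f03803;
  0x7511b9c02414c1c6248133c320012724020e0cc2d39; 0x4f03ccc84384008031c3315c4c2300a0038cd00f333;
  0x10fcf0f045810223300b3421130b8000c33c2343073; 0x703c33d008c509013308734418c20e0603733486231;
  0x13ccc3f21048014c4f00f3000c064e440877e089330; 0x4cc303f0c00030cf000c300f0c33033ccc000cc003f;
  0x163e13cd2000f9024300fc80000dcc0c037094cb234; 0x10f33c3030003c300f00c0300cccc033cc03300c03f;
  0x13c4e8730004516a108b2030300cc3c80360844387c; 0x172812c474c0c0231809330d0c20842042c32e09227]%positive.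
Definition spread_children : seq positive := [::
  0x1a985374621000aa986374521000aa987364521000aa8937645210009a9837645210009a9865317204007a9875316204007a8953716204006a9853716204006a9876315204007a8963715204006a9863715204006a8973615204006a9873615204006a9837615204005a986574321000aa987564321000aa8957643210009a9857643210009a987654321000aa8967543210009a9867543210009a8976543210009a9876543210009a9876543210008a9876513204007a8965713204006a9865713204006a8975613204006a9875613204006a9857613204005a8976513204006a9876513204006a9867513204005a9876513204005a9865347201007a9875346201007a8953746201006a9853746201006a9876345201007a8963745201006a9863745201006a8973645201006a9873645201006a9837645201005a9876503241004a8965307241002a9865307241002a8975306241002a9875306241002a9853706241001a8976305241002a9876305241002a9863705241001a9873605241001a9876543201007a8965743201006a9865743201006a8975643201006a9875643201006a9857643201005a8976543201006a9876543201006a9867543201005a9876543201005a8976503241002a9876503241002a9865703241001a9875603241001a9876503241001a9865347210007a9875346210007a8953746210006a9853746210006a9876345210007a8963745210006a9863745210006a8973645210006a9873645210006a9837645210005a9876513240004a8965317240002a9865317240002a8975316240002a9875316240002a9853716240001a8976315240002a9876315240002a9863715240001a9873615240001a9876543210007a8965743210006a9865743210006a8975643210006a9875643210006a9857643210005a8976543210006a9876543210006a9867543210005a9876543210005a8976513240002a9876513240002a9865713240001a9875613240001a9876513240001a9876543210004a8965347210002a9865347210002a8975346210002a9875346210002a9853746210001a8976345210002a9876345210002a9863745210001a9873645210001a8976543210003a9876543210003a9865347210000a9875346210000a9876345210000a8976543210002a9876543210002a9865743210001a9875643210001a9876543210001a9876543210000;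
  0x1a9451387260012a9634715280014a9471385260012a9834715260014a9431785260010a9651387240012a9178563240016a9851367240012a9158367240011a9671385240012a9836715240014a9631785240010a9871365240012a9178365240011a9831765240010a9654713280014a9471583260012a9854713260014a9451783260010a9674513280014a9876543210019a9674513280013a9874513260014a9471583260010a9874513260013a9671583240012a9856713240014a9651783240010a9871563240012a9178563240011a9851763240010a9876513240014a9671583240010a9876513240013a9871563240010a965431728000da947158326000fa985431726000da945138726000ba967431528000da9836745210018a963471528000ca987431526000da947138526000ba983471526000ca967158324000fa985631724000da965138724000ba987156324000fa917856324000ea985136724000ba987631524000da967138524000ba983671524000ca987136524000ba967451328000da9856743210018a965471328000ca987451326000da947158326000ba985471326000ca9876543210018a967451328000ca9876543210017a987451326000ca987651324000da967158324000ba985671324000ca987156324000ba987651324000ca9654387210012a9478563210016a9854367210012a9458367210011a9674385210012a9836745210014a9634785210010a9874365210012a9478365210011a9834765210010a9678543210016a9856347210012a9658347210011a9876543210016a9876543210015a9856347210011a9876345210012a9678345210011a9836745210010a9876345210011a9674583210012a9856743210014a9654783210010a9874563210012a9478563210011a9854763210010a9876543210014a9674583210010a9876543210013a9874563210010a9876543210012a9678543210011a9856743210010a9876543210011a9876543210010a967458321000fa985634721000da965438721000ba987456321000fa947856321000ea985436721000ba987634521000da967438521000ba983674521000ca987436521000ba987654321000fa967854321000ea985634721000ba987654321000ea987634521000ba987654321000da967458321000ba985674321000ca987456321000ba987654321000ca987654321000b]%positive.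

(** * Evaluation of the catalogue *)

Definition catalogue m := map graph_of (nth [::] [:: graphs0; graphs1; graphs2; graphs3; graphs4; graphs5; graphs6; graphs7; graphs8] m).
Definition children m := map (unpack 4) (nth [::] [:: children0; children1; children2; children3; children4; children5; children6; children7] m).
Definition weights m := nth [::] [:: weights0; weights1; weights2; weights3; weights4; weights5; weights6] m.
(** The five graphs with seven missing pairs on ten vertices for which no packing in the list covers
    everything. *)
Definition stubborn := drop 160 (catalogue 7).

Lemma catalogue_complete m : m < 7 -> complete_step 10 10 (catalogue m) (catalogue m.+1) (children m).
Proof. by do 7 (case: m => [|m]; first by move=> _; exact_no_check (erefl true)). Qed.

Lemma catalogue_complete8 : complete_step 10 4 (catalogue 7) (catalogue 8) (children 7).
Proof. exact_no_check (erefl true). Qed.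

Definition all_certified n D b h (gs : seq (seq (nat * nat))) ws :=
  (size gs == size ws) && all2 (certified n D b h) gs ws.

Lemma certified_small m : m < 7 -> all_certified 10 6 2 0 (catalogue m) (weights m).
Proof. by do 7 (case: m => [|m]; first by move=> _; exact_no_check (erefl true)). Qed.

Lemma certified7 : all_certified 10 6 2 0 (take 160 (catalogue 7)) weights7.
Proof. exact_no_check (erefl true). Qed.

(** Two of the five need the finer denominator 12. *)
Lemma certified_stubborn : all_certified 10 6 2 2 (take 3 stubborn) near_weights7
  && all_certified 10 12 3 2 (drop 3 stubborn) fine_weights7.
Proof. exact_no_check (erefl true). Qed.

Lemma certified8 : all_certified 10 6 2 2 (catalogue 8) weights8.
Proof. exact_no_check (erefl true). Qed.

Definition hub_label g := find (fun v => 3 < valency 10 g v) (iota 0 10).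

(** Every exceptional graph has a vertex of valency at least 4 and at most two isolated vertices; with all
    valencies at most 4 only two of them are left. *)
Lemma stubborn_shape : all (fun g => [&& framed 10 g, hub_label g < 10, 7 < count (fun v => 0 < valency 10 g v) (iota 0 10)
   & slim 10 4 10 g ==> (g \in take 2 (drop 1 stubborn))]) stubborn.
Proof. exact_no_check (erefl true). Qed.

(** The graphs obtained from these two by adding an eleventh vertex of valency [r] that is not missing to
    the hub. *)
Definition attachments r := flatten [seq [seq (attached 10 g X, 11) | X <- sublists r [seq k <- iota 0 10 | k != hub_label g]]
  | g <- take 2 (drop 1 stubborn)].

Lemma leaves_complete : listed 11 (map graph_of leaf_graphs) (attachments 1) (flatten (map (unpack 4) leaf_children)).
Proof. exact_no_check (erefl true). Qed.

Lemma spreads_complete : listed 11 (map graph_of spread_graphs) (attachments 4) (flatten (map (unpack 4) spread_children)).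
Proof. exact_no_check (erefl true). Qed.

Lemma certified_leaves : all_certified 11 12 3 1 (map graph_of leaf_graphs) leaf_weights.
Proof. exact_no_check (erefl true). Qed.

Lemma certified_spreads : all_certified 11 6 2 8 (map graph_of spread_graphs) spread_weights.
Proof. exact_no_check (erefl true). Qed.

(** * Ten vertices *)

Section Ten.
Variables (T : finType).
Implicit Types (A B N W H : {set T}) (F S C : {set {set T}}).

Lemma degree_lt A F v : v \in A -> degree A F v < #|A|.
Proof. by move=> vA; rewrite -(degree_neighbours F vA) addn1 ltnS leq_addl. Qed.

Lemma catalogue_drawn m A F : m < 8 -> #|A| = 10 -> missing A F = m ->
  exists lab g, g \in catalogue m /\ drawn 10 lab A F g.
Proof.
elim: m A F => [|m IH] A F m8 cA mA.
  have [lab D] := drawn_empty mA; rewrite cA in D.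
  by exists lab, [::]; split.
apply: (catalogue_step (catalogue_complete m8) _ cA mA) => [A' F' cA' mA'|v vA].
  by apply: IH => //; apply: ltnW.
by rewrite ltnW // -cA degree_lt.
Qed.

Lemma catalogue_drawn8 A F : #|A| = 10 -> missing A F = 8 -> {in A, forall v, degree A F v <= 4} ->
  exists lab g, g \in catalogue 8 /\ drawn 10 lab A F g.
Proof.
move=> cA mA dA; apply: (catalogue_step catalogue_complete8 _ cA mA dA) => A' F' cA' mA'.
exact: catalogue_drawn.
Qed.

Lemma stubborn_drawn lab A F g : g \in stubborn -> drawn 10 lab A F g ->
  [/\ framed 10 g, 7 < #|A :\: isolated A F|,
      exists2 a, a \in A & lab a = hub_label g /\ 3 < degree A F a
    & {in A, forall v, degree A F v <= 4} -> g \in take 2 (drop 1 stubborn)].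
Proof.
move=> gs D; have /allP/(_ g gs) /and4P[fr hl cnt sl] := stubborn_shape.
have lp : all (fun e => e.1 != e.2) g by case/andP: fr => /allP lp _; apply/allP => e /lp /and3P[].
have dE v : v \in A -> degree A F v = valency 10 g (lab v) by move=> vA; exact: degree_joined D lp vA.
split=> //.
- apply: leq_trans cnt _; rewrite -sum1_count big_mkcond /=.
  rewrite -(sum_lab (fun k => if 0 < valency 10 g k then 1 else 0) D) -sum1_card big_mkcond [leqRHS]big_mkcond /=.
  apply: leq_sum => v _; rewrite in_setD inE; case: (boolP (v \in A)) => //= vA.
  by rewrite -dE // lt0n; case: (degree A F v == 0).
- have [a aA la] := label_of D hl; exists a => //; split=> //; rewrite dE // la.
  have hh : has (fun v => 3 < valency 10 g v) (iota 0 10) by rewrite has_find size_iota.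
  by have := nth_find 0 hh; rewrite nth_iota //; exact: hl.
move=> dA; apply: (implyP sl); apply/allP => k; rewrite mem_iota => k10.
have [v vA <-] := label_of D k10; by rewrite -dE // dA.
Qed.

Lemma degree_delete A F y a : y \in A -> a \in A -> a != y ->
  degree A F a = degree (A :\ y) F a + ([set y; a] \in F).
Proof.
move=> yA aA ay; rewrite !degree_set //; last by rewrite in_setD1 ay.
rewrite (cardsD1 y) inE yA eq_sym ay /= setUC addnC; congr (_ + _).
by apply: eq_card => u; rewrite !inE; case: (u == y); rewrite //= andbF.
Qed.

Lemma degree_deleteS A F y a : a \in A -> degree (A :\ y) F a <= degree A F a.
Proof.
by move=> aA; apply: subset_leq_card; apply/subsetP => p; rewrite !inE => /andP[/and3P[-> /subsetD1P[-> _] ->] ->].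
Qed.

Lemma listed_drawn n hs xs ds lab A F g w : listed n hs xs ds -> (g, w) \in xs -> drawn n lab A F g ->
  exists lab' h, h \in hs /\ drawn n lab' A F h.
Proof.
move=> ls gx D; have [h [p [hh rn]]] := listed_renames ls gx.
by have [lab' D'] := drawn_renames rn D; exists lab', h.
Qed.

(** The hub of the exceptional graph already has valency 4, so the new vertex cannot be missing to it. *)
Lemma attachment_drawn A F y lab g : y \in A -> g \in stubborn -> drawn 10 lab (A :\ y) F g ->
  {in A, forall v, degree A F v <= 4} ->
  exists lab' g', (g', 11) \in attachments (degree A F y) /\ drawn 11 lab' A F g'.
Proof.
move=> yA gs D dA; have [fr _ [a aB [la da]] g2] := stubborn_drawn gs D.
have aA : a \in A by move: aB; rewrite in_setD1 => /andP[].
have ay : a != y by move: aB; rewrite in_setD1 => /andP[].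
have [lab' [P [D' sz PE]]] := drawn_attach fr D yA; exists lab', (attached 10 g [seq k <- iota 0 10 | P k]); split=> //.
have Pa : P (hub_label g) = false.
  rewrite -la PE //; apply/negbTE/negP => yaF.
  by have := dA a aA; rewrite (degree_delete F yA aA ay) yaF; move: da; clear; lia.
have eX : [seq k <- iota 0 10 | P k] = [seq k <- [seq k <- iota 0 10 | k != hub_label g] | P k].
  rewrite -filter_predI; apply: eq_filter => k /=.
  by case: (k =P hub_label g) => [->|_]; rewrite ?Pa ?andbT.
apply/flattenP; exists [seq (attached 10 g X, 11) | X <- sublists (degree A F y) [seq k <- iota 0 10 | k != hub_label g]].
  apply: (map_f (fun g => [seq (attached 10 g X, 11) | X <- sublists (degree A F y) [seq k <- iota 0 10 | k != hub_label g]])).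
  apply: g2 => v vB; apply: leq_trans (degree_deleteS F y _) (dA v _); by move: vB; rewrite in_setD1 => /andP[].
apply: (map_f (fun X => (attached 10 g X, 11))).
by rewrite -sz eX; exact: filter_sublists.
Qed.

Lemma all_certified_mem n D b h gs ws g : all_certified n D b h gs ws -> g \in gs ->
  exists wd, certified n D b h g wd.
Proof.
case/andP => _; elim: gs ws => // g' gs IH [|w ws] //= /andP[cg cs]; rewrite in_cons => /orP[/eqP ->|gg].
  by exists w.
exact: IH cs gg.
Qed.
End Ten.

Section TenPacks.
Local Open Scope ring_scope.
Variables (R : realFieldType) (T : finType).
Implicit Types (A B N W H : {set T}) (F S C : {set {set T}}) (p q t e : {set T}) (c : {set T} -> R).

Lemma packs_all_certified (n D b h : nat) gs ws lab A F g : all_certified n D b h gs ws -> (0 < D)%N -> g \in gs ->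
  drawn n lab A F g -> exists w : {set T} -> R, packs A F w (h%:R / 2).
Proof. by move=> /all_certified_mem ac D0 /ac[wd cg] Dr; exact: packs_certified Dr D0 cg. Qed.

Lemma packs_le A F (w : {set T} -> R) K K' : packs A F w K -> K <= K' -> packs A F w K'.
Proof. by move=> [h1 h2 h3] KK; split=> //; apply: le_trans KK. Qed.

Lemma packs0_excess A F (w : {set T} -> R) c : packs A F w 0 -> excess A F c <= 0.
Proof.
move=> pw; have [h1 _ _] := pw; apply: le_trans (weak_duality c h1) _.
by rewrite big1 // => p pA; have := packs_exact pw pA; rewrite /coverage => ->; rewrite subrr mul0r.
Qed.

Lemma tame_capped A F c mu : tame A F c mu -> capped A F c (2 * mu).
Proof. by case=> m0 h _; split=> //; apply: mulr_ge0. Qed.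

Lemma ten6 A F : #|A| = 10%N -> (missing A F <= 6)%N -> exists w : {set T} -> R, packs A F w 0.
Proof.
move=> cA mA; have [lab [g [gg D]]] := catalogue_drawn (leq_trans mA (leqnSn 6) : missing A F < 8)%N cA (erefl _).
by have := packs_all_certified (certified_small (mA : missing A F < 7)%N) isT gg D; rewrite mul0r.
Qed.

Lemma ten7_cases A F : #|A| = 10%N -> missing A F = 7%N ->
  (exists w : {set T} -> R, packs A F w 0) \/ exists lab g, g \in stubborn /\ drawn 10 lab A F g.
Proof.
move=> cA mA; have [lab [g [gg D]]] := catalogue_drawn (isT : 7 < 8)%N cA mA.
move: gg; rewrite -[catalogue 7](cat_take_drop 160) mem_cat => /orP[gg|gg].
  by left; have := packs_all_certified certified7 isT gg D; rewrite mul0r.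
by right; exists lab, g.
Qed.

Lemma ten7 A F : #|A| = 10%N -> missing A F = 7%N -> exists w : {set T} -> R, packs A F w 1.
Proof.
move=> cA mA; case: (ten7_cases cA mA) => [[w pw]|[lab [g [gg D]]]].
  by exists w; apply: packs_le pw _.
case/andP: certified_stubborn => h1 h2.
move: gg; rewrite -[stubborn](cat_take_drop 3) mem_cat => /orP[gg|gg].
  by have := packs_all_certified h1 isT gg D; clear; rewrite divff // pnatr_eq0.
by have := packs_all_certified h2 isT gg D; clear; rewrite divff // pnatr_eq0.
Qed.

Lemma ten8 A F : #|A| = 10%N -> missing A F = 8%N -> {in A, forall v, degree A F v <= 4}%N ->
  exists w : {set T} -> R, packs A F w 1.
Proof.
move=> cA mA dA; have [lab [g [gg D]]] := catalogue_drawn8 cA mA dA.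
by have := packs_all_certified certified8 isT gg D; rewrite divff // pnatr_eq0.
Qed.

(** Each further missing pair costs at most twice the cap, by [excess_reset]. *)
Lemma ten_more m A F c M : #|A| = 10%N -> missing A F = (8 + m)%N -> {in A, forall v, degree A F v <= 4}%N ->
  capped A F c M -> excess A F c <= (2 * m + 1)%N%:R * M.
Proof.
elim: m F c => [|m IH] F c cA mA dA capc; first by have [w pw] := ten8 cA mA dA; exact: packs_capped pw capc.
have /card_gt0P[f] : (0 < #|F :&: pairs A|)%N by have := mA; rewrite /missing => ->.
rewrite in_setI => /andP[fF fA]; have [M0 hM] := capc.
have := excess_reset fF fA (capped_tame capc); set c' := reset _ _ _ => h.
have capc' : capped A (F :\ f) c' M.
  split=> // p; rewrite present_setD1 // in_setU1 /c' /reset.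
  by case: eqP => [_ _|_ /= /hM //]; lra.
have := IH (F :\ f) c' cA _ _ capc'.
rewrite (_ : (2 * m.+1 + 1)%N%:R = (2 * m + 1)%N%:R + 2); last by rewrite -natrD; congr _%:R; lia.
move=> /(_ _ _) h2; rewrite mulrDl; apply: le_trans h _; rewrite lerD2r; apply: h2.
  by have := missing_setD1 fF fA; rewrite mA => -[->]; rewrite addnS.
by move=> v vA; apply: leq_trans (dA v vA); rewrite (degree_setD1 v fF fA) leq_addl.
Qed.
End TenPacks.

(** * Passing weight on to a new vertex *)

Section Caps.
Variable T : finType.
Implicit Types (A B N H : {set T}) (F : {set {set T}}) (p t : {set T}).

Lemma degree_full A v : v \in A -> degree A setT v = #|A|.-1.
Proof.
move=> vA; have := degree_neighbours setT vA.
rewrite (_ : neighbours A setT v = set0) ?cards0; last first.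
  by apply/setP => u; rewrite !inE !andbF.
by rewrite addn1 => <-.
Qed.

(** Each vertex of [A] lies in [#|A| - 1] pairs. *)
Lemma pairs_cap A H : \sum_(p in pairs A) #|p :&: H| = #|A :&: H| * #|A|.-1.
Proof.
have := @sum_degree_cap T A setT (A :&: H) (subsetIl _ _); rewrite setTI.
have -> : \sum_(v in A :&: H) degree A setT v = \sum_(v in A :&: H) #|A|.-1.
  by apply: eq_bigr => v; rewrite in_setI => /andP[vA _]; exact: degree_full.
rewrite sum_nat_const => ->; apply: eq_bigr => p; rewrite inE => /andP[pA _].
by rewrite setIA (setIidPl pA).
Qed.

Lemma pairs_within A H : \sum_(p in pairs A) (p \subset H) = 'C(#|A :&: H|, 2).
Proof.
rewrite -card_pairs -sum1_card big_mkcond [RHS]big_mkcond /=; apply: eq_bigr => p _.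
by rewrite !inE subsetI; case: (p \subset A); case: (p \subset H); case: (_ == 2).
Qed.
End Caps.

Section Fourth.
Local Open Scope ring_scope.
Variables (R : realFieldType) (T : finType).
Implicit Types (A B N W H : {set T}) (F S C : {set {set T}}) (p q t e : {set T}) (c w : {set T} -> R).

Lemma sum_coverage A F w (f : {set T} -> R) :
  \sum_(p in present A F) coverage A F w p * f p = \sum_(t in triangles A F) w t * \sum_(p in pairs t) f p.
Proof.
under eq_bigr do rewrite mulr_suml; under [RHS]eq_bigr do rewrite mulr_sumr.
rewrite (exchange_big_dep (mem (triangles A F))) /=; last by move=> p t _ /andP[].
apply: eq_bigr => t tA; apply: eq_bigl => p; apply/andP/idP => [[pA /andP[_ pt]]|pt].
  by rewrite inE pt; move: pA; rewrite in_setD => /andP[_ /card_pair ->].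
by split; [exact: triangles_pairs tA pt|rewrite tA; exact: pair_sub pt].
Qed.

(** Sum over all present pairs the number [2] for pairs inside [N], minus half the number of ends in [N].
    On the pairs of a triangle it adds up to 3 inside [N] and to at most 0 otherwise, and the packing
    covers each pair exactly once, so the sum is at most three times the weight inside [N]; over all
    present pairs it is at least 1. *)
Lemma inner_weight A F N w : #|A| = 10%N -> N \subset A -> #|N| = 6%N -> (missing N F <= 1)%N -> packs A F w 0 ->
  1 <= 3 * \sum_(t in triangles N F) w t.
Proof.
move=> cA sN cN mN pw; have [h1 _ _] := pw.
pose tau p : R := 2 * (p \subset N)%:R - 2^-1 * #|p :&: N|%:R.
have AN : A :&: N = N by rewrite setIC; apply/setIidPl.
have full B : \sum_(p in pairs B) tau p = 2 * 'C(#|B :&: N|, 2)%:R - 2^-1 * (#|B :&: N| * #|B|.-1)%N%:R.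
  by rewrite sumrB -!mulr_sumr -!natr_sum pairs_within pairs_cap.
have low : 1 <= \sum_(p in present A F) tau p.
  have : \sum_(p in pairs A) tau p = 3 by rewrite full AN cA cN (_ : 'C(6, 2) = 15)%N //=; lra.
  rewrite (big_setID F) /= => e3.
  have : \sum_(p in pairs A :&: F) tau p <= 2 * (missing N F)%:R.
    rewrite sumrB -!mulr_sumr -!natr_sum lerBlDr.
    have -> : (\sum_(p in pairs A :&: F) (p \subset N) = missing N F)%N.
      rewrite /missing -sum1_card big_mkcond [RHS]big_mkcond /=; apply: eq_bigr => p _.
      rewrite !inE; case pN: (p \subset N); rewrite ?andbF //=; last by case: (_ && _).
      by rewrite (subset_trans pN sN); case: (p \in F); case: (_ == _).
    by rewrite lerDl mulr_ge0 ?invr_ge0 ?ler0n.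
  have : (missing N F)%:R <= 1 :> R by rewrite (ler_nat _ _ 1).
  by rewrite /present; lra.
apply: le_trans low _.
have -> : \sum_(p in present A F) tau p = \sum_(p in present A F) coverage A F w p * tau p.
  by apply: eq_bigr => p pA; rewrite (packs_exact pw pA) mul1r.
rewrite sum_coverage mulr_sumr.
have sT : triangles N F \subset triangles A F.
  by apply/subsetP => t; rewrite !inE => /and3P[tN -> ->]; rewrite (subset_trans tN sN).
rewrite (big_setID (triangles N F)) /= (setIidPr sT) -[leRHS]addr0; apply: lerD.
  apply: ler_sum => t; rewrite inE => /and3P[tN /eqP ct _].
  have -> : \sum_(p in pairs t) tau p = 3 by rewrite full (setIidPl tN) ct (_ : 'C(3, 2) = 3)%N //=; lra.
  by rewrite mulrC.
apply: sumr_le0 => t; rewrite in_setD => /andP[tN tA].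
have /andP[w0 _] := h1 t tA; move: (tA); rewrite inE => /and3P[_ /eqP ct dt].
rewrite mulr_ge0_le0 // full ct.
have : (#|t :&: N| <= 2)%N.
  rewrite -ltnS -ct ltn_neqAle subset_leq_card ?subsetIl // andbT.
  apply: contra tN => /eqP e; rewrite inE ct dt eqxx !andbT.
  by apply/setIidPl/eqP; rewrite eqEcard subsetIl e leqnn.
move: #|t :&: N| => h h2; have : (2 * 'C(h, 2) <= h)%N by case: h h2 => [|[|[|]]].
by rewrite -(ler_nat R) !natrM /=; lra.
Qed.

(** Let [S >= 1/3] be the weight inside the neighbourhood [N] of [x]. A proportion [1 / (3 S)] of each
    triangle [abc] in [N] is replaced by the three triangles [xab], [xbc] and [xac] of the same weight.
    The pairs inside [N] stay covered, and the edges at [x] receive a total of 2 out of 6. *)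
Lemma excess_through A F c M x w : #|A| = 11%N -> x \in A -> #|neighbours A F x| = 6%N ->
  (missing (neighbours A F x) F <= 1)%N -> packs (A :\ x) F w 0 -> capped A F c M -> excess A F c <= 4 * M.
Proof.
move=> cA xA cN mN pw [M0 hM]; set N := neighbours A F x in cN mN.
have cB : #|A :\ x| = 10%N by have := cardsD1 x A; rewrite xA cA; case.
have sN : N \subset A :\ x by apply/subsetP => u; rewrite !inE => /and3P[-> -> _].
have := inner_weight cB sN cN mN pw; set S := \sum_(t in _) _ => hS.
have [h1 h2 h3] := pw.
have w0 t : t \in triangles N F -> 0 <= w t.
  move=> tN; have /h1/andP[] // : t \in triangles (A :\ x) F.
  by move: tN; rewrite !inE => /and3P[tN -> ->]; rewrite (subset_trans tN sN).
have S0 : 0 < S by lra.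
pose lam := (3 * S)^-1; have lam0 : 0 <= lam by rewrite invr_ge0; lra.
have lam1 : lam <= 1 by rewrite invf_le1; lra.
have lamS : lam * S = 3^-1 by rewrite /lam invfM -mulrA mulVf ?mulr1 // gt_eqF.
pose th p := lam * coverage N F w p.
have th0 p : 0 <= th p by rewrite mulr_ge0 // sumr_ge0 // => t /andP[tN _]; exact: w0.
have th1 p : th p <= 3^-1.
  rewrite -lamS ler_wpM2l // /S [leRHS](bigID (fun t => p \subset t)) /= lerDl.
  by apply: sumr_ge0 => t /andP[tN _]; exact: w0.
rewrite (excess_split F c xA) -/N.
pose w' t := if t \in triangles N F then (1 - lam) * w t else w t.
have h1' t : t \in triangles (A :\ x) F -> 0 <= w' t <= 2^-1.
  move=> tB; have /andP[a b] := h1 t tB; rewrite /w'; case: ifP => _; last by rewrite a.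
  rewrite mulr_ge0 ?subr_ge0 //=; apply: le_trans b; rewrite -[leRHS]mul1r; apply: ler_wpM2r => //; lra.
have sT : triangles N F \subset triangles (A :\ x) F.
  by apply/subsetP => t; rewrite !inE => /and3P[tN -> ->]; rewrite (subset_trans tN sN).
have eq1 : excess (A :\ x) F c <= \sum_(p in present N F) th p * c p.
  apply: le_trans (weak_duality c h1') _.
  have sP : present N F \subset present (A :\ x) F by exact: presentS.
  rewrite (big_setID (present N F)) /= (setIidPr sP) [X in _ + X]big1 ?addr0; last first.
    move=> p; rewrite in_setD => /andP[pN pB]; rewrite -/(coverage _ _ _ p).
    rewrite (_ : coverage _ _ _ _ = 1) ?subrr ?mul0r // -(packs_exact pw pB) /coverage.
    apply: eq_bigr => t /andP[tB pt]; rewrite /w' ifN //; apply: contra pN => tN.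
    apply: (triangles_pairs tN); rewrite inE pt; move: pB; rewrite in_setD => /andP[_ /card_pair ->] //.
  apply: ler_sum => p pN; have pB := subsetP sP _ pN; rewrite le_eqVlt; apply/orP; left; apply/eqP.
  congr (_ * _); rewrite -(packs_exact pw pB) /coverage /th /coverage mulr_sumr.
  rewrite -sumrB big_mkcondr /= [RHS]big_mkcondr /=.
  rewrite (big_setID (triangles N F)) /= (setIidPr sT) [X in _ + X]big1 ?addr0.
    by apply: eq_bigr => t tN; rewrite /w' tN; case: ifP => _ //; lra.
  by move=> t; rewrite in_setD => /andP[tN _]; rewrite /w' (negPf tN) subrr; case: ifP.
have eq2 : \sum_(p in present N F) th p * (c p + \sum_(u in p) c [set x; u])
   <= 2^-1 * \sum_(p in present N F) Num.max 0 (c p + \sum_(u in p) c [set x; u]).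
  rewrite mulr_sumr; apply: ler_sum => p _; set y := c p + _.
  have a := th0 p; have b := th1 p; have d := max0_ge y; have d0 := max0_ge0 y.
  apply: (@le_trans _ _ (th p * Num.max 0 y)); first exact: ler_wpM2l.
  by apply: ler_wpM2r => //; lra.
pose D u := \sum_(p in present N F | u \in p) th p.
have eq3 : \sum_(p in present N F) th p * \sum_(u in p) c [set x; u] = \sum_(u in N) D u * c [set x; u].
  under eq_bigr do rewrite mulr_sumr; under [RHS]eq_bigr do rewrite mulr_suml.
  rewrite (exchange_big_dep (mem N)) /=; last first.
    by move=> p u; rewrite in_setD => /andP[_ /pair_sub/subsetP pN] /pN.
  by apply: eq_bigr => u _.
have sumD : \sum_(u in N) D u = 2.
  have -> : \sum_(u in N) D u = \sum_(p in present N F) th p * 2.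
    rewrite (exchange_big_dep (mem (present N F))) /=; last by move=> u p _ /andP[].
    apply: eq_bigr => p pN; rewrite (eq_bigl (mem p)); last first.
      move=> u; rewrite pN /=; apply/andP/idP => [[]//|up]; split=> //.
      by move: pN; rewrite in_setD => /andP[_ /pair_sub/subsetP]; apply.
    rewrite sumr_const; move: pN; rewrite in_setD => /andP[_ /card_pair ->].
    by rewrite mulr_natr.
  rewrite -mulr_suml -mulr_sumr.
  have -> : \sum_(p in present N F) coverage N F w p = 3 * S.
    transitivity (\sum_(p in present N F) coverage N F w p * 1); first by apply: eq_bigr => p _; rewrite mulr1.
    rewrite /S mulr_sumr sum_coverage; apply: eq_bigr => t; rewrite inE => /and3P[_ /eqP ct _].
    by rewrite sumr_const card_pairs ct mulrC (_ : 'C(3, 2) = 3)%N.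
  by rewrite mulrCA lamS; lra.
have D1 u : D u <= 1.
  have -> : D u = lam * \sum_(p in present N F) coverage N F w p * (u \in p)%:R.
    rewrite /D mulr_sumr big_mkcondr /=; apply: eq_bigr => p _.
    by rewrite /th; case: (u \in p); rewrite ?mulr1 ?mulr0.
  have : \sum_(p in present N F) coverage N F w p * (u \in p)%:R <= 2 * S.
    rewrite sum_coverage /S mulr_sumr; apply: ler_sum => t tN; rewrite mulrC; apply: ler_wpM2r; first exact: w0.
    rewrite -natr_sum (ler_nat _ _ 2); move: tN; rewrite inE => /and3P[_ /eqP ct _].
    have -> : (\sum_(p in pairs t) (u \in p) = \sum_(p in pairs t) #|p :&: [set u]|)%N.
      apply: eq_bigr => p _; rewrite setIC; case: (boolP (u \in p)) => up.
        by rewrite (setIidPl _) ?sub1set // cards1.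
      by apply/esym/eqP; rewrite cards_eq0 setI_eq0 disjoints1.
    rewrite pairs_cap ct; have : (#|t :&: [set u]| <= 1)%N by rewrite -(cards1 u) subset_leq_card // subsetIr.
    by clear; lia.
  move=> h; apply: (@le_trans _ _ (lam * (2 * S))); first exact: ler_wpM2l.
  by rewrite mulrCA lamS; lra.
have eq4 : \sum_(u in N) (1 - D u) * c [set x; u] <= 4 * M.
  apply: (@le_trans _ _ (\sum_(u in N) (1 - D u) * M)).
    by apply: ler_sum => u uN; apply: ler_wpM2l; [rewrite subr_ge0|exact/hM/present_link].
  by rewrite -mulr_suml sumrB sumD sumr_const cN; apply: ler_wpM2r => //; lra.
have : \sum_(u in N) (1 - D u) * c [set x; u] = \sum_(u in N) c [set x; u] - \sum_(u in N) D u * c [set x; u].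
  by rewrite -sumrB; apply: eq_bigr => u _; rewrite mulrBl mul1r.
have : \sum_(p in present N F) th p * (c p + \sum_(u in p) c [set x; u]) =
    \sum_(p in present N F) th p * c p + \sum_(p in present N F) th p * \sum_(u in p) c [set x; u].
  by rewrite -big_split; apply: eq_bigr => p _; rewrite mulrDr.
lra.
Qed.

(** Four vertices of degree 4 meet [16 - missing H F] missing pairs, at most 11, so at least five of the
    six pairs between them are missing and at most one missing pair avoids them all. *)
Lemma four_hubs A F H : H \subset A -> #|H| = 4%N -> {in H, forall v, degree A F v = 4%N} -> missing A F = 11%N ->
  exists2 x, x \in H & (missing (neighbours A F x) F <= 1)%N.
Proof.
move=> sH cH dH mA; have := degree_subset F sH; rewrite mA (eq_bigr _ dH) sum_nat_const cH => eH.
have bH := missing_bin H F; rewrite cH in bH.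
have b6 : 'C(4, 2) = 6%N by [].
have [x xH dx] : exists2 x, x \in H & (2 < degree H F x)%N.
  apply/exists_inP; apply/negbNE/negP; rewrite negb_exists_in => /forall_inP h.
  have := handshake H F; have : (\sum_(v in H) degree H F v <= \sum_(v in H) 2)%N.
    by apply: leq_sum => v /h; rewrite -leqNgt.
  by rewrite sum_nat_const cH; move: eH bH; rewrite b6; clear; lia.
exists x => //; have n0 : neighbours H F x = set0.
  by apply/eqP; rewrite -cards_eq0; have := degree_neighbours F xH; rewrite cH; move: dx; clear; lia.
apply: leq_trans (_ : missing (A :\: H) F <= 1)%N; last by move: eH bH; rewrite b6; clear; lia.
apply: subset_leq_card; apply: setIS; apply: pairsS; apply/subsetP => u.
rewrite inE in_setD => /and3P[uA ux xu]; rewrite uA andbT; apply/negP => uH.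
have : u \in neighbours H F x by rewrite inE uH ux.
by rewrite n0 inE.
Qed.

End Fourth.

(** * Eleven vertices *)

Section Eleven.
Local Open Scope ring_scope.
Variables (R : realFieldType) (T : finType).
Implicit Types (A B N W H : {set T}) (F S C : {set {set T}}) (p q t e : {set T}) (c w : {set T} -> R).

Lemma eleven_average A F c M (f : T -> nat) k : #|A| = 11%N -> 0 <= M ->
  (forall v, v \in A -> excess (A :\ v) F c <= (f v)%:R * M) -> (\sum_(v in A) f v <= 9 * k)%N ->
  excess A F c <= k%:R * M.
Proof.
move=> cA M0 hf hk; have A2 : (2 < #|A|)%N by rewrite cA.
have := excess_average F c A2; rewrite cA => e.
have h1 : \sum_(v in A) excess (A :\ v) F c <= (9 * k)%N%:R * M.
  apply: (@le_trans _ _ ((\sum_(v in A) f v)%N%:R * M)); last by apply: ler_wpM2r; rewrite ?ler_nat.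
  by rewrite natr_sum mulr_suml; apply: ler_sum.
have h3 : 0 <= \sum_(t in triangles A F) Num.max 0 (cost c t) by apply: sumr_ge0 => t _; exact: max0_ge0.
by move: h1; rewrite natrM; lra.
Qed.

Lemma eleven_few_core A F c : #|A| = 11%N -> (#|A :\: isolated A F| <= 6)%N -> (missing A F <= 10)%N -> excess A F c <= 0.
Proof.
move=> cA w6 m10; have := card_core A F; rewrite cA => hc.
apply: spread_few; [lia|lia|].
have -> : #|isolated A F| = (11 - #|A :\: isolated A F|)%N by lia.
move: #|A :\: isolated A F| w6 => w w6.
have m20 : (2 * missing A F <= 20)%N by lia.
apply: (@leq_trans ((11 - w) * (w + 1) + 20 + w)%N); first by rewrite leq_add2r leq_add2l.
by case: w w6 => [|[|[|[|[|[|[|//]]]]]]].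
Qed.

(** Declaring a pair present can only make more vertices isolated. *)
Lemma core_reset A F f : (#|A :\: isolated A (F :\ f)| <= #|A :\: isolated A F|)%N.
Proof.
apply: subset_leq_card; apply/subsetP => v; rewrite !in_setD !inE; case: (v \in A) => //=; rewrite !andbT -!lt0n => h.
apply: leq_trans h _; apply: subset_leq_card; apply/subsetP => p; rewrite !inE.
by case/andP => /andP[/andP[_ ->] ->] ->.
Qed.

Lemma bound_ten : deficit_bound R T 0 10.
Proof.
move=> A F c mu cA mA _; rewrite mul0r; have [|w pw] := ten6 R cA (F := F); first by lia.
exact: packs0_excess pw.
Qed.

Section Fixed.
Variables (A : {set T}) (F : {set {set T}}).
Hypothesis cA : #|A| = 11%N.

Lemma card_delete v : v \in A -> #|A :\ v| = 10%N.
Proof. by move=> vA; have := cardsD1 v A; rewrite vA cA; case. Qed.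

Lemma delete_tame v c mu : tame A F c mu -> tame (A :\ v) F c mu.
Proof. by apply: tameS; apply: presentS => //; exact: subD1set. Qed.

Lemma delete_capped v c M : capped A F c M -> capped (A :\ v) F c M.
Proof. by apply: cappedS; apply: presentS => //; exact: subD1set. Qed.

Lemma delete_few v c : v \in A -> (missing A F <= degree A F v + 6)%N -> excess (A :\ v) F c <= 0.
Proof.
move=> vA h; have [|w pw] := ten6 R (card_delete vA) (F := F); first by have := missingD1 A F v; lia.
exact: packs0_excess pw.
Qed.

Hypothesis dA : {in A, forall v, degree A F v <= 4}%N.

Lemma delete_degree v : v \in A -> {in A :\ v, forall u, degree (A :\ v) F u <= 4}%N.
Proof.
by move=> vA u uB; have uA : u \in A by [move: uB; rewrite in_setD1 => /andP[]]; apply: leq_trans (degree_deleteS F v uA) (dA uA).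
Qed.

(** The weights for these graphs leave only 1/2 uncovered, which a tame cost turns into at most [mu]. *)
Lemma leaf_excess c mu y lab g : y \in A -> degree A F y = 1%N -> g \in stubborn -> drawn 10 lab (A :\ y) F g ->
  tame A F c mu -> excess A F c <= mu.
Proof.
move=> yA dy gs D tc; have [lab' [g' [gx D']]] := attachment_drawn yA gs D dA; rewrite dy in gx.
have [lab2 [h [hh D2]]] := listed_drawn leaves_complete gx D'.
have [w pw] := packs_all_certified R certified_leaves isT hh D2.
by have := packs_capped pw (tame_capped tc); clear; lra.
Qed.

Lemma spread_excess c M y lab g : y \in A -> degree A F y = 4%N -> g \in stubborn -> drawn 10 lab (A :\ y) F g ->
  capped A F c M -> excess A F c <= 4 * M.
Proof.
move=> yA dy gs D capc; have [lab' [g' [gx D']]] := attachment_drawn yA gs D dA; rewrite dy in gx.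
have [lab2 [h [hh D2]]] := listed_drawn spreads_complete gx D'.
have [w pw] := packs_all_certified R certified_spreads isT hh D2.
by have := packs_capped pw capc; clear; lra.
Qed.

(** The uncovered weight known for ten vertices with [m] missing pairs. *)
Definition price m := (if m <= 6 then 0 else if m == 7 then 1 else 2 * m - 15)%N.

Lemma delete_price v c M : v \in A -> capped A F c M -> excess (A :\ v) F c <= (price (missing A F - degree A F v))%:R * M.
Proof.
move=> vA capc; have [M0 _] := capc; have cB := card_delete vA.
have -> : (missing A F - degree A F v = missing (A :\ v) F)%N by rewrite -(missingD1 A F v) addnK.
rewrite /price; case: leqP => [m6|m7].
  by have [w pw] := ten6 R cB m6; rewrite mul0r; exact: packs0_excess pw.
case: eqP => [m8|/eqP m8].
  by have [w pw] := ten7 R cB m8; exact: packs_capped pw (delete_capped v capc).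
have e : missing (A :\ v) F = (8 + (missing (A :\ v) F - 8))%N by lia.
have := ten_more cB e (delete_degree vA) (delete_capped v capc).
by rewrite (_ : 2 * _ + 1 = 2 * missing (A :\ v) F - 15)%N //; lia.
Qed.

(** Weights that cover everything would make the excess nonpositive. *)
Lemma delete_stubborn v c : v \in A -> missing A F = (degree A F v + 7)%N -> 0 < excess (A :\ v) F c ->
  exists lab g, g \in stubborn /\ drawn 10 lab (A :\ v) F g.
Proof.
move=> vA e pos; have m7 : missing (A :\ v) F = 7%N by have := missingD1 A F v; rewrite e addnC => /addnI.
case: (ten7_cases R (card_delete vA) m7) => // -[w pw].
by have := packs0_excess c pw; rewrite leNgt pos.
Qed.

Lemma card_isolated : (\sum_(v in A) (degree A F v == 0) = #|isolated A F|)%N.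
Proof.
rewrite -sum1_card big_mkcond [RHS]big_mkcond /=; apply: eq_bigr => v _; rewrite inE.
by case: (v \in A); case: (_ == _).
Qed.

(** At most four vertices are isolated, and the deletion of each costs at most [2 mu], while [9 mu] is
    available. *)
Lemma eleven_missing8 c mu : missing A F = 8%N -> (6 < #|A :\: isolated A F|)%N -> tame A F c mu -> excess A F c <= 1%N%:R * mu.
Proof.
move=> mA w7 tc; have [mu0 _ _] := tc; have hc := card_core A F; rewrite cA in hc.
have [/exists_inP[y yA /andP[/eqP dy pos]]|none] := boolP [exists y in A, (degree A F y == 1%N) && (0 < excess (A :\ y) F c)].
  have [|lab [g [gs D]]] := delete_stubborn yA _ pos; first by rewrite mA dy.
  by rewrite mul1r; exact: leaf_excess yA dy gs D tc.
apply: (@eleven_average A F c mu (fun v => 2 * (degree A F v == 0))%N 1 cA mu0) => [v vA|]; last first.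
  by rewrite -big_distrr /= card_isolated; move: hc w7; clear; lia.
case: (ltngtP (degree A F v) 1) => [|d2|d1].
- rewrite ltnS leqn0 => /eqP d0; have m8 : missing (A :\ v) F = 8%N by have := missingD1 A F v; rewrite d0 addn0 mA.
  have [w pw] := ten8 R (card_delete vA) m8 (delete_degree vA).
  by have := packs_capped pw (tame_capped (delete_tame v tc)); rewrite d0 mul1r.
- rewrite (_ : _ == _ = false) ?mul0r; last by apply/negbTE; rewrite -lt0n; apply: ltnW.
  by apply: delete_few => //; rewrite mA; move: d2; clear; lia.
rewrite d1 mul0r; move: none; rewrite negb_exists_in => /forall_inP/(_ v vA).
by rewrite d1 eqxx /= -leNgt.
Qed.

(** Deleting an isolated vertex costs 3 and any core vertex at most 1, but a vertex of largest degree
    costs nothing; with at most four isolated vertices this stays below the available 18. *)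
Lemma eleven_missing9 c M : missing A F = 9%N -> (6 < #|A :\: isolated A F|)%N -> capped A F c M -> excess A F c <= 2%N%:R * M.
Proof.
move=> mA w7 capc; have [M0 _] := capc; have hc := card_core A F; rewrite cA in hc.
have [a aA [da ea]] : exists2 a, a \in A & (0 < degree A F a)%N /\ excess (A :\ a) F c <= 0.
  have [/exists_inP[a aA da]|none] := boolP [exists a in A, 2 < degree A F a]%N.
    exists a => //; split; first by apply: ltn_trans da.
    by apply: delete_few => //; rewrite mA; move: da; clear; lia.
  move: none; rewrite negb_exists_in => /forall_inP none.
  have [a aA da] : exists2 a, a \in A & (1 < degree A F a)%N.
    apply/exists_inP; apply/negbNE/negP; rewrite negb_exists_in => /forall_inP h.
    have : (\sum_(v in A) degree A F v <= \sum_(v in A) 1)%N by apply: leq_sum => v /h; rewrite -leqNgt.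
    by rewrite handshake sum1_card mA cA.
  exists a => //; split; first by apply: ltnW.
  have d2 : degree A F a = 2%N by apply/eqP; rewrite eqn_leq da leqNgt none.
  rewrite leNgt; apply/negP => pos.
  have [|lab [g [gs D]]] := delete_stubborn aA _ pos; first by rewrite mA d2.
  have [_ _ [b bB [_ db]] _] := stubborn_drawn gs D.
  have bA : b \in A by move: bB; rewrite in_setD1 => /andP[].
  have := none b bA; rewrite -leqNgt => h; have := leq_trans (degree_deleteS F a bA) h.
  by move: db; clear; lia.
apply: (@eleven_average A F c M (fun v => if v == a then 0 else 1 + 2 * (degree A F v == 0))%N 2 cA M0) => [v vA|]; last first.
  have : (\sum_(v in A) (1 + 2 * (degree A F v == 0)) = 11 + 2 * #|isolated A F|)%N.
    by rewrite big_split /= sum1_card cA -big_distrr /= card_isolated.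
  rewrite (bigD1 a) //= [X in (X <= _)%N](bigD1 a) //= eqxx.
  rewrite (_ : degree A F a == 0 = false)%N; last by apply/negbTE; rewrite -lt0n.
  rewrite [X in (0 + X)%N](eq_bigr (fun v => 1 + 2 * (degree A F v == 0))%N); last by move=> v /andP[_ /negPf ->].
  by move: hc w7; clear; lia.
case: eqP => [->|_]; first by rewrite mul0r.
apply: le_trans (delete_price vA capc) _; apply: ler_wpM2r => //; rewrite ler_nat mA.
by move: (dA vA); case: (degree A F v) => [|[|[|[|[|d]]]]].
Qed.

(** The price of deleting a vertex of degree [d] is at most [4 - d], and 5 for [d = 0]. With eight core
    vertices this is enough. With seven, deleting a vertex of degree 3 is free, since an exceptional graph
    has at least eight core vertices; and not all core degrees can be 1 or 4, as their sum 20 is not 7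
    modulo 3. *)
Lemma eleven_missing10 c M : missing A F = 10%N -> (6 < #|A :\: isolated A F|)%N -> capped A F c M -> excess A F c <= 3%N%:R * M.
Proof.
move=> mA w7 capc; have [M0 _] := capc; have hc := card_core A F; rewrite cA in hc.
have sd := handshake A F; rewrite mA in sd.
have [w8|w8] := ltnP 7 #|A :\: isolated A F|.
  apply: (@eleven_average A F c M (fun v => price (10 - degree A F v))%N 3 cA M0) => [v vA|].
    by have := delete_price vA capc; rewrite mA.
  have : (\sum_(v in A) (price (10 - degree A F v) + degree A F v) <= \sum_(v in A) (4 + (degree A F v == 0)))%N.
    by apply: leq_sum => v /dA; case: (degree A F v) => [|[|[|[|[|d]]]]].
  rewrite !big_split /= sd sum_nat_const cA card_isolated; move: hc w8; clear; lia.
have e7 : #|A :\: isolated A F| = 7%N by apply/eqP; rewrite eqn_leq w8 w7.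
have [/exists_inP[a aA da]|none] := boolP [exists a in A, (degree A F a == 2) || (degree A F a == 3)]%N; last first.
  have : (\sum_(v in A) degree A F v = \sum_(v in A) (3 * (degree A F v == 4) + (degree A F v != 0)))%N.
    apply: eq_bigr => v vA; move: none; rewrite negb_exists_in => /forall_inP/(_ v vA); have := dA vA.
    by case: (degree A F v) => [|[|[|[|[|d]]]]].
  rewrite sd big_split /= -big_distrr /=.
  have -> : (\sum_(v in A) (degree A F v != 0) = 7)%N.
    rewrite -e7 -sum1_card big_mkcond [RHS]big_mkcond /=; apply: eq_bigr => v _; rewrite in_setD inE.
    by case: (v \in A); rewrite ?andbF //=; case: (_ == _).
  by clear; lia.
apply: (@eleven_average A F c M (fun v => if degree A F v == 3 then 0 else price (10 - degree A F v))%N 3 cA M0) => [v vA|].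
  case: eqP => [d3|_]; last by have := delete_price vA capc; rewrite mA.
  rewrite mul0r leNgt; apply/negP => pos.
  have [|lab [g [gs D]]] := delete_stubborn vA _ pos; first by rewrite mA d3.
  have [_ w9 _ _] := stubborn_drawn gs D; move: w9; rewrite ltnNge => /negP; apply; rewrite -e7.
  apply: subset_leq_card; apply/subsetP => u; rewrite !in_setD !inE.
  case: (u == v) => //=; rewrite ?andbF //; case uA: (u \in A) => //=; rewrite !andbT -!lt0n => h.
  exact: leq_trans h (degree_deleteS F v uA).
have : (\sum_(v in A) ((if degree A F v == 3 then 0 else price (10 - degree A F v)) + degree A F v
     + ((degree A F v == 2) || (degree A F v == 3))) <= \sum_(v in A) (4 + (degree A F v == 0)))%N.
  by apply: leq_sum => v /dA; case: (degree A F v) => [|[|[|[|[|d]]]]].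
have : (0 < \sum_(v in A) ((degree A F v == 2) || (degree A F v == 3)))%N by rewrite (bigD1 a) //= da.
rewrite !big_split /= sd sum_nat_const cA card_isolated; move: hc e7; clear; lia.
Qed.

(** The price of deleting a vertex of degree [d < 4] is [7 - 2 d], which adds up to 33 and one for each
    vertex of degree 4; 36 is available. With four or more vertices of degree 4, one of them satisfies the
    hypotheses of [excess_through]. *)
Lemma eleven_missing11 c M : missing A F = 11%N -> capped A F c M -> excess A F c <= 4%N%:R * M.
Proof.
move=> mA capc; have [M0 _] := capc.
have sd := handshake A F; rewrite mA in sd.
have [/exists_inP[y yA /andP[/eqP dy pos]]|none] := boolP [exists y in A, (degree A F y == 4%N) && (0 < excess (A :\ y) F c)].
  have [|lab [g [gs D]]] := delete_stubborn yA _ pos; first by rewrite mA dy.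
  exact: spread_excess yA dy gs D capc.
have [l4|l4] := leqP #|[set v in A | degree A F v == 4%N]| 3.
  apply: (@eleven_average A F c M (fun v => if degree A F v == 4 then 0 else price (11 - degree A F v))%N 4 cA M0) => [v vA|].
    case: eqP => [d4|_]; last by have := delete_price vA capc; rewrite mA.
    rewrite mul0r; move: none; rewrite negb_exists_in => /forall_inP/(_ v vA).
    by rewrite d4 eqxx /= -leNgt.
  have : (\sum_(v in A) ((if degree A F v == 4 then 0 else price (11 - degree A F v)) + 2 * degree A F v)
     <= \sum_(v in A) (7 + (degree A F v == 4)))%N.
    by apply: leq_sum => v /dA; case: (degree A F v) => [|[|[|[|[|d]]]]].
  have -> : (\sum_(v in A) (7 + (degree A F v == 4)) = 77 + #|[set v in A | degree A F v == 4%N]|)%N.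
    rewrite big_split /= sum_nat_const cA -sum1_card; congr (_ + _)%N.
    rewrite big_mkcond [RHS]big_mkcond /=; apply: eq_bigr => v _; rewrite inE.
    by case: (v \in A); case: (_ == _).
  by rewrite big_split /= -big_distrr /= sd; move: l4; clear; lia.
have [H sH cH] := subset_card l4.
have sHA : H \subset A by apply: subset_trans sH _; apply/subsetP => v; rewrite inE => /andP[].
have dH v : v \in H -> degree A F v = 4%N by move=> /(subsetP sH); rewrite inE => /andP[_ /eqP].
have [x xH mN] := four_hubs sHA cH dH mA.
have xA := subsetP sHA _ xH; have dx := dH x xH.
have m7 : missing (A :\ x) F = 7%N by have := missingD1 A F x; rewrite dx mA; clear; lia.
case: (ten7_cases R (card_delete xA) m7) => [[w pw]|[lab [g [gs D]]]].
  apply: (excess_through cA xA _ mN pw capc).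
  by have := degree_neighbours F xA; rewrite dx cA; clear; lia.
exact: spread_excess xA dx gs D capc.
Qed.
End Fixed.

(** Two pairs in the neighbourhood of [x] with weight 1/2 leave 3 units at [x], and one more missing pair
    to [A :\ x]. *)
Lemma eleven_hub5 A F c M x : #|A| = 11%N -> missing A F = 11%N -> x \in A -> degree A F x = 5%N -> capped A F c M ->
  excess A F c <= 4%N%:R * M.
Proof.
move=> cA mA xA dx capc; have [M0 hM] := capc.
have cN : #|neighbours A F x| = 5%N by have := degree_neighbours F xA; rewrite dx cA; clear; lia.
have mN := missing_neighbours F xA; rewrite dx mA in mN.
have [|C sC cC] := @subset_card _ (present (neighbours A F x) F) 2.
  have := card_present (neighbours A F x) F; rewrite cN (_ : 'C(5, 2) = 10)%N //; move: mN; clear; lia.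
have sCp := subset_trans sC (present_pairs _ F).
have := @excess_hub R T A F x C c M xA sC; rewrite cC => h.
apply: le_trans (h _) _ => [F' sF mF'|].
  have cB := card_delete cA xA; have m7 : (missing (A :\ x) F' <= 7)%N.
    by have := missingD1 A F x; rewrite dx mA; move: mF'; clear => /=; lia.
  have cap' : capped (A :\ x) F' c M by apply: cappedS capc; apply: presentS => //; exact: subD1set.
  move: m7; rewrite leq_eqVlt => /orP[/eqP m7|m6].
    by have [w pw] := ten7 R cB m7; have := packs_capped pw cap'; rewrite mul1r.
  by have [w pw] := ten6 R cB m6; apply: le_trans (packs0_excess c pw) M0.
apply: (@le_trans _ _ (M + \sum_(u in neighbours A F x) (1 - (cdeg C u)%:R / 2) * M)).
  rewrite lerD2l; apply: ler_sum => u uN; apply: ler_wpM2l; last by apply: hM; exact: present_link.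
  rewrite subr_ge0 ler_pdivrMr // mul1r (ler_nat _ _ 2) -cC; apply: subset_leq_card.
  by apply/subsetP => p; rewrite inE => /andP[].
rewrite -mulr_suml sumrB -mulr_suml -natr_sum -card_set_pairs // sumr_const cC cN.
by rewrite natrM; lra.
Qed.

(** A vertex of degree at least a third of [12 + k] is settled by [hub], a core of at most six vertices by
    [spread_few]; the other graphs are those of the preceding counts. *)
Lemma eleven_exact k A F c mu : (k <= 4)%N -> #|A| = 11%N -> (missing A F = 7 + k)%N -> tame A F c mu ->
  excess A F c <= k%:R * mu.
Proof.
move=> k4 cA mA tc; have [mu0 _ _] := tc.
have kmu : 0 <= k%:R * mu by apply: mulr_ge0.
have [/exists_inP[a aA da]|] := boolP [exists a in A, 12 + k <= 3 * degree A F a]%N.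
  by apply: (@hub R T k 10 A F c a mu bound_ten) => //; move: k4 mA da; clear; lia.
rewrite negb_exists_in => /forall_inP hd.
have [w6|w7] := leqP #|A :\: isolated A F| 6.
  have [m10|m11] := leqP (missing A F) 10; first exact: le_trans (eleven_few_core c cA w6 m10) kmu.
  have ek : k = 4%N by move: mA m11 k4; clear; lia.
  have /card_gt0P[f] : (0 < #|F :&: pairs A|)%N by rewrite -/(missing A F); apply: leq_trans m11.
  rewrite in_setI => /andP[fF fA]; apply: le_trans (excess_reset fF fA tc) _.
  have : excess A (F :\ f) (reset c f (- (2 * mu))) <= 0.
    apply: eleven_few_core => //; first exact: leq_trans (core_reset _ _ _) w6.
    by have := missing_setD1 fF fA; rewrite mA ek => -[->].
  by rewrite ek; lra.
have dA : (k != 4)%N || [forall v in A, degree A F v != 5] -> {in A, forall v, degree A F v <= 4}%N.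
  move=> hk v vA; have := hd v vA; rewrite -ltnNge => h.
  case/orP: hk => [hk|/forall_inP/(_ v vA) h5]; last by move: h k4 h5; clear; lia.
  by move: hk h k4; clear; lia.
case: k k4 mA kmu hd dA => [|[|[|[|[|//]]]]] _ mA kmu hd dA.
- have d3 v : v \in A -> (degree A F v <= 3)%N by move=> /hd; clear; lia.
  apply: (@eleven_average A F c mu (fun=> 0%N) 0 cA mu0) => [v vA|]; last by rewrite big1.
  rewrite mul0r leNgt; apply/negP => pos.
  have [d0|dpos] := posnP (degree A F v); last first.
    have h6 : (missing A F <= degree A F v + 6)%N by rewrite mA; move: dpos; clear; lia.
    by have := delete_few cA c vA h6; rewrite leNgt pos.
  have [|lab [g [gs D]]] := delete_stubborn cA vA _ pos; first by rewrite mA d0.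
  have [_ _ [b bB [_ db]] _] := stubborn_drawn gs D.
  have bA : b \in A by move: bB; rewrite in_setD1 => /andP[].
  have := leq_trans (degree_deleteS F v bA) (d3 b bA); by move: db; clear; lia.
- exact: eleven_missing8 cA (dA isT) _ _ mA w7 tc.
- by apply: bound_of_capped tc => // c' M capc; exact: eleven_missing9 cA (dA isT) _ _ mA w7 capc.
- by apply: bound_of_capped tc => // c' M capc; exact: eleven_missing10 cA (dA isT) _ _ mA w7 capc.
apply: bound_of_capped tc => // c' M capc.
have [/exists_inP[x xA /eqP dx]|none] := boolP [exists v in A, degree A F v == 5%N].
  exact: eleven_hub5 cA mA xA dx capc.
have h4 : {in A, forall v, degree A F v <= 4}%N by apply: dA; move: none; rewrite negb_exists_in.
exact: eleven_missing11 cA h4 _ _ mA capc.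
Qed.

Lemma bound_eleven k : (k <= 4)%N -> deficit_bound R T k 11.
Proof.
elim: k => [|k IH] k4 A F c mu cA mA tc; have [mu0 _ _] := tc.
  move: mA; rewrite addn0 leq_eqVlt => /orP[/eqP mA|mA].
    by apply: eleven_exact => //; move: mA; clear; lia.
  apply: (@eleven_average A F c mu (fun=> 0%N) 0 cA mu0) => [v vA|]; last by rewrite big1.
  by rewrite mul0r; apply: delete_few => //; move: mA; clear; lia.
move: mA; rewrite leq_eqVlt => /orP[/eqP mA|mA].
  by apply: eleven_exact => //; move: mA; clear; lia.
apply: (@le_trans _ _ (k%:R * mu)); last by apply: ler_wpM2r => //; rewrite ler_nat.
by apply: IH (ltnW k4) _ _ _ _ cA _ tc; move: mA; clear; lia.
Qed.

Lemma bound_all n k : (10 < n)%N -> (k <= 4)%N -> deficit_bound R T k n.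
Proof.
move=> n10; have [m ->] : exists m, n = (m + 11)%N by exists (n - 11)%N; move: n10; clear; lia.
elim: m k => [|m IH] k k4; first exact: bound_eleven.
by apply: (@induction_step R T (m + 11)%N _ IH k k4); clear; lia.
Qed.
End Eleven.

(** * From costs back to packings *)

Section Farkas.
Local Open Scope ring_scope.
Variables (R : realFieldType).

(** The largest lower bound or the smallest upper bound is a solution. *)
Lemma one_variable (I : finType) (a d : I -> R) :
  (forall i, a i = 0 -> 0 <= d i) ->
  (forall p q, 0 < a p -> a q < 0 -> d q / a q <= d p / a p) ->
  exists x, forall i, a i * x <= d i.
Proof.
move=> h0 hpq.
have up x i : 0 < a i -> x <= d i / a i -> a i * x <= d i.
  by move=> ai; rewrite ler_pdivlMr // mulrC.
have dn x i : a i < 0 -> d i / a i <= x -> a i * x <= d i.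
  by move=> ai; rewrite ler_ndivrMr // mulrC.
have [/existsP[q0 q0P]|nq] := boolP [exists q, a q < 0].
  case: (@arg_maxP _ _ _ q0 (fun q => a q < 0) (fun q => d q / a q) q0P) => q aq qmax.
  exists (d q / a q) => i; have [ai|ai|ai] := ltgtP (a i) 0.
  - by apply: dn => //; apply: qmax.
  - by apply: up => //; apply: hpq.
  - by rewrite ai mul0r h0.
have nonneg i : 0 <= a i by rewrite leNgt; move/existsPn: nq => /(_ i).
have [/existsP[p0 p0P]|np] := boolP [exists p, 0 < a p].
  case: (@arg_minP _ _ _ p0 (fun p => 0 < a p) (fun p => d p / a p) p0P) => p ap pmin.
  exists (d p / a p) => i; have := nonneg i; rewrite le_eqVlt => /orP[/eqP ai|ai].
    by rewrite -ai mul0r h0.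
  by apply: up => //; apply: pmin.
exists 0 => i; rewrite mulr0 h0 //; apply/eqP; rewrite eq_le nonneg andbT leNgt.
by move/existsPn: np => /(_ i).
Qed.

(** Fourier-Motzkin elimination of one variable after the other: the rows [inl k] keep an inequality
    without [x j0], the rows [inr (p, q)] combine an upper with a lower bound for it. *)
Lemma farkas (J : eqType) (s : seq J) : uniq s -> forall (I : finType) (a : I -> J -> R) (b : I -> R),
  (exists x : J -> R, forall i, \sum_(j <- s) a i j * x j <= b i) \/
  (exists y : I -> R, [/\ forall i, 0 <= y i, {in s, forall j, \sum_i y i * a i j = 0}
     & \sum_i y i * b i < 0]).
Proof.
elim: s => [_|j0 s IH /= /andP[j0s us]] I a b.
  have [/existsP[i bi]|/existsPn h] := boolP [exists i, b i < 0]; [right|left].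
    exists (fun k => (k == i)%:R); split => //.
    by rewrite (bigD1 i) //= eqxx mul1r big1 ?addr0 // => k /negPf ->; rewrite mul0r.
  by exists (fun=> 0) => i; rewrite big_nil leNgt; apply: h.
pose lam (r : I + I * I) (i : I) : R := match r with
  | inl k => ((k == i) && (a k j0 == 0))%:R
  | inr (p, q) => if (0 < a p j0) && (a q j0 < 0)
                  then (p == i)%:R / a p j0 - (q == i)%:R / a q j0 else 0 end.
have lam0 r i : 0 <= lam r i.
  case: r => [k|[p q]] /=; first by rewrite ler0n.
  case: ifP => // /andP[ap aq]; rewrite subr_ge0; apply: (@le_trans _ _ 0).
    by rewrite ler_ndivrMr // mul0r ler0n.
  by rewrite divr_ge0 ?ler0n // ltW.
have lamE (f : I -> R) p q : 0 < a p j0 -> a q j0 < 0 ->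
    \sum_i lam (inr (p, q)) i * f i = f p / a p j0 - f q / a q j0.
  move=> ap aq; rewrite /= ap aq /=; under eq_bigr do rewrite mulrBl.
  rewrite sumrB (bigD1 p) //= big1 ?addr0; last by move=> i; rewrite eq_sym => /negPf ->; rewrite !mul0r.
  rewrite [X in _ - X](bigD1 q) //= big1 ?addr0; last by move=> i; rewrite eq_sym => /negPf ->; rewrite !mul0r.
  by rewrite !eqxx /= !mulr1n; ring.
have lamL (f : I -> R) k : a k j0 = 0 -> \sum_i lam (inl k) i * f i = f k.
  move=> ak; rewrite (bigD1 k) //= big1 ?addr0 ?eqxx ?ak ?eqxx ?mul1r //.
  by move=> i; rewrite eq_sym => /negPf ->; rewrite mul0r.
have lamj r : \sum_i lam r i * a i j0 = 0.
  case: r => [k|[p q]].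
    have [ak|ak] := eqVneq (a k j0) 0; first by rewrite lamL.
    by apply: big1 => i _; rewrite /= (negPf ak) andbF mul0r.
  have [/andP[ap aq]|h] := boolP ((0 < a p j0) && (a q j0 < 0)).
    by rewrite lamE // divff ?gt_eqF // divff ?lt_eqF // subrr.
  by apply: big1 => i _; rewrite /= (negPf h) mul0r.
have [] := IH us _ (fun r j => \sum_i lam r i * a i j) (fun r => \sum_i lam r i * b i).
  case=> x hx; left.
  have sum_lam r : \sum_(j <- s) (\sum_i lam r i * a i j) * x j =
      \sum_i lam r i * \sum_(j <- s) a i j * x j.
    under eq_bigr do rewrite mulr_suml; rewrite exchange_big; apply: eq_bigr => i _ /=.
    by rewrite mulr_sumr; apply: eq_bigr => j _; rewrite mulrA.
  have {}hx r : \sum_i lam r i * \sum_(j <- s) a i j * x j <= \sum_i lam r i * b i.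
    by rewrite -sum_lam.
  pose sx i := \sum_(j <- s) a i j * x j.
  have [i ai|p q ap aq|x0 hx0] := @one_variable I (a^~ j0) (fun i => b i - sx i).
  - by have := hx (inl i); rewrite !lamL // subr_ge0.
  - by have := hx (inr (p, q)); rewrite !lamE // -/(sx _) -/(sx _) !mulrBl; lra.
  exists (fun j => if j == j0 then x0 else x j) => i; rewrite big_cons eqxx.
  rewrite (_ : \sum_(j <- s) _ = sx i); last first.
    by apply: eq_big_seq => j js; case: eqP js => // ->; rewrite (negPf j0s).
  by have := hx0 i; lra.
case=> y [y0 ya yb]; right; exists (fun i => \sum_r y r * lam r i).
have E (f : I -> R) : \sum_i (\sum_r y r * lam r i) * f i = \sum_r y r * \sum_i lam r i * f i.
  under eq_bigr do rewrite mulr_suml; rewrite exchange_big; apply: eq_bigr => r _ /=.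
  by rewrite mulr_sumr; apply: eq_bigr => i _; rewrite mulrA.
split=> [i|j|]; last by rewrite E.
  by apply: sumr_ge0 => r _; rewrite mulr_ge0.
rewrite inE E => /predU1P[->|js]; last exact: ya.
by apply: big1 => r _; rewrite lamj mulr0.
Qed.

End Farkas.

Section Primal.
Local Open Scope ring_scope.
Variables (R : realFieldType) (T : finType).
Implicit Types (A : {set T}) (F : {set {set T}}) (p t : {set T}) (c : {set T} -> R).

(** If the linear system for [w] had no solution, Farkas' multipliers would be a bound [M] for the
    uncovered weight and [yp] for the pairs, and the cost [M - yp] would violate the hypothesis. *)
Lemma strong_duality A F (K : R) :
  (forall c M, capped A F c M -> excess A F c <= K * M) ->
  exists w : {set T} -> R,
  [/\ forall t, t \in triangles A F -> 0 <= w t <= 2^-1,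
      forall t, t \notin triangles A F -> w t = 0,
      forall p, p \in present A F -> \sum_(t in triangles A F | p \subset t) w t <= 1
    & \sum_(p in present A F) (1 - \sum_(t in triangles A F | p \subset t) w t) <= K].
Proof.
move=> H; set E := present A F; set D := triangles A F.
pose a (r : option ({set T} * 'I_3)) (t : {set T}) : R := match r with
  | None => - 3
  | Some (p, i) => match val i with
    | 0%N => (t == p)%:R | 1%N => - (t == p)%:R | _ => ((p \in E) && (p \subset t))%:R end end.
pose b (r : option ({set T} * 'I_3)) : R := match r with
  | None => K - #|E|%:R
  | Some (p, i) => match val i with 0%N => 2^-1 | 1%N => 0 | _ => 1 end end.
pose i0 : 'I_3 := @Ordinal 3 0 isT; pose i1 : 'I_3 := @Ordinal 3 1 isT; pose i2 : 'I_3 := @Ordinal 3 2 isT.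
have cov3 t : t \in D -> \sum_(p in E | p \subset t) (1 : R) = 3.
  move=> tD; rewrite (eq_bigl (mem (pairs t))); last first.
    move=> p; rewrite [RHS]/=; apply/andP/idP => [[pE pt]|pt].
      by rewrite inE pt; move: pE; rewrite !inE => /andP[_ /andP[]].
    by rewrite (triangles_pairs tD pt) (pair_sub pt).
  by rewrite sumr_const card_pairs; move: tD; rewrite inE => /and3P[_ /eqP -> _].
have sumE (x : {set T} -> R) t0 : \sum_(t in D) (t == t0)%:R * x t = (t0 \in D)%:R * x t0.
  have [tD|tD] := boolP (t0 \in D).
    rewrite (bigD1 t0) //= eqxx big1 ?addr0 // => t /andP[_ /negPf ->]; exact: mul0r.
  rewrite mul0r big1 // => t tD'; case: eqP => [tt|]; rewrite ?mul0r //.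
  by rewrite -tt tD' in tD.
have sum_row (y : option ({set T} * 'I_3) -> R) (f : option ({set T} * 'I_3) -> R) :
    \sum_r y r * f r = y None * f None + (\sum_p y (Some (p, i0)) * f (Some (p, i0)) +
     (\sum_p y (Some (p, i1)) * f (Some (p, i1)) + \sum_p y (Some (p, i2)) * f (Some (p, i2)))).
  rewrite (bigD1 None) //=; congr (_ + _).
  rewrite (reindex_omap (@Some ({set T} * 'I_3)) id) /=; last by case.
  rewrite (eq_bigl predT); last by move=> i; rewrite eqxx.
  rewrite (eq_bigr (fun q => (fun p i => y (Some (p, i)) * f (Some (p, i))) q.1 q.2)); last by case.
  rewrite -(pair_bigA _ (fun p i => y (Some (p, i)) * f (Some (p, i)))) /=.
  rewrite exchange_big big_ord_recl /= big_ord_recl /= big_ord_recl /= big_ord0 addr0.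
  have e1 : lift (ord0 : 'I_3) (ord0 : 'I_2) = i1 by exact: val_inj.
  have e2 : lift (ord0 : 'I_3) (lift (ord0 : 'I_2) (ord0 : 'I_1)) = i2 by exact: val_inj.
  have e0 : ord0 = i0 by exact: val_inj.
  by rewrite e2 e1 e0.
have [[x hx]|[y [y0 ya yb]]] := farkas (enum_uniq (mem D)) a b.
  pose w t := if t \in D then x t else 0.
  have hxD r : \sum_(t in D) a r t * x t <= b r by have := hx r; rewrite big_enum.
  have wcov p : \sum_(t in D | p \subset t) w t = \sum_(t in D | p \subset t) x t.
    by apply: eq_bigr => t /andP[tD _]; rewrite /w tD.
  exists w; split.
  - move=> t tD; rewrite /w tD.
    have := hxD (Some (t, i0)); rewrite /= sumE tD mul1r => ->; rewrite andbT.
    have := hxD (Some (t, i1)); rewrite /=; under eq_bigr do rewrite mulNr.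
    by rewrite sumrN sumE tD mul1r oppr_le0.
  - by move=> t /negPf tD; rewrite /w tD.
  - move=> p pE; rewrite wcov; have := hxD (Some (p, i2)); rewrite /= pE /=.
    rewrite (bigID (fun t : {set T} => p \subset t)) /= [X in _ + X]big1 ?addr0; last first.
      by move=> t /andP[_ /negPf ->]; rewrite mul0r.
    by congr (_ <= _); apply: eq_bigr => t /andP[_ ->]; rewrite mul1r.
  rewrite sumrB sumr_const -/E.
  rewrite (exchange_big_dep (mem D)) /=; last by move=> p t _ /andP[].
  have := hxD None; rewrite /=.
  rewrite (_ : \sum_(t in D) - 3 * x t = - \sum_(t in D) \sum_(p in E | (t \in D) && (p \subset t)) w t).
    by lra.
  rewrite -sumrN; apply: eq_bigr => t tD; rewrite tD /= -(cov3 _ tD) mulNr; congr (- _).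
  by rewrite mulr_suml; apply: eq_bigr => p _; rewrite mul1r /w tD.
exfalso.
set M := y None; pose yp p := y (Some (p, i2)); pose al t := y (Some (t, i0)).
have hy t : t \in D -> 3 * M - \sum_(p in pairs t) yp p <= al t.
  move=> tD; have := ya t; rewrite mem_enum sum_row /= => /(_ tD).
  rewrite -/M (bigD1 t) //= eqxx mulr1 [X in _ + (_ + X + _)]big1 ?addr0; last first.
    by move=> p; rewrite eq_sym => /negPf ->; rewrite mulr0.
  rewrite [X in _ + (_ + (X + _))](bigD1 t) //= eqxx mulrN1 [X in _ + (_ + (_ + X + _))]big1 ?addr0; last first.
    by move=> p; rewrite eq_sym => /negPf ->; rewrite oppr0 mulr0.
  rewrite (_ : \sum_p y (Some (p, i2)) * _ = \sum_(p in pairs t) yp p); last first.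
    rewrite [RHS]big_mkcond /=; apply: eq_bigr => p _.
    have -> : (p \in E) && (p \subset t) = (p \in pairs t).
      apply/andP/idP => [[pE pt]|pt].
        by rewrite inE pt; move: pE; rewrite !inE => /andP[_ /andP[]].
      by rewrite (triangles_pairs tD pt) (pair_sub pt).
    by case: ifP; rewrite ?mulr1 ?mulr0.
  by have := y0 (Some (t, i1)); rewrite -/(al t); lra.
move: yb; rewrite sum_row /= -/M [X in _ + (_ + (X + _))]big1 ?add0r; last by move=> p _; rewrite mulr0.
rewrite -mulr_suml; under [X in _ + (_ + X)]eq_bigr do rewrite mulr1.
pose c p := M - yp p.
have cap : capped A F c M.
  by split=> [|p _]; rewrite ?y0 // /c gerBl y0.
have := H c M cap; rewrite /excess -/E -/D sumrB sumr_const.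
have s1 : \sum_(t in D) Num.max 0 (cost c t) <= \sum_t al t.
  rewrite [leRHS](bigID (mem D)) /=; apply: ler_wpDr; first by apply: sumr_ge0 => t _; exact: y0.
  apply: ler_sum => t tD; rewrite ge_max y0 /=; apply: le_trans (hy _ tD).
  rewrite /cost sumrB sumr_const card_pairs; move: tD; rewrite inE => /and3P[_ /eqP -> _].
  by rewrite (_ : 'C(3, 2) = 3%N) // -[M *+ _]mulr_natl lexx.
have s2 : \sum_(p in E) yp p <= \sum_p yp p.
  by rewrite [leRHS](bigID (mem E)) /= lerDl; apply: sumr_ge0 => t _; exact: y0.
rewrite -mulr_natl; rewrite /yp /al in s1 s2 *.
set X := #|E|%:R; lra.
Qed.

End Primal.

Section FinalStep.
Local Open Scope ring_scope.

Lemma mem_imset_sym (T : finType) (r : rel T) u v : symmetric r ->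
  ([set u; v] \in [set [set x; y] | x in T, y in T & r x y]) = r u v.
Proof.
move=> sr; apply/imset2P/idP => [[x y _]|ruv]; last by exists u v; rewrite ?inE.
by rewrite inE => /andP[_ rxy] /set2_inj[[-> ->]|[-> ->]]; rewrite // sr.
Qed.

(** The number of missing pairs determines an integer deficit [k <= a], to which the bound is applied. *)
Theorem packing_of_bound (R : realType) (n : nat) (a : R) (T : finType) (e : rel T) :
  (11 <= n)%N -> (forall k, (k <= 4)%N -> @deficit_bound R T k n) ->
  0 <= a <= 4 ->
  symmetric e ->
  irreflexive e ->
  #|T| = n ->
  #|missing_edges e|%:R <= n%:R - 4 + a ->
  exists omega : {set T} -> R,
    [/\ fractional_triangle_packing e omega,
        uncovered_weight e omega <= a
      & forall t : {set T}, triangle e t -> omega t <= 1 / 2].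
Proof.
move=> n11 HQ /andP[a0 a4] se ie cT mT.
set A := [set: T]; set F := missing_edges e.
have FP u v : ([set u; v] \in F) = (u != v) && ~~ e u v.
  by apply: mem_imset_sym => x y; rewrite eq_sym se.
have EP u v : ([set u; v] \in edges e) = e u v by exact: mem_imset_sym.
have EE : edges e = present A F.
  apply/setP => p; apply/idP/idP => [|].
    case/imset2P => u v _; rewrite inE => /andP[_ euv] ->.
    have uv : u != v by apply: contraTneq euv => ->; rewrite ie.
    by rewrite in_setD FP euv andbF mem_pairs2 !inE uv.
  rewrite in_setD => /andP[pF /pairsP[u [v [_ _ uv ep]]]].
  by move: pF; rewrite ep FP EP uv negbK.
have TD t : triangle e t = (t \in triangles A F).
  rewrite inE subsetT /triangle /=; case: (#|t| == 3) => //=.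
  apply/forall_inP/idP => [h|d u ut].
    rewrite -setI_eq0; apply/eqP/setP => p; rewrite !in_setI in_set0; apply/negP => /andP[].
    move=> /pairsP[u [v [ut vt uv ->]]]; rewrite FP => /andP[_ /negP]; apply.
    by have /forall_inP/(_ _ vt) := h _ ut; rewrite uv.
  apply/forall_inP => v vt; apply/implyP => uv.
  have := disjointFr d (x := [set u; v]); rewrite mem_pairs2 ut vt uv => /(_ isT).
  by rewrite FP uv => /negbFE.
have mA : missing A F = #|F|.
  rewrite /missing (setIidPl _) //; apply/subsetP => p /imset2P[u v _].
  by rewrite inE => /and3P[_ uv _] ->; rewrite mem_pairs2 !inE uv.
pose k := (missing A F + 4 - n)%N.
have ka : k%:R <= a.
  rewrite /k; have [h|h] := leqP n (missing A F + 4)%N; last by rewrite (eqP (ltnW h)).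
  rewrite natrB // natrD mA; lra.
have k4 : (k <= 4)%N by rewrite -(ler_nat R); apply: le_trans ka a4.
have [w [w01 wD wp wu]] : exists w : {set T} -> R,
  [/\ forall t, t \in triangles A F -> 0 <= w t <= 2^-1,
      forall t, t \notin triangles A F -> w t = 0,
      forall p, p \in present A F -> \sum_(t in triangles A F | p \subset t) w t <= 1
    & \sum_(p in present A F) (1 - \sum_(t in triangles A F | p \subset t) w t) <= k%:R].
  apply: strong_duality => c M cap; apply: (HQ k k4); last exact: capped_tame.
    by rewrite cardsT.
  by rewrite /k; lia.
have cov p : p \in present A F -> edge_weight w p = \sum_(t in triangles A F | p \subset t) w t.
  rewrite in_setD => /andP[_ pA]; have cp := card_pair pA.
  rewrite /edge_weight (bigID (mem p)) /= big1 ?add0r; last first.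
    move=> x xp; apply: wD; rewrite inE (_ : #|_| == 3 = false) ?andbF //.
    by rewrite (setUidPr _) ?sub1set // cp.
  rewrite (eq_bigl (mem (~: p))); last by move=> x; rewrite /= inE.
  rewrite -(big_imset (h := fun x => x |: p) w) /=; last first.
    move=> x y; rewrite !inE => xp yp /setP/(_ x); rewrite !inE eqxx (negPf xp) orbF.
    by rewrite orbF => /esym/eqP.
  rewrite big_mkcond [RHS]big_mkcond /=; apply: eq_bigr => t _.
  have [tD|tD] := boolP (t \in triangles A F); last by rewrite wD // if_same.
  congr (if _ then _ else _); apply/imsetP/idP => [[x _ ->]|pt]; first exact: subsetUr.
  have /set0Pn[x] : t :\: p != set0.
    rewrite -cards_eq0 cardsD (setIidPr pt) cp.
    by move: tD; rewrite inE => /and3P[_ /eqP -> _].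
  rewrite inE => /andP[xp xt]; exists x; first by rewrite !inE.
  apply/eqP; rewrite eq_sym eqEcard subUset sub1set xt pt cardsU1 xp cp.
  by move: tD; rewrite inE => /and3P[_ /eqP -> _].
exists w; split.
- split=> [t|t|p].
  + by rewrite TD => /w01 /andP[-> w2]; apply: le_trans w2 _; lra.
  + by rewrite TD; apply: wD.
  + by rewrite EE => pE; rewrite cov // wp.
- rewrite /uncovered_weight EE; apply: le_trans ka; apply: le_trans wu.
  by apply: ler_sum => p pE; rewrite cov.
by move=> t; rewrite TD => /w01 /andP[_]; rewrite div1r.
Qed.

End FinalStep.

Local Open Scope ring_scope.

Theorem theorem2p1 (R : realType) (n : nat) (a : R) (T : finType) (e : rel T) :
  (11 <= n)%N ->
  0 <= a <= 4 ->
  symmetric e ->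
  irreflexive e ->
  #|T| = n ->
  #|missing_edges e|%:R <= n%:R - 4 + a ->
  exists omega : {set T} -> R,
    [/\ fractional_triangle_packing e omega,
        uncovered_weight e omega <= a
      & forall t : {set T}, triangle e t -> omega t <= 1 / 2].
Proof. by move=> n11; apply: packing_of_bound => // k; exact: bound_all. Qed.
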